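(* Let $\mathcal{W},\mathcal{V}$ be closed subspaces of $L^2(\mathbb{R})$ with $L^2(\mathbb{R})=\mathcal{W}\oplus\mathcal{V}^{\perp}$. Let $\phi,\widetilde{\phi}\in L^2(\mathbb{R})$ be such that $\{T_k\phi\}_{k\in\mathbb{Z}}$ and $\{T_k\widetilde{\phi}\}_{k\in\mathbb{Z}}$ are frames for $\mathcal{W}$ and $\mathcal{V}$, respectively. Assume $\epsilon\ge0$. If $$\big|[\widehat{\phi},\widehat{\widetilde{\phi}}](\gamma)-1\big|\le\frac{\epsilon}{\|\pi_{\mathcal{W}\mathcal{V}^{\perp}}\|}\quad\text{for a.e. }\gamma\in N(\Phi)^{c},$$ then $\{T_k\phi\}_{k\in\mathbb{Z}}$ and $\{T_k\widetilde{\phi}\}_{k\in\mathbb{Z}}$ are $\epsilon$-approximate oblique dual frames.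
   Context: $T_kf(x)=f(x-k)$ for $k\in\mathbb{Z}$. The Fourier transform is $\widehat{f}(\gamma)=\int_{\mathbb{R}}f(x)e^{-2\pi i x\gamma}\,dx$, extended to a unitary operator of $L^2(\mathbb{R})$. For $\phi,\psi\in L^2(\mathbb{R})$, the 1-periodic bracket is $[\widehat{\phi},\widehat{\psi}](\gamma)=\sum_{k\in\mathbb{Z}}\widehat{\phi}(\gamma+k)\overline{\widehat{\psi}(\gamma+k)}$ (a.e. defined, complex valued); $\Phi(\gamma)=\sum_{k\in\mathbb{Z}}|\widehat{\phi}(\gamma+k)|^2$, $N(\Phi)=\{\gamma:\Phi(\gamma)=0\}$; $A^c$ is the complement of $A$ in $\mathbb{R}$. The direct sum $\mathcal{H}=\mathcal{W}\oplus\mathcal{V}^{\perp}$ ($\mathcal{H}=L^2(\mathbb{R})$; equivalently $\mathcal{H}=\mathcal{V}\oplus\mathcal{W}^{\perp}$) is not assumed orthogonal; $\pi_{\mathcal{W}\mathcal{V}^{\perp}}$ is the oblique projection onto $\mathcal{W}$ along $\mathcal{V}^{\perp}$ and $\pi_{\mathcal{V}\mathcal{W}^{\perp}}$ that onto $\mathcal{V}$ along $\mathcal{W}^{\perp}$. A family $\{f_k\}\subset\mathcal{W}$ is a frame for $\mathcal{W}$ if there are $0<\alpha\le\beta<\infty$ with $\alpha\|f\|^2\le\sum_k|\langle f,f_k\rangle|^2\le\beta\|f\|^2$ for all $f\in\mathcal{W}$. For such $\mathcal{F}=\{f_k\}$, $T_{\mathcal{F}}\{c_k\}=\sum_kc_kf_k$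 (synthesis operator on $\ell^2$) and $T_{\mathcal{F}}^{*}f=\{\langle f,f_k\rangle\}_k$. Frames $\mathcal{F}$ for $\mathcal{W}$ and $\mathcal{G}$ for $\mathcal{V}$ are $\epsilon$-approximate oblique dual frames if $\|\pi_{\mathcal{W}\mathcal{V}^{\perp}}-T_{\mathcal{F}}T_{\mathcal{G}}^{*}\|\le\epsilon$ or, equivalently, $\|\pi_{\mathcal{V}\mathcal{W}^{\perp}}-T_{\mathcal{G}}T_{\mathcal{F}}^{*}\|\le\epsilon$. *)

(* Defs.v *)
(* MathComp-Analysis, over an arbitrary [R : realType].
   Complex-valued functions on the line are plain functions [R -> R[i]].
   Elements of L^2(R) are represented by (Borel) measurable functions with finite
   2-norm; a.e. equal functions are not identified syntactically, so every
   equality of elements of L^2(R) below is an a.e. equality. *)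
From HB Require Import structures.
From mathcomp Require Import all_boot all_order all_algebra.
From mathcomp Require Import complex.
From mathcomp Require Import all_classical all_reals all_analysis.
From mathcomp Require Import summability.

Set Implicit Arguments.
Unset Strict Implicit.
Unset Printing Implicit Defensive.

Import Order.TTheory GRing.Theory Num.Theory.
Import numFieldNormedType.Exports.

Local Open Scope classical_set_scope.
Local Open Scope complex_scope.
Local Open Scope ring_scope.

Section L2.
Context {R : realType}.
Local Notation C := R[i].
Local Notation mu := (@lebesgue_measure R).
Implicit Types (f g : R -> C) (W V A B : set (R -> C)) (F G : int -> R -> C).

Definition cmod (z : C) : R := Normc.normc z.

Definition cmeasurable f : Prop :=
  measurable_fun setT (fun x => complex.Re (f x)) /\
  measurable_fun setT (fun x => complex.Im (f x)).

Definition L1norm f : \bar R := 'N[mu]_1[(fun x => (cmod (f x))%:E)]%E.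
Definition L2norm f : \bar R := 'N[mu]_2%:E[(fun x => (cmod (f x))%:E)]%E.

Definition L1 : set (R -> C) := [set f | cmeasurable f /\ (L1norm f < +oo)%E].
Definition L2 : set (R -> C) := [set f | cmeasurable f /\ (L2norm f < +oo)%E].

Definition cintegral f : C :=
  (\int[mu]_x complex.Re (f x)) +i* (\int[mu]_x complex.Im (f x)).

Definition inner f g : C := cintegral (fun x => f x * (g x)^*).

Definition scalef (a : C) f : R -> C := fun x => a * f x.

Definition translate (k : int) f : R -> C := fun x => f (x - k%:~R).

(* Closed in the L^2-norm; [closed_lim] also makes the set invariant under
   modification of its elements on null sets. *)
Record closed_subspace W : Prop := ClosedSubspace {
  subspace_L2 : W `<=` L2;
  subspace0 : W 0;
  subspaceD : forall f g, W f -> W g -> W (f + g);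
  subspaceZ : forall (a : C) f, W f -> W (scalef a f);
  closed_lim : forall (u : nat -> R -> C) f,
    (forall n, W (u n)) -> L2 f ->
    L2norm (u n - f) @[n --> \oo] --> 0%E -> W f
}.

Definition orthocomp V : set (R -> C) :=
  [set f | L2 f /\ forall g, V g -> inner f g = 0].

(* L^2(R) is the algebraic direct sum of A and B, not necessarily orthogonal *)
Definition L2_direct_sum A B : Prop :=
  (forall f, L2 f -> exists a b, [/\ A a, B b & f = a + b]) /\
  (forall f, A f -> B f -> f = 0 %[ae mu]).

(* The projection onto A along B: the component in A of the decomposition of f,
   which is unique up to a.e. equality when [L2_direct_sum A B]. *)
Definition oblique_proj A B f : R -> C := xget 0 [set a | A a /\ B (f - a)].

(* Extended-real operator norm on L^2(R). In a quotient c / opnorm T the extended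
   inverse sends 0 to +oo and +oo to 0; for T the projection onto a subspace W the
   value 0 means that W = {0}, in which case a bound required only where the
   periodization of an element of W is nonzero is required almost nowhere. *)
Definition opnorm (T : (R -> C) -> R -> C) : \bar R :=
  ereal_sup [set L2norm (T f) | f in [set f | L2 f /\ (L2norm f <= 1)%E]].

Definition frame W F : Prop :=
  (forall k, W (F k)) /\
  exists alpha beta : R, [/\ 0 < alpha, alpha <= beta &
    forall f, W f ->
      (alpha%:E * L2norm f ^+ 2
         <= \esum_(k in [set: int]) ((cmod (inner f (F k))) ^+ 2)%:E)%E /\
      (\esum_(k in [set: int]) ((cmod (inner f (F k))) ^+ 2)%:E
         <= beta%:E * L2norm f ^+ 2)%E].

(* s is the sum of the family u in L^2(R): the net of the partial sums over the
   finite subsets of the integers converges to s in norm. *)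
Definition is_L2_sum (u : int -> R -> C) (s : R -> C) : Prop :=
  L2 s /\ L2norm (partial_sum u J - s) @[J --> totally] --> 0%E.

Definition synthesis_op F (c : int -> C) : R -> C :=
  xget 0 [set s | is_L2_sum (fun k => scalef (c k) (F k)) s].

Definition analysis_op F f : int -> C := fun k => inner f (F k).

Definition approx_oblique_dual_frames (eps : R) W V F G : Prop :=
  [/\ frame W F, frame V G &
    (opnorm (fun f => oblique_proj W (orthocomp V) f
                      - synthesis_op F (analysis_op G f))%R <= eps%:E)%E].

Definition cis (t : R) : C := cos t +i* sin t.

Definition fourier_integral f : R -> C :=
  fun gamma => cintegral (fun x => f x * cis (- (2 * pi * x * gamma))).

(* The Fourier transform on L^2(R): the extension by continuity in L^2-norm of
   the integral transform on the dense subspace of integrable functions. *)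
Definition is_fourier f g : Prop :=
  L2 g /\ exists u : nat -> R -> C,
    [/\ forall n, L1 (u n) /\ L2 (u n),
        L2norm (u n - f) @[n --> \oo] --> 0%E &
        L2norm (fourier_integral (u n) - g) @[n --> \oo] --> 0%E].

Definition fourier f : R -> C := xget 0 [set g | is_fourier f g].

(* Complex sums over the integers: limit over finite subsets, componentwise *)
Definition zsum (u : int -> C) : C :=
  (summability.sum (fun k => complex.Re (u k) : R^o))
  +i* (summability.sum (fun k => complex.Im (u k) : R^o)).

Definition bracket f g : R -> C :=
  fun gamma => zsum (fun k => f (gamma + k%:~R) * (g (gamma + k%:~R))^*).

Definition periodization f : R -> \bar R :=
  fun gamma => (\esum_(k in [set: int]) ((cmod (f (gamma + k%:~R))) ^+ 2)%:E)%E.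

Definition zero_set (P : R -> \bar R) : set R := [set gamma | P gamma = 0%E].

End L2.

(* Main.v *)
(* Write P for the oblique projection onto W along V^perp. Since f - P f is
   orthogonal to V, the error P f - sum_k <f, T_k phit> T_k phi depends only on
   w = P f, whose norm is at most |P| |f|, so it suffices to prove
   |w - sum_k <w, T_k phit> T_k phi| <= K |w| for w in W, where K bounds
   |[phi^, phit^] - 1| on N(Phi)^c. The lower frame bound makes the finite
   combinations of translates of phi dense in W. For two of them, with
   w^ = A phi^ and h^ = A' phi^ for trigonometric polynomials A and A', Parseval's
   identity on a period gives
     <w, h> - sum_k <w, T_k phit> <T_k phi, h>
       = int_0^1 A conj(A') Phi (1 - [phi^, phit^]),
   which is at most K |w| |h| by Cauchy-Schwarz, as |w|^2 = int_0^1 |A|^2 Phi.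
   The integrand vanishes on N(Phi), so the bound on the bracket is needed only
   on N(Phi)^c. Plancherel's theorem is itself deduced from Parseval's identity,
   applied to compactly supported functions on each coset of frequencies; the
   uniqueness of Fourier coefficients behind it comes from trigonometric
   polynomials approximating indicators of intervals. *)

Require Import Defs.
From HB Require Import structures.
From mathcomp Require Import all_boot all_order all_algebra.
From mathcomp Require Import complex.
From mathcomp Require Import all_classical all_reals all_analysis.
From mathcomp Require Import measurable_realfun summability finmap ring lra.

Set Implicit Arguments.
Unset Strict Implicit.
Unset Printing Implicit Defensive.

Import Order.TTheory GRing.Theory Num.Theory.
Import numFieldNormedType.Exports.

Local Open Scope classical_set_scope.
Local Open Scope complex_scope.
Local Open Scope ring_scope.

Local Notation Re := complex.Re.
Local Notation Im := complex.Im.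

(** The frame inequalities are never turned into a bound on Phi, so the brackets are a priori only
    integrable on a period. Square integrability of A [phi^, phit^] and A' Phi is read off their
    Fourier coefficients: these are the inner products of the combinations with the translates,
    hence square summable by Bessel's inequality. This is why Parseval's identity is proved for
    integrable functions with square-summable coefficients, and why it rests on uniqueness of
    coefficients. Functions equal a.e. are not identified, so the inner product is only
    semi-definite and the abstract part works with limits in a seminorm. The projection is not shown
    to be bounded either. If its norm is +oo, the hypothesis reads [phi^, phit^] = 1 on N(Phi)^c and
    the defect bound is used with K = 0; if P f has norm 0, the error is null by the Bessel bounds
    alone. *)

Section ComplexModulus.
Context {R : realType}.
Implicit Types (z w : R[i]) (x : R).

Lemma cmodE z : (cmod z)%:C = `|z|.
Proof. by case: z => a b; rewrite normc_def. Qed.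

Lemma cmod_ge0 z : 0 <= cmod z.
Proof. by rewrite -ler0c cmodE. Qed.

Lemma cmodM z w : cmod (z * w) = cmod z * cmod w.
Proof. exact: Normc.normcM. Qed.

Lemma cmodD z w : cmod (z + w) <= cmod z + cmod w.
Proof. exact: le_normcD. Qed.

Lemma cmodN z : cmod (- z) = cmod z.
Proof. exact: normcN. Qed.

Lemma cmodC z w : cmod (z - w) = cmod (w - z).
Proof. by rewrite -cmodN opprB. Qed.

Lemma cmod0 : cmod (0 : R[i]) = 0.
Proof. exact: Normc.normc0. Qed.

Lemma cmod1 : cmod (1 : R[i]) = 1.
Proof. exact: Normc.normc1. Qed.

Lemma cmod_eq0 z : cmod z = 0 -> z = 0.
Proof. exact: Normc.eq0_normc. Qed.

Lemma cmod_sqr z : cmod z ^+ 2 = Re z ^+ 2 + Im z ^+ 2.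
Proof. by case: z => a b /=; rewrite /cmod /= sqr_sqrtr // addr_ge0 // sqr_ge0. Qed.

Lemma cmod_conj z : cmod z^* = cmod z.
Proof. by case: z => a b; rewrite /cmod /= sqrrN. Qed.

Lemma cmod_real x : cmod x%:C = `|x|.
Proof. by rewrite /cmod /= expr0n /= addr0 sqrtr_sqr. Qed.

Lemma mulcJ z : z * z^* = (cmod z ^+ 2)%:C.
Proof. by rewrite rmorphXn /= cmodE sqr_normc. Qed.

Lemma ler_Re_cmod z : `|Re z| <= cmod z.
Proof. by rewrite -lecR cmodE; exact: normc_ge_Re. Qed.

Lemma ler_Im_cmod z : `|Im z| <= cmod z.
Proof.
rewrite -sqrtr_sqr -(ger0_norm (cmod_ge0 z)) -[in leRHS]sqrtr_sqr.
by rewrite ler_wsqrtr // cmod_sqr lerDr sqr_ge0.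
Qed.

Lemma cmod_le_ReIm z : cmod z <= `|Re z| + `|Im z|.
Proof.
have h : 0 <= `|Re z| + `|Im z| by rewrite addr_ge0.
rewrite -(ler_pXn2r (ltn0Sn 1)) ?nnegrE ?cmod_ge0 // cmod_sqr.
by rewrite sqrrD !real_normK ?num_real // -addrA lerD2l lerDr mulrn_wge0 // mulr_ge0.
Qed.

Lemma cReD z w : Re (z + w) = Re z + Re w. Proof. by case: z w => [? ?] []. Qed.
Lemma cImD z w : Im (z + w) = Im z + Im w. Proof. by case: z w => [? ?] []. Qed.
Lemma cReB z w : Re (z - w) = Re z - Re w. Proof. by case: z w => [? ?] []. Qed.
Lemma cImB z w : Im (z - w) = Im z - Im w. Proof. by case: z w => [? ?] []. Qed.
Lemma cReN z : Re (- z) = - Re z. Proof. by case: z. Qed.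
Lemma cReM z w : Re (z * w) = Re z * Re w - Im z * Im w.
Proof. by case: z w => [? ?] []. Qed.
Lemma cImM z w : Im (z * w) = Re z * Im w + Im z * Re w.
Proof. by case: z w => [? ?] []. Qed.
Lemma cReJ z : Re z^* = Re z. Proof. by case: z. Qed.
Lemma cImJ z : Im z^* = - Im z. Proof. by case: z. Qed.
Lemma cReZ x z : Re (x%:C * z) = x * Re z.
Proof. by rewrite cReM /= mul0r subr0. Qed.
Lemma cImZ x z : Im (x%:C * z) = x * Im z.
Proof. by rewrite cImM /= mul0r addr0. Qed.

Lemma conjZ x z : (x%:C * z)^* = x%:C * z^*.
Proof. by case: z => a b; congr (_ +i* _) => /=; ring. Qed.

Lemma Re_conjZM x z : Re (x%:C * z^* * z) = x * cmod z ^+ 2.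
Proof. by rewrite cmod_sqr; case: z => a b /=; ring. Qed.

Lemma complex_ext z w : Re z = Re w -> Im z = Im w -> z = w.
Proof. by case: z w => [? ?] [? ?] /= -> ->. Qed.

Lemma Re_sum (I : Type) (s : seq I) (P : pred I) (f : I -> R[i]) :
  Re (\sum_(i <- s | P i) f i) = \sum_(i <- s | P i) Re (f i).
Proof. exact: (big_morph _ cReD). Qed.

Lemma Im_sum (I : Type) (s : seq I) (P : pred I) (f : I -> R[i]) :
  Im (\sum_(i <- s | P i) f i) = \sum_(i <- s | P i) Im (f i).
Proof. exact: (big_morph _ cImD). Qed.

Lemma cmod_sum (I : Type) (s : seq I) (f : I -> R[i]) :
  cmod (\sum_(i <- s) f i) <= \sum_(i <- s) cmod (f i).
Proof.
elim: s => [|a s ih]; first by rewrite !big_nil cmod0.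
by rewrite !big_cons (le_trans (cmodD _ _)) // lerD2l.
Qed.

End ComplexModulus.

(* Optimizing over [t] turns the symmetric bound into the product bound. *)
Lemma amgm_product (R : realType) (X C a b : R) : 0 <= a -> 0 <= b -> 0 <= C ->
  (forall t, 0 < t -> X <= C * (t * a ^+ 2 + b ^+ 2 / t) / 2) -> X <= C * a * b.
Proof.
move=> a0 b0 C0 h; apply/ler_addgt0Pr => e e0.
(* The shift by [d] keeps [t = (b + d) / (a + d)] meaningful and positive when [a] or [b] vanishes;
   it costs [C * (a + b) * d / 2], which is below [e]. *)
pose d := e / (C * (a + b) + 1).
have D0 : 0 < C * (a + b) + 1 by rewrite ltr_wpDl // mulr_ge0 // addr_ge0.
have d0 : 0 < d by rewrite divr_gt0.
have ad : 0 < a + d by rewrite ltr_wpDl.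
have bd : 0 < b + d by rewrite ltr_wpDl.
have := h ((b + d) / (a + d)) (divr_gt0 bd ad).
move/le_trans; apply.
have h1 : (b + d) / (a + d) * a ^+ 2 <= (b + d) * a.
  rewrite mulrAC ler_pdivrMr // -mulrA ler_wpM2l ?(ltW bd) //.
  by rewrite expr2 ler_wpM2l // lerDl ltW.
have h2 : b ^+ 2 / ((b + d) / (a + d)) <= (a + d) * b.
  rewrite invf_div mulrCA ler_wpM2l ?(ltW ad) // ler_pdivrMr //.
  by rewrite expr2 ler_wpM2l // lerDl ltW.
have h3 : C * (a + b) * d <= e.
  by rewrite /d mulrA ler_pdivrMr // [leRHS]mulrDr mulr1 mulrC lerDl ltW.
have h4 : 0 <= C * (a + b) * d by rewrite mulr_ge0 ?(ltW d0) // mulr_ge0 ?addr_ge0.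
have := ler_wpM2l C0 (lerD h1 h2).
set A := C * (_ + _) => hA.
rewrite ler_pdivrMr //; apply: (le_trans hA); nra.
Qed.

(** * Bessel families and frames in inner product spaces *)

Section PreHilbert.
Context {R : realType} {H : lmodType R[i]} (ip : H -> H -> R[i]).

(** Semi-definite on purpose: the model is a space of functions in which every a.e. null function is
    a null vector. *)
Record inner_product : Prop := InnerProduct {
  ipDl : forall x y z, ip (x + y) z = ip x z + ip y z;
  ipZl : forall a x z, ip (a *: x) z = a * ip x z;
  ipJ : forall x y, ip y x = (ip x y)^*;
  ip_ge0 : forall x, 0 <= Re (ip x x) }.

Definition hnorm (x : H) : R := Num.sqrt (Re (ip x x)).

Definition ip_complete := forall u : nat -> H,
  (forall e, 0 < e -> exists N, forall m n, (N <= m)%N -> (N <= n)%N ->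
     hnorm (u m - u n) <= e) ->
  exists l, forall e, 0 < e -> exists N, forall n, (N <= n)%N ->
     hnorm (u n - l) <= e.

Context (hip : inner_product).

Lemma ip0l y : ip 0 y = 0.
Proof. by rewrite -(scale0r 0) (ipZl hip) mul0r. Qed.

Lemma ipNl x y : ip (- x) y = - ip x y.
Proof. by rewrite -scaleN1r (ipZl hip) mulN1r. Qed.

Lemma ipBl x y z : ip (x - y) z = ip x z - ip y z.
Proof. by rewrite (ipDl hip) ipNl. Qed.

Lemma ipDr x y z : ip x (y + z) = ip x y + ip x z.
Proof. by rewrite (ipJ hip) (ipDl hip) rmorphD /= -!(ipJ hip). Qed.

Lemma ipZr a x y : ip x (a *: y) = a^* * ip x y.
Proof. by rewrite (ipJ hip) (ipZl hip) rmorphM /= -(ipJ hip). Qed.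

Lemma ip0r x : ip x 0 = 0.
Proof. by rewrite (ipJ hip) ip0l rmorph0. Qed.

Lemma ipBr x y z : ip x (y - z) = ip x y - ip x z.
Proof. by rewrite (ipJ hip) ipBl rmorphB /= -!(ipJ hip). Qed.

Lemma ip_suml (I : Type) (s : seq I) (f : I -> H) y :
  ip (\sum_(i <- s) f i) y = \sum_(i <- s) ip (f i) y.
Proof. by apply: (big_morph (ip^~ y)) => [a b|]; rewrite ?(ipDl hip) ?ip0l. Qed.

Lemma ip_sumr (I : Type) (s : seq I) (f : I -> H) y :
  ip y (\sum_(i <- s) f i) = \sum_(i <- s) ip y (f i).
Proof. by apply: (big_morph (ip y)) => [a b|]; rewrite ?ipDr ?ip0r. Qed.

Lemma hnorm_ge0 x : 0 <= hnorm x. Proof. exact: sqrtr_ge0. Qed.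

Lemma hnorm_sqr x : hnorm x ^+ 2 = Re (ip x x).
Proof. by rewrite sqr_sqrtr ?(ip_ge0 hip). Qed.

Lemma ipxx x : ip x x = (hnorm x ^+ 2)%:C.
Proof.
apply: complex_ext; rewrite hnorm_sqr //=.
have /(congr1 (@complex.Im R)) := ipJ hip x x; rewrite cImJ; lra.
Qed.

Lemma hnormZ a x : hnorm (a *: x) = cmod a * hnorm x.
Proof.
apply: (@pexpIrn _ 2); rewrite ?nnegrE ?hnorm_ge0 ?mulr_ge0 ?cmod_ge0 ?hnorm_ge0 //.
by rewrite hnorm_sqr (ipZl hip) ipZr mulrA mulcJ ipxx cReZ exprMn.
Qed.

Lemma hnormN x : hnorm (- x) = hnorm x.
Proof. by rewrite -scaleN1r hnormZ cmodN cmod1 mul1r. Qed.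

Lemma hnormC x y : hnorm (x - y) = hnorm (y - x).
Proof. by rewrite -hnormN opprB. Qed.

Lemma hnormD_sqr x y :
  hnorm (x + y) ^+ 2 = hnorm x ^+ 2 + 2 * Re (ip x y) + hnorm y ^+ 2.
Proof.
rewrite !hnorm_sqr !(ipDl hip) !ipDr !cReD (ipJ hip x y) cReJ; ring.
Qed.

Lemma hnormB_sqr x y :
  hnorm (x - y) ^+ 2 = hnorm x ^+ 2 - 2 * Re (ip x y) + hnorm y ^+ 2.
Proof. by rewrite hnormD_sqr hnormN -[- y]scaleN1r ipZr rmorphN1 mulN1r cReN; ring. Qed.

(** Nonnegativity of |x - t <x, y> y|^2 for real [t], taken at t = 1 / |y|^2 when [y] is not
    null. *)
Lemma cauchy_schwarz x y : cmod (ip x y) <= hnorm x * hnorm y.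
Proof.
rewrite -(ler_pXn2r (ltn0Sn 1)) ?nnegrE ?cmod_ge0 ?mulr_ge0 ?hnorm_ge0 // exprMn.
set N := cmod _ ^+ 2; set X := hnorm x ^+ 2; set Y := hnorm y ^+ 2.
have Y0 : 0 <= Y by rewrite sqr_ge0.
have X0 : 0 <= X by rewrite sqr_ge0.
have N0 : 0 <= N by rewrite sqr_ge0.
have key (t : R) : 0 <= X - 2 * t * N + t ^+ 2 * N * Y.
  have := sqr_ge0 (hnorm (x - (t%:C * ip x y) *: y)).
  rewrite hnormB_sqr hnormZ ipZr conjZ Re_conjZM.
  rewrite cmodM cmod_real !exprMn real_normK ?num_real // -/X -/Y -/N.
  by rewrite !mulrA.
have [Y_eq0|Y_neq0] := eqVneq Y 0.
  (* For a null [y] the polynomial is affine in [t]; at this [t] it would equal -1 if [N] were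
     nonzero. *)
  have := key ((X + 1) / (2 * N)); rewrite Y_eq0 !mulr0 addr0.
  have [->//|N_neq0] := eqVneq N 0.
  have -> : 2 * ((X + 1) / (2 * N)) * N = X + 1 by field.
  lra.
have Ypos : 0 < Y by rewrite lt_neqAle eq_sym Y_neq0.
have := key Y^-1.
have -> : Y^-1 ^+ 2 * N * Y = N / Y by field.
have -> : X - 2 * Y^-1 * N + N / Y = X - N / Y by field.
by rewrite subr_ge0 ler_pdivrMr.
Qed.

Lemma ler_hnormD x y : hnorm (x + y) <= hnorm x + hnorm y.
Proof.
rewrite -(ler_pXn2r (ltn0Sn 1)) ?nnegrE ?addr_ge0 ?hnorm_ge0 // hnormD_sqr sqrrD.
have := le_trans (ler_norm _) (le_trans (ler_Re_cmod _) (cauchy_schwarz x y)).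
rewrite lerD2r lerD2l; lra.
Qed.

Lemma ler_hnormB x y : hnorm (x - y) <= hnorm x + hnorm y.
Proof. by rewrite -(hnormN y) ler_hnormD. Qed.

Lemma hnorm_dist x y z : hnorm (x - z) <= hnorm (x - y) + hnorm (y - z).
Proof. by rewrite -{1}(subrK y x) -addrA ler_hnormD. Qed.

Lemma Re_ip_amgm (M : R) x y : 0 < M ->
  2 * Re (ip x y) <= M * hnorm x ^+ 2 + hnorm y ^+ 2 / M.
Proof.
move=> M0; have := sqr_ge0 (hnorm (M%:C *: x - y)).
rewrite hnormB_sqr hnormZ (ipZl hip) cReZ cmod_real gtr0_norm // exprMn => h.
rewrite -(ler_pM2l M0).
have -> : M * (M * hnorm x ^+ 2 + hnorm y ^+ 2 / M) = M ^+ 2 * hnorm x ^+ 2 + hnorm y ^+ 2.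
  by field; rewrite gt_eqF.
lra.
Qed.

Section Families.
Context {I : choiceType}.
Implicit Types (F G : I -> H) (c d : I -> R[i]) (J K : {fset I}).

Definition bessel_on (W : H -> Prop) (M : R) F := forall x J, W x ->
  \sum_(k <- J) cmod (ip x (F k)) ^+ 2 <= M * hnorm x ^+ 2.

Definition bounded_synthesis (M : R) F := forall c J,
  hnorm (\sum_(k <- J) c k *: F k) ^+ 2 <= M * \sum_(k <- J) cmod (c k) ^+ 2.

Definition hsum (u : I -> H) (s : H) := forall e, 0 < e ->
  exists J, forall K, fsubset J K -> hnorm (\sum_(k <- K) u k - s) <= e.

Definition csum (u : I -> R[i]) (s : R[i]) := forall e, 0 < e ->
  exists J, forall K, fsubset J K -> cmod (\sum_(k <- K) u k - s) <= e.

Definition sq_summable c := exists B, forall J, \sum_(k <- J) cmod (c k) ^+ 2 <= B.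

(** Synthesis is the adjoint of analysis: Bessel's inequality is tested on the finite combination
    itself, which must therefore lie in [W]. *)
Lemma bessel_bounded_synthesis (W : H -> Prop) M F : 0 < M ->
  (forall x y, W x -> W y -> W (x + y)) -> (forall a x, W x -> W (a *: x)) ->
  W 0 -> (forall k, W (F k)) -> bessel_on W M F -> bounded_synthesis M F.
Proof.
move=> M0 WD WZ W0 WF bF c J; set y := \sum_(k <- J) _.
have Wy : W y by rewrite /y; elim/big_ind: _ => // i _; exact: WZ.
have := bF y J Wy; set S := \sum_(k <- J) _ => hS.
set T := \sum_(k <- J) _.
have : 2 * hnorm y ^+ 2 <= M * T + S / M.
  rewrite hnorm_sqr {1}/y ip_suml Re_sum /T /S !mulr_sumr mulr_suml -big_split /=.
  apply: ler_sum => k _; rewrite (ipZl hip).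
  have h : Re (c k * ip (F k) y) <= cmod (c k) * cmod (ip y (F k)).
    rewrite (le_trans (ler_norm _)) // (le_trans (ler_Re_cmod _)) //.
    by rewrite cmodM (ipJ hip y) cmod_conj.
  set a := cmod (c k) in h *; set b := cmod _ in h *.
  have := sqr_ge0 (M * a - b) => h2.
  rewrite -(ler_pM2l M0).
  have -> : M * (M * a ^+ 2 + b ^+ 2 / M) = M ^+ 2 * a ^+ 2 + b ^+ 2.
    by field; rewrite gt_eqF.
  nra.
have : S / M <= hnorm y ^+ 2 by rewrite ler_pdivrMr // mulrC.
lra.
Qed.

(** Taking <x, F k> as coefficients gives the converse, now for every [x]. Together the two lemmas
    extend a Bessel bound from the subspace spanned by the family to the whole space. *)
Lemma bounded_synthesis_bessel M F : 0 < M ->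
  bounded_synthesis M F -> bessel_on (fun=> True) M F.
Proof.
move=> M0 sF x J _; pose c k := ip x (F k).
have := sF c J; set y := \sum_(k <- J) _ *: _; set S := \sum_(k <- J) _ => hy.
have h : Re (ip x y) = S.
  rewrite /y ip_sumr Re_sum; apply: eq_bigr => k _.
  by rewrite ipZr mulrC mulcJ.
have := Re_ip_amgm x y M0; rewrite h.
have : hnorm y ^+ 2 / M <= S by rewrite ler_pdivrMr // mulrC.
lra.
Qed.

Lemma fset_sumD (V : nmodType) (f : I -> V) J K : fsubset J K ->
  \sum_(k <- K) f k = \sum_(k <- J) f k + \sum_(k <- fsetD K J) f k.
Proof.
move=> JK; rewrite (big_fsetID _ (mem J)) /=; congr (_ + _).
  apply: congr_big => //; congr enum_fset; apply/fsetP => k; rewrite !inE.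
  by case: (boolP (k \in J)) => [/(fsubsetP JK) ->|]; rewrite ?andbF.
apply: congr_big => //; congr enum_fset; apply/fsetP => k; rewrite !inE.
by rewrite andbC.
Qed.

(** [J] nearly attains the supremum of the finite sums, so indices outside [J] can add at most
    [e]. *)
Lemma sq_summable_tail c e : sq_summable c -> 0 < e ->
  exists J, forall K, fsubset J K -> \sum_(k <- fsetD K J) cmod (c k) ^+ 2 <= e.
Proof.
move=> [B hB] e0.
pose E := [set S | exists J : {fset I}, S = \sum_(k <- J) cmod (c k) ^+ 2].
have supE : has_sup E.
  split; first by exists (\sum_(k <- fset0) cmod (c k) ^+ 2); exists fset0.
  by exists B => _ [J ->].
have [_ [J ->] hJ] := sup_adherent e0 supE.
exists J => K JK.
have : \sum_(k <- K) cmod (c k) ^+ 2 <= sup E.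
  by apply: ub_le_sup; [case: supE|exists K].
rewrite (fset_sumD _ JK); lra.
Qed.

(** Completeness concerns sequences while [hsum] is a limit over finite sets. The sets [T n] control
    the tails, and their unions [K n] form an increasing sequence of sets along which the partial
    sums are Cauchy. *)
Lemma hsum_exists M F c : 0 < M -> ip_complete -> bounded_synthesis M F ->
  sq_summable c -> exists s, hsum (fun k => c k *: F k) s.
Proof.
move=> M0 cpl sF sc.
have /choice[T hT] : forall n : nat, exists J, forall K, fsubset J K ->
    hnorm (\sum_(k <- fsetD K J) c k *: F k) <= n.+1%:R^-1.
  move=> n; have e0 : 0 < (n.+1%:R^-1 ^+ 2) / M :> R by rewrite divr_gt0 // exprn_gt0.
  have [J hJ] := sq_summable_tail sc e0; exists J => K JK.
  rewrite -(ler_pXn2r (ltn0Sn 1)) ?nnegrE ?hnorm_ge0 //.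
  by rewrite (le_trans (sF _ _)) // mulrC -ler_pdivlMr // hJ.
pose K := fix K n := if n is m.+1 then fsetU (K m) (T m.+1) else T 0%N.
have TK n m : (n <= m)%N -> fsubset (T n) (K m).
  elim: m => [|m ih]; first by rewrite leqn0 => /eqP ->; exact: fsubset_refl.
  rewrite leq_eqVlt => /predU1P[->|]; first exact: fsubsetUr.
  by rewrite ltnS => /ih h; apply: fsubset_trans h _; exact: fsubsetUl.
have close n J : fsubset (T n) J ->
    hnorm (\sum_(k <- J) c k *: F k - \sum_(k <- T n) c k *: F k) <= n.+1%:R^-1.
  by move=> TJ; rewrite (fset_sumD _ TJ) addrC addKr hT.
pose u n := \sum_(k <- K n) c k *: F k.
have inv_small (e : R) : 0 < e -> exists n : nat, n.+1%:R^-1 <= e.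
  move=> e0; exists (Num.truncn e^-1); rewrite -[leRHS]invrK lef_pV2 ?posrE ?invr_gt0 //.
  by rewrite ltW // truncnS_gt.
have cu n m J : (n <= m)%N -> fsubset (T n) J ->
    hnorm (\sum_(k <- J) c k *: F k - u m) <= n.+1%:R^-1 + n.+1%:R^-1.
  move=> nm TJ; apply: le_trans (hnorm_dist _ (\sum_(k <- T n) c k *: F k) _) _.
  by rewrite lerD ?close // hnormC close // TK.
have [|s hs] := cpl u.
  move=> e e0; have [n hn] := inv_small (e / 2) ltac:(by rewrite divr_gt0).
  exists n => m m' nm nm'; apply: le_trans (cu n m' _ nm' (TK _ _ nm)) _.
  by move: hn; move: (n.+1%:R^-1) => d; lra.
exists s => e e0; have [n hn] := inv_small (e / 3) ltac:(by rewrite divr_gt0).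
have [N hN] := hs (e / 3) ltac:(by rewrite divr_gt0).
exists (T n) => J TJ; apply: le_trans (hnorm_dist _ (u (maxn n N)) _) _.
have := cu n (maxn n N) J (leq_maxl _ _) TJ.
by have := hN (maxn n N) (leq_maxr _ _); move: hn; move: (n.+1%:R^-1) => d; lra.
Qed.

End Families.
End PreHilbert.

Section PreHilbertFrames.
Context {R : realType} {H : lmodType R[i]} (ip : H -> H -> R[i]).
Context (hip : inner_product ip) {I : choiceType}.
Local Notation hnorm := (hnorm ip).
Local Notation hsum := (hsum ip).
Implicit Types (F G : I -> H) (c d : I -> R[i]) (J K : {fset I}).

(** An index may be repeated in the list, so that adding combinations is concatenation. *)
Definition hspan F x := exists s : seq (I * R[i]), x = \sum_(q <- s) q.2 *: F q.1.

Lemma hspan0 F : hspan F 0.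
Proof. by exists [::]; rewrite big_nil. Qed.

Lemma hspanD F x y : hspan F x -> hspan F y -> hspan F (x + y).
Proof. by move=> [s ->] [t ->]; exists (s ++ t); rewrite big_cat. Qed.

Lemma hspan_fset F c J : hspan F (\sum_(k <- J) c k *: F k).
Proof. by exists [seq (k, c k) | k <- J]; rewrite big_map. Qed.

Lemma hspanZ F a x : hspan F x -> hspan F (a *: x).
Proof.
move=> [s ->]; exists [seq (q.1, a * q.2) | q <- s]; rewrite big_map scaler_sumr.
by apply: eq_bigr => q _; rewrite scalerA.
Qed.

Lemma hspan_sub F (W : H -> Prop) : (forall x y, W x -> W y -> W (x + y)) ->
  (forall a x, W x -> W (a *: x)) -> W 0 -> (forall k, W (F k)) ->
  forall x, hspan F x -> W x.
Proof.
move=> WD WZ W0 WF x [s ->]; elim/big_ind: _ => // q _; exact: WZ.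
Qed.

Lemma small_expr (r B e : R) : 0 <= r -> r < 1 -> 0 < e -> exists n, r ^+ n * B <= e.
Proof.
move=> r0 r1 e0.
have : (fun n => r ^+ n * B) @ \oo --> 0 * B.
  by apply: cvgMl; apply: cvg_expr; rewrite ger0_norm.
rewrite mul0r => /cvgrPdist_le /(_ e e0) [N _ /(_ N (leqnn N))] /=.
by rewrite sub0r normrN => h; exists N; exact: le_trans (ler_norm _) h.
Qed.

(* Richardson iteration: with [S] the truncated frame operator, one step
   [x - S x / M] contracts the squared distance to the span by [1 - a / 2M]. *)
Lemma frame_span_dense (W : H -> Prop) (a M : R) F : 0 < a -> a <= M ->
  (forall x y, W x -> W y -> W (x + y)) -> (forall z x, W x -> W (z *: x)) ->
  W 0 -> (forall k, W (F k)) -> bessel_on ip W M F ->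
  (forall x, W x -> forall e, 0 < e ->
     exists J, a * hnorm x ^+ 2 <= \sum_(k <- J) cmod (ip x (F k)) ^+ 2 + e) ->
  forall w, W w -> forall e, 0 < e -> exists2 p, hspan F p & hnorm (w - p) <= e.
Proof.
move=> a0 aM WD WZ W0 WF bF lF w Ww.
have M0 : 0 < M by exact: lt_le_trans aM.
have sF := bessel_bounded_synthesis hip M0 WD WZ W0 WF bF.
pose r := 1 - a / (2 * M).
have aM2 : a / (2 * M) <= 2^-1.
  by rewrite ler_pdivrMr ?mulr_gt0 //; lra.
have aM0 : 0 < a / (2 * M) by rewrite divr_gt0 // mulr_gt0.
have step p : hspan F p -> exists2 p', hspan F p' &
    hnorm (w - p') ^+ 2 <= r * hnorm (w - p) ^+ 2.
  move=> sp; set x := w - p.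
  have Wp := hspan_sub WD WZ W0 WF sp.
  have Wx : W x by rewrite /x -scaleN1r; apply: WD => //; exact: WZ.
  have [x0|xn0] := eqVneq (hnorm x ^+ 2) 0.
    by exists p => //; rewrite -/x x0 mulr0.
  have xpos : 0 < hnorm x ^+ 2 by rewrite lt_neqAle eq_sym xn0 sqr_ge0.
  (* Half of the lower frame bound is given up to truncate the frame sum to [J], whence the 2 in
     [r]. *)
  have e0 : 0 < a * hnorm x ^+ 2 / 2 by rewrite divr_gt0 // mulr_gt0.
  have [J hJ] := lF x Wx _ e0.
  pose c k := ip x (F k).
  set S := \sum_(k <- J) _ in hJ.
  pose y := \sum_(k <- J) c k *: F k.
  have hy : hnorm y ^+ 2 <= M * S by exact: sF.
  have hS : ip x y = S%:C.
    rewrite /y (ip_sumr hip) /S rmorph_sum /=; apply: eq_bigr => k _.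
    by rewrite (ipZr hip) mulrC mulcJ.
  exists (p + (M^-1)%:C *: y).
    by apply: hspanD => //; apply: hspanZ; exact: hspan_fset.
  (* |x - y / M|^2 = |x|^2 - 2 S / M + |y|^2 / M^2 is at most |x|^2 - S / M, since |y|^2 <= M S. *)
  rewrite opprD addrA -/x (hnormB_sqr hip) (hnormZ hip) (ipZr hip) hS.
  have -> : Re (((M^-1)%:C)^* * S%:C) = M^-1 * S by rewrite /=; ring.
  rewrite cmod_real gtr0_norm ?invr_gt0 // exprMn /r.
  have hS0 : 0 <= S by apply: sumr_ge0 => k _; exact: sqr_ge0.
  have h1 : M^-1 ^+ 2 * hnorm y ^+ 2 <= M^-1 * S.
    rewrite expr2 -mulrA ler_pM2l ?invr_gt0 //.
    by rewrite ler_pdivrMl.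
  have h2 : a / (2 * M) * hnorm x ^+ 2 <= M^-1 * S.
    have -> : a / (2 * M) * hnorm x ^+ 2 = M^-1 * (a * hnorm x ^+ 2 / 2).
      by field; rewrite gt_eqF.
    by rewrite ler_pM2l ?invr_gt0 //; lra.
  lra.
have r0 : 0 <= r by rewrite /r; lra.
have iter n : exists2 p, hspan F p & hnorm (w - p) ^+ 2 <= r ^+ n * hnorm w ^+ 2.
  elim: n => [|n [p sp hp]].
    by exists 0; [exact: hspan0|rewrite subr0 expr0 mul1r].
  have [p' sp' hp'] := step p sp; exists p' => //.
  by rewrite (le_trans hp') // [r ^+ n.+1]exprS -mulrA ler_wpM2l.
move=> e e0; have [||n hn] := @small_expr r (hnorm w ^+ 2) (e ^+ 2) r0.
- by rewrite /r; lra.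
- by rewrite exprn_gt0.
have [p sp hp] := iter n; exists p => //.
rewrite -(ler_pXn2r (ltn0Sn 1)) ?nnegrE ?hnorm_ge0 //; last exact: ltW.
exact: le_trans hp hn.
Qed.

Lemma hsum_ip u s h : hsum u s -> csum (fun k : I => ip (u k) h) (ip s h).
Proof.
move=> hs e e0.
have p0 : 0 < hnorm h + 1 by rewrite ltr_wpDl // hnorm_ge0.
have [J hJ] := hs (e / (hnorm h + 1)) (divr_gt0 e0 p0).
exists J => K JK; rewrite -(ip_suml hip) -(ipBl hip).
apply: le_trans (cauchy_schwarz hip _ _) _.
have := hJ K JK; rewrite ler_pdivlMr // => /(le_trans _); apply.
by rewrite ler_wpM2l ?hnorm_ge0 // lerDl.
Qed.

Lemma csum_unique (u : I -> R[i]) s t : csum u s -> csum u t -> s = t.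
Proof.
move=> hs ht; apply/eqP; rewrite -subr_eq0; apply/eqP/cmod_eq0.
apply/eqP; rewrite eq_le cmod_ge0 andbT; apply/ler_addgt0Pr => e e0.
have [J hJ] := hs (e / 2) ltac:(by rewrite divr_gt0).
have [K hK] := ht (e / 2) ltac:(by rewrite divr_gt0).
have := hJ _ (fsubsetUl J K); have := hK _ (fsubsetUr J K).
set x := \sum_(k <- _) _ => h1 h2.
rewrite add0r -[s in s - t](subrK x) -addrA.
by apply: le_trans (cmodD _ _) _; rewrite [cmod (s - x)]cmodC; lra.
Qed.

Lemma hsumB u v s t : hsum u s -> hsum v t -> hsum (fun k : I => u k - v k) (s - t).
Proof.
move=> hs ht e e0.
have [J hJ] := hs (e / 2) ltac:(by rewrite divr_gt0).
have [K hK] := ht (e / 2) ltac:(by rewrite divr_gt0).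
exists (fsetU J K) => L JKL.
have := hJ _ (fsubset_trans (fsubsetUl J K) JKL).
have := hK _ (fsubset_trans (fsubsetUr J K) JKL).
rewrite sumrB; set x := \sum_(k <- _) v k; set y := \sum_(k <- _) u k => h1 h2.
have -> : y - x - (s - t) = (y - s) - (x - t).
  by rewrite !opprB addrACA [RHS]addrACA [- x - s]addrC.
have := ler_hnormB hip (y - s) (x - t); lra.
Qed.

Lemma hsum_bound M B F c s : 0 < M -> bounded_synthesis ip M F ->
  (forall J, \sum_(k <- J) cmod (c k) ^+ 2 <= B ^+ 2) -> 0 <= B ->
  hsum (fun k => c k *: F k) s -> hnorm s <= Num.sqrt M * B.
Proof.
move=> M0 sF hB B0 hs; apply/ler_addgt0Pr => e e0.
have [J /(_ J (fsubset_refl _)) hJ] := hs e e0.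
have : hnorm (\sum_(k <- J) c k *: F k) <= Num.sqrt M * B.
  rewrite -(ler_pXn2r (ltn0Sn 1)) ?nnegrE ?mulr_ge0 ?sqrtr_ge0 ?hnorm_ge0 //.
  by rewrite exprMn [Num.sqrt M ^+ 2]sqr_sqrtr ?(ltW M0) // (le_trans (sF _ _)) // ler_pM2l.
set y := \sum_(k <- _) _ in hJ *.
have := ler_hnormD hip (s - y) y; rewrite subrK (hnormC hip s); lra.
Qed.

(** Finite sums within 1 / (n + 1) of the limit give the sequence that closedness of [W] asks
    for. *)
Lemma hsum_closed (W : H -> Prop) (u : I -> H) s :
  (forall x y, W x -> W y -> W (x + y)) -> W 0 -> (forall k, W (u k)) ->
  (forall (v : nat -> H) l, (forall n, W (v n)) ->
     (forall e, 0 < e -> exists N, forall n, (N <= n)%N -> hnorm (v n - l) <= e) -> W l) ->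
  hsum u s -> W s.
Proof.
move=> WD W0 Wu cW hs.
have /choice[T hT] : forall n : nat, exists J, hnorm (\sum_(k <- J) u k - s) <= n.+1%:R^-1.
  move=> n; have [J hJ] := hs n.+1%:R^-1 ltac:(by rewrite invr_gt0).
  by exists J; exact: hJ (fsubset_refl _).
apply: (cW (fun n => \sum_(k <- T n) u k)).
  by move=> n; elim/big_ind: _.
move=> e e0; exists (Num.truncn e^-1) => n hn; apply: le_trans (hT n) _.
rewrite -[leRHS]invrK lef_pV2 ?posrE ?invr_gt0 //.
by rewrite ltW // (lt_le_trans (truncnS_gt _)) // ler_nat.
Qed.

(* The bound on finite combinations passes to [W] because
   [w |-> w - \sum <w, G k> F k] is bounded. *)
Lemma dual_defect_bound (W : H -> Prop) (a M M' C : R) F G :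
  0 < a -> a <= M -> 0 < M' -> 0 <= C -> ip_complete ip ->
  (forall x y, W x -> W y -> W (x + y)) -> (forall z x, W x -> W (z *: x)) ->
  W 0 -> (forall k, W (F k)) ->
  (forall (v : nat -> H) l, (forall n, W (v n)) ->
     (forall e, 0 < e -> exists N, forall n, (N <= n)%N -> hnorm (v n - l) <= e) -> W l) ->
  bessel_on ip W M F ->
  (forall x, W x -> forall e, 0 < e ->
     exists J, a * hnorm x ^+ 2 <= \sum_(k <- J) cmod (ip x (F k)) ^+ 2 + e) ->
  bounded_synthesis ip M' G ->
  (forall w h, hspan F w -> hspan F h -> exists2 q,
     csum (fun k : I => ip w (G k) * ip (F k) h) q &
     cmod (ip w h - q) <= C * hnorm w * hnorm h) ->
  forall w s, W w -> hsum (fun k => ip w (G k) *: F k) s -> hnorm (w - s) <= C * hnorm w.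
Proof.
move=> a0 aM M'0 C0 cpl WD WZ W0 WF cW bF lF sG form.
have M0 : 0 < M by exact: lt_le_trans aM.
have sF := bessel_bounded_synthesis hip M0 WD WZ W0 WF bF.
have bG := bounded_synthesis_bessel hip M'0 sG.
have dense := frame_span_dense a0 aM WD WZ W0 WF bF lF.
have WB x y : W x -> W y -> W (x - y).
  by move=> Wx Wy; rewrite -scaleN1r; apply: WD => //; apply: WZ.
have Wspan x : hspan F x -> W x by exact: hspan_sub.
have ex w : exists s, hsum (fun k => ip w (G k) *: F k) s.
  by apply: (hsum_exists hip M0 cpl sF); exists (M' * hnorm w ^+ 2) => J; exact: bG.
have Ws w s : hsum (fun k => ip w (G k) *: F k) s -> W s.
  by apply: hsum_closed => // k; exact: WZ.
(* Operator bound of w |-> \sum <w, G k> F k: analysis with [G] costs the root of [M'], synthesis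
   with [F] the root of [M]. *)
pose L := Num.sqrt M * Num.sqrt M'.
have L0 : 0 <= L by rewrite mulr_ge0 ?sqrtr_ge0.
have bnd w s : hsum (fun k => ip w (G k) *: F k) s -> hnorm s <= L * hnorm w.
  move=> hs; rewrite -mulrA; apply: (hsum_bound M0 sF _ _ hs).
    by move=> J; rewrite exprMn [Num.sqrt M' ^+ 2]sqr_sqrtr ?(ltW M'0) //; exact: bG.
  by rewrite mulr_ge0 ?sqrtr_ge0 ?hnorm_ge0.
have span_bound w s : hspan F w -> hsum (fun k => ip w (G k) *: F k) s ->
    hnorm (w - s) <= C * hnorm w.
  move=> sw hs; set d := w - s.
  have Wd : W d by apply: WB; [exact: Wspan|exact: Ws hs].
  have [d0|dn0] := eqVneq (hnorm d) 0; first by rewrite d0 mulr_ge0 ?hnorm_ge0.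
  have dpos : 0 < hnorm d by rewrite lt_neqAle eq_sym dn0 hnorm_ge0.
  rewrite -(ler_pM2r dpos); apply/ler_addgt0Pr => e e0.
  (* The defect [d] is tested against a combination [p] close to it. Replacing [d] by [p] in |d|^2 =
     Re <d, d - p> + Re <d, p> costs at most (|d| + C |w|) |d - p|. *)
  have D0 : 0 < hnorm d + C * hnorm w.
    by rewrite ltr_pwDl // mulr_ge0 // hnorm_ge0.
  have [p sp hp] := dense d Wd (e / (hnorm d + C * hnorm w)) (divr_gt0 e0 D0).
  have [q hq hC] := form w p sw sp.
  have qE : q = ip s p.
    apply: (csum_unique hq).
    have := hsum_ip p hs; congr csum; apply/funext => k; exact: (ipZl hip).
  rewrite {q hq}qE -(ipBl hip) -/d in hC.
  have h1 : hnorm d ^+ 2 = Re (ip d (d - p)) + Re (ip d p).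
    by rewrite (ipBr hip) cReB subrK hnorm_sqr.
  have h2 := le_trans (ler_norm _) (le_trans (ler_Re_cmod _) (cauchy_schwarz hip d (d - p))).
  have h3 := le_trans (ler_norm _) (le_trans (ler_Re_cmod _) hC).
  have h4 : hnorm p <= hnorm d + hnorm (d - p).
    have := ler_hnormB hip d (d - p); by rewrite opprB addrC subrK.
  move: hp; rewrite ler_pdivlMr // => hp.
  have h5 := ler_wpM2l (mulr_ge0 C0 (hnorm_ge0 ip w)) h4.
  rewrite -expr2 h1; nra.
move=> w s Ww hs; apply/ler_addgt0Pr => e e0.
(* Passing from [p] to [w] costs at most (C + 1 + L) |w - p|: [C] from |p|, 1 from w - p and [L]
   from s - t. *)
have D0 : 0 < 2 * C + 1 + L.
  by rewrite -addrA ltr_wpDl ?mulr_ge0 // ltr_pwDl.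
have [p sp hp] := dense w Ww (e / (2 * C + 1 + L)) (divr_gt0 e0 D0).
have [t ht] := ex p.
have hd : hsum (fun k => ip (w - p) (G k) *: F k) (s - t).
  have := hsumB hs ht; congr (hsum _ _); apply/funext => k.
  by rewrite (ipBl hip) scalerBl.
have h1 := bnd _ _ hd.
have h2 := span_bound p t sp ht.
have h3 : hnorm p <= hnorm w + hnorm (w - p).
  have := ler_hnormB hip w (w - p); by rewrite opprB addrC subrK.
have -> : w - s = (p - t) + ((w - p) - (s - t)).
  by rewrite opprB addrACA [p + _]addrC subrK addKr.
move: hp; rewrite ler_pdivlMr // => hp.
have := ler_hnormD hip (p - t) ((w - p) - (s - t)).
have := ler_hnormB hip (w - p) (s - t).
have := ler_wpM2l C0 h3.
have := mulr_ge0 C0 (hnorm_ge0 ip (w - p)).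
nra.
Qed.

End PreHilbertFrames.

(** * Complex integrals and the Hilbert space L^2 *)

Section ComplexIntegral.
Context {R : realType}.
Local Notation mu := (@lebesgue_measure R).
Local Notation C := R[i].
Implicit Types (f g : R -> C) (h : R -> R).

Definition rintegrable h := mu.-integrable setT (EFin \o h).
Definition cintegrable f :=
  rintegrable (fun x => Re (f x)) /\ rintegrable (fun x => Im (f x)).

Lemma aeS (P Q : R -> Prop) : (forall x, P x -> Q x) ->
  {ae mu, forall x, P x} -> {ae mu, forall x, Q x}.
Proof.
by move=> PQ [N [mN N0 hN]]; exists N; split => //; apply: subset_trans hN => x nQ /PQ.
Qed.

Lemma aeS2 (P Q S : R -> Prop) : (forall x, P x -> Q x -> S x) ->
  {ae mu, forall x, P x} -> {ae mu, forall x, Q x} -> {ae mu, forall x, S x}.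
Proof.
move=> PQS hP hQ; have F := ae_filter_ringOfSetsType mu.
by apply: (@filterS2 _ _ F _ _ _ _ hP hQ) => x; exact: PQS.
Qed.

Lemma measurable_cmod f : cmeasurable f -> measurable_fun setT (fun x => cmod (f x)).
Proof.
move=> [mr mi].
have -> : (fun x => cmod (f x)) = Num.sqrt \o (fun x => Re (f x) ^+ 2 + Im (f x) ^+ 2).
  by apply/funext => x /=; rewrite -cmod_sqr sqrtr_sqr ger0_norm ?cmod_ge0.
apply: measurableT_comp; first by apply: continuous_measurable_fun; exact: sqrt_continuous.
by apply: measurable_funD; apply: measurable_funX.
Qed.

Lemma cmeasurableD f g : cmeasurable f -> cmeasurable g ->
  cmeasurable (fun x => f x + g x).
Proof.
move=> [fr fi] [gr gi]; split.
  by under eq_fun do rewrite cReD; exact: measurable_funD.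
by under eq_fun do rewrite cImD; exact: measurable_funD.
Qed.

Lemma cmeasurableM f g : cmeasurable f -> cmeasurable g ->
  cmeasurable (fun x => f x * g x).
Proof.
move=> [fr fi] [gr gi]; split.
  by under eq_fun do rewrite cReM; apply: measurable_funB; exact: measurable_funM.
by under eq_fun do rewrite cImM; apply: measurable_funD; exact: measurable_funM.
Qed.

Lemma cmeasurable_cst (c : C) : cmeasurable (fun=> c).
Proof. by split; exact: measurable_cst. Qed.

Lemma cmeasurableZ c f : cmeasurable f -> cmeasurable (fun x => c * f x).
Proof. by apply: cmeasurableM; exact: cmeasurable_cst. Qed.

Lemma cmeasurableJ f : cmeasurable f -> cmeasurable (fun x => (f x)^*).
Proof.
move=> [fr fi]; split; first by under eq_fun do rewrite cReJ.
by under eq_fun do rewrite cImJ; exact: measurable_funN.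
Qed.

Lemma cmeasurable_real h : measurable_fun setT h -> cmeasurable (fun x => (h x)%:C).
Proof. by split => //=; exact: measurable_cst. Qed.

Lemma cmeasurable_sum (I : Type) (s : seq I) (F : I -> R -> C) :
  (forall i, cmeasurable (F i)) -> cmeasurable (fun x => \sum_(i <- s) F i x).
Proof.
move=> mF; elim: s => [|a s ih].
  by under eq_fun do rewrite big_nil; exact: cmeasurable_cst.
by under eq_fun do rewrite big_cons; exact: cmeasurableD.
Qed.

Lemma rintegrable_le h (k : R -> R) : measurable_fun setT h -> rintegrable k ->
  (forall x, `|h x| <= k x) -> rintegrable h.
Proof.
move=> mh ik hk; apply: (le_integrable _ _ _ ik) => //.
  exact/measurable_EFinP.
by move=> x _ /=; rewrite lee_fin (le_trans (hk x)) // ler_norm.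
Qed.

Lemma rintegrableD h k : rintegrable h -> rintegrable k ->
  rintegrable (fun x => h x + k x).
Proof. by move=> ih ik; exact: (integrableD _ ih ik). Qed.

Lemma rintegrableZ c h : rintegrable h -> rintegrable (fun x => c * h x).
Proof. by move=> ih; exact: (integrableZl _ c ih). Qed.

Lemma rintegrable_measurable h : rintegrable h -> measurable_fun setT h.
Proof. by move=> /measurable_int /measurable_EFinP. Qed.

Lemma cintegrable_measurable f : cintegrable f -> cmeasurable f.
Proof. by move=> [fr fi]; split; exact: rintegrable_measurable. Qed.

Lemma cintegrable_le f h : cmeasurable f -> rintegrable h ->
  (forall x, cmod (f x) <= h x) -> cintegrable f.
Proof.
move=> [mr mi] ih fh; split; apply: (rintegrable_le _ ih) => // x.
  exact: le_trans (ler_Re_cmod _) (fh x).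
exact: le_trans (ler_Im_cmod _) (fh x).
Qed.

Lemma cintegrable_cmod f : cintegrable f -> rintegrable (fun x => cmod (f x)).
Proof.
move=> cf; have [fr fi] := cf.
apply: (rintegrable_le _ (rintegrableD (integrable_norm fr) (integrable_norm fi))).
  by apply: measurable_cmod; exact: cintegrable_measurable.
by move=> x; rewrite ger0_norm ?cmod_ge0 // cmod_le_ReIm.
Qed.

Lemma cintegrableP f : cintegrable f <->
  cmeasurable f /\ rintegrable (fun x => cmod (f x)).
Proof.
split=> [cf|[mf cf]]; last exact: cintegrable_le mf cf _.
by split; [exact: cintegrable_measurable|exact: cintegrable_cmod].
Qed.

Lemma cintegrableD f g : cintegrable f -> cintegrable g ->
  cintegrable (fun x => f x + g x).
Proof.
move=> [fr fi] [gr gi]; split.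
  by under eq_fun do rewrite cReD; exact: rintegrableD.
by under eq_fun do rewrite cImD; exact: rintegrableD.
Qed.

Lemma cintegrableMl B f g : cmeasurable f -> (forall x, cmod (f x) <= B) ->
  cintegrable g -> cintegrable (fun x => f x * g x).
Proof.
move=> mf fB ig; have ig' := cintegrable_cmod ig.
apply: (cintegrable_le _ (rintegrableZ B ig')).
  by apply: cmeasurableM => //; exact: cintegrable_measurable.
by move=> x; rewrite cmodM ler_wpM2r // cmod_ge0.
Qed.

Lemma cintegrableZ c f : cintegrable f -> cintegrable (fun x => c * f x).
Proof. by apply: (@cintegrableMl (cmod c) (fun=> c)) => //; exact: cmeasurable_cst. Qed.

Lemma cintegrableN f : cintegrable f -> cintegrable (fun x => - f x).
Proof. by under [X in _ -> cintegrable X]eq_fun do rewrite -mulN1r; exact: cintegrableZ. Qed.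

Lemma cintegrableB f g : cintegrable f -> cintegrable g ->
  cintegrable (fun x => f x - g x).
Proof. by move=> mf mg; apply: cintegrableD => //; exact: cintegrableN. Qed.

Lemma cintegrable0 : cintegrable (fun=> 0 : C).
Proof. by split; exact: integrable0. Qed.

Lemma cintegrable_sum (I : Type) (s : seq I) (F : I -> R -> C) :
  (forall i, cintegrable (F i)) -> cintegrable (fun x => \sum_(i <- s) F i x).
Proof.
move=> mF; elim: s => [|a s ih].
  by under eq_fun do rewrite big_nil; exact: cintegrable0.
by under eq_fun do rewrite big_cons; exact: cintegrableD.
Qed.

Lemma cintegralD f g : cintegrable f -> cintegrable g ->
  cintegral (fun x => f x + g x) = cintegral f + cintegral g.
Proof.
move=> [fr fi] [gr gi]; apply: complex_ext; rewrite ?cReD ?cImD /=.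
  by under eq_Rintegral do rewrite cReD; exact: RintegralD.
by under eq_Rintegral do rewrite cImD; exact: RintegralD.
Qed.

Lemma cintegralZ c f : cintegrable f ->
  cintegral (fun x => c * f x) = c * cintegral f.
Proof.
move=> [fr fi]; apply: complex_ext; rewrite ?cReM ?cImM /=.
  under eq_Rintegral do rewrite cReM.
  rewrite RintegralB //; [|exact: rintegrableZ..].
  by rewrite !RintegralZl.
under eq_Rintegral do rewrite cImM.
rewrite RintegralD //; [|exact: rintegrableZ..].
by rewrite !RintegralZl.
Qed.

Lemma cintegralN f : cintegrable f -> cintegral (fun x => - f x) = - cintegral f.
Proof.
by move=> cf; under eq_fun do rewrite -mulN1r; rewrite cintegralZ // mulN1r.
Qed.

Lemma cintegralB f g : cintegrable f -> cintegrable g ->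
  cintegral (fun x => f x - g x) = cintegral f - cintegral g.
Proof.
by move=> cf cg; rewrite cintegralD ?cintegralN //; exact: cintegrableN.
Qed.

Lemma cintegralJ f : cintegrable f -> cintegral (fun x => (f x)^*) = (cintegral f)^*.
Proof.
move=> [fr fi]; apply: complex_ext; rewrite ?cReJ ?cImJ /=.
  by under eq_Rintegral do rewrite cReJ.
under eq_Rintegral do rewrite cImJ -mulN1r.
by rewrite RintegralZl // mulN1r.
Qed.

Lemma cintegral0 : cintegral (fun=> 0 : C) = 0.
Proof. by apply: complex_ext; rewrite /= /Rintegral integral0. Qed.

Lemma cintegral_sum (I : Type) (s : seq I) (F : I -> R -> C) :
  (forall i, cintegrable (F i)) ->
  cintegral (fun x => \sum_(i <- s) F i x) = \sum_(i <- s) cintegral (F i).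
Proof.
move=> mF; elim: s => [|a s ih].
  by under eq_fun do rewrite big_nil; rewrite cintegral0 big_nil.
under eq_fun do rewrite big_cons.
by rewrite big_cons -ih cintegralD //; exact: cintegrable_sum.
Qed.

(** Measurability is that of Borel sets, so it has to be assumed of [k]: it does not pass along a.e.
    equality. *)
Lemma ae_eq_rintegrable h k : measurable_fun setT k -> {ae mu, forall x, h x = k x} ->
  rintegrable h -> rintegrable k.
Proof.
move=> mk hk ih; have mh := rintegrable_measurable ih.
apply/integrableP; split; first exact/measurable_EFinP.
have /integrableP[_] := ih; apply: le_lt_trans; rewrite le_eqVlt; apply/orP; left.
apply/eqP/ae_eq_integral => //.
- by apply: measurableT_comp => //; exact/measurable_EFinP.
- by apply: measurableT_comp => //; exact/measurable_EFinP.
- by apply: aeS hk => x /= -> _.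
Qed.

Lemma ae_eq_Rintegral h k : measurable_fun setT h -> measurable_fun setT k ->
  {ae mu, forall x, h x = k x} -> \int[mu]_x h x = \int[mu]_x k x.
Proof.
move=> mh mk hk; congr fine; apply: ae_eq_integral => //.
- exact/measurable_EFinP.
- exact/measurable_EFinP.
- by apply: aeS hk => x /= -> _.
Qed.

Lemma ae_eq_cintegral f g : cmeasurable f -> cmeasurable g ->
  {ae mu, forall x, f x = g x} -> cintegral f = cintegral g.
Proof.
move=> [fr fi] [gr gi] fg; apply: complex_ext; apply: ae_eq_Rintegral => //;
  by apply: aeS fg => x ->.
Qed.

(* Rotating [f] by the phase of its integral reduces to the real case. *)
Lemma cmod_cintegral_le f : cintegrable f ->
  cmod (cintegral f) <= \int[mu]_x cmod (f x).
Proof.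
move=> cf; set z := cintegral f.
have icf := cintegrable_cmod cf.
have [z0|zn0] := eqVneq (cmod z) 0.
  by rewrite z0; apply: Rintegral_ge0 => x _; exact: cmod_ge0.
have zpos : 0 < cmod z by rewrite lt_neqAle eq_sym zn0 cmod_ge0.
pose u := (cmod z)^-1%:C * z^*.
have u1 : cmod u = 1.
  by rewrite cmodM cmod_real cmod_conj gtr0_norm ?invr_gt0 // mulVf.
have -> : cmod z = Re (cintegral (fun x => u * f x)).
  rewrite cintegralZ // -/z /u Re_conjZM expr2 mulrA mulVf // mul1r //.
rewrite /=; apply: le_Rintegral => //; first by case: (cintegrableZ u cf).
by move=> x _; rewrite (le_trans (ler_norm _)) // (le_trans (ler_Re_cmod _)) // cmodM u1 mul1r.
Qed.

Definition ccvg (u : nat -> C) (l : C) := cmod (u n - l) @[n --> \oo] --> (0 : R).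

Lemma ccvgP (u : nat -> C) l : ccvg u l <->
  (Re (u n) @[n --> \oo] --> Re l) /\ (Im (u n) @[n --> \oo] --> Im l).
Proof.
split=> [ul|[ur ui]].
  split; apply/cvgrPdist_le => e e0; move/cvgrPdist_le: ul => /(_ e e0);
  apply: filterS => n; rewrite sub0r normrN ger0_norm ?cmod_ge0 // => h.
    by rewrite distrC -cReB (le_trans (ler_Re_cmod _)).
  by rewrite distrC -cImB (le_trans (ler_Im_cmod _)).
apply/cvgrPdist_le => e e0.
move/cvgrPdist_le: ur => /(_ (e / 2) ltac:(by rewrite divr_gt0)) ur.
move/cvgrPdist_le: ui => /(_ (e / 2) ltac:(by rewrite divr_gt0)) ui.
apply: filterS2 ur ui => n hr hi.
rewrite sub0r normrN ger0_norm ?cmod_ge0 // cmodC (le_trans (cmod_le_ReIm _)) //.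
by rewrite cReB cImB; lra.
Qed.

Lemma ccvg_unique (u : nat -> C) l l' : ccvg u l -> ccvg u l' -> l = l'.
Proof.
move=> /ccvgP[ur ui] /ccvgP[vr vi]; apply: complex_ext.
  exact: (cvg_unique _ ur vr).
exact: (cvg_unique _ ui vi).
Qed.

Lemma cmeasurable_cvg (u : nat -> R -> C) f : (forall n, cmeasurable (u n)) ->
  (forall x, ccvg (u ^~ x) (f x)) -> cmeasurable f.
Proof.
move=> mu_ uf; split.
  apply: (@measurable_fun_cvg _ _ _ setT (fun n x => Re (u n x))).
    by move=> n; case: (mu_ n).
  by move=> x _; have /ccvgP[] := uf x.
apply: (@measurable_fun_cvg _ _ _ setT (fun n x => Im (u n x))).
  by move=> n; case: (mu_ n).
by move=> x _; have /ccvgP[] := uf x.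
Qed.

Lemma dominated_Rintegral (u : nat -> R -> R) h (g : R -> R) :
  (forall n, measurable_fun setT (u n)) -> measurable_fun setT h -> rintegrable g ->
  {ae mu, forall x, u n x @[n --> \oo] --> h x} ->
  {ae mu, forall x, forall n, `|u n x| <= g x} ->
  rintegrable h /\ (\int[mu]_x u n x @[n --> \oo] --> \int[mu]_x h x).
Proof.
move=> mu_ mh ig uh ug.
have mE n : measurable_fun setT (EFin \o u n) by exact/measurable_EFinP.
have mhE : measurable_fun setT (EFin \o h) by exact/measurable_EFinP.
have uhE : {ae mu, forall x, setT x -> (EFin \o u n) x @[n --> \oo] --> (EFin \o h) x}.
  by apply: aeS uh => x uh _; apply: cvg_EFin => //; exact: nearW.
have ugE : {ae mu, forall x, forall n, setT x -> (`|(EFin \o u n) x| <= (EFin \o g) x)%E}.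
  by apply: aeS ug => x ug n _; rewrite /= lee_fin.
have [] := @dominated_convergence _ _ _ mu setT measurableT _ _ _ mE mhE uhE ig ugE.
move=> ih _ cv; split => //.
rewrite /Rintegral; apply: fine_cvg.
rewrite fineK; first exact: cv.
exact: integrable_fin_num.
Qed.

Lemma dominated_cintegral (u : nat -> R -> C) f (g : R -> R) :
  (forall n, cmeasurable (u n)) -> cmeasurable f -> rintegrable g ->
  {ae mu, forall x, ccvg (u ^~ x) (f x)} ->
  {ae mu, forall x, forall n, cmod (u n x) <= g x} ->
  cintegrable f /\ ccvg (fun n => cintegral (u n)) (cintegral f).
Proof.
move=> mu_ [mr mi] ig uf ug.
have ur : {ae mu, forall x, Re (u n x) @[n --> \oo] --> Re (f x)}.
  by apply: aeS uf => x /ccvgP[].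
have ui : {ae mu, forall x, Im (u n x) @[n --> \oo] --> Im (f x)}.
  by apply: aeS uf => x /ccvgP[].
have gr : {ae mu, forall x, forall n, `|Re (u n x)| <= g x}.
  by apply: aeS ug => x h n; exact: le_trans (ler_Re_cmod _) (h n).
have gi : {ae mu, forall x, forall n, `|Im (u n x)| <= g x}.
  by apply: aeS ug => x h n; exact: le_trans (ler_Im_cmod _) (h n).
have [ir cr] := dominated_Rintegral (fun n => (mu_ n).1) mr ig ur gr.
have [ii ci] := dominated_Rintegral (fun n => (mu_ n).2) mi ig ui gi.
by split; [split|apply/ccvgP].
Qed.

End ComplexIntegral.

Section L2Space.
Context {R : realType}.
Local Notation mu := (@lebesgue_measure R).
Local Notation C := R[i].
Implicit Types (f g : R -> C) (h : R -> R).

Definition sqint f : R := \int[mu]_x (cmod (f x) ^+ 2).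

Lemma sqint_ge0 f : 0 <= sqint f.
Proof. by apply: Rintegral_ge0 => x _; exact: sqr_ge0. Qed.

Lemma L2normE f : L2norm f = ((\int[mu]_x (cmod (f x) ^+ 2)%:E) `^ 2^-1)%E.
Proof.
rewrite /L2norm unlock; congr (poweR _ _); apply: eq_integral => x _ /=.
by rewrite ger0_norm ?cmod_ge0 // powR_mulrn ?cmod_ge0.
Qed.

Lemma L2P f : L2 f <-> cmeasurable f /\ rintegrable (fun x => cmod (f x) ^+ 2).
Proof.
have pos : (0 <= \int[mu]_x (cmod (f x) ^+ 2)%:E)%E.
  by apply: integral_ge0 => x _; rewrite lee_fin sqr_ge0.
have absE : (\int[mu]_x `|(cmod (f x) ^+ 2)%:E| = \int[mu]_x (cmod (f x) ^+ 2)%:E)%E.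
  by apply: eq_integral => x _; rewrite gee0_abs // lee_fin sqr_ge0.
split=> [[mf]|[mf /integrableP[_]]].
  rewrite /= L2normE => hf; split => //; apply/integrableP; split.
    by apply/measurable_EFinP; apply: measurable_funX; exact: measurable_cmod.
  by rewrite /comp absE; apply: lty_poweRy hf; rewrite invr_eq0 pnatr_eq0.
rewrite /comp absE => hf; split => //; rewrite /= L2normE.
by rewrite poweR_lty.
Qed.

Lemma L2_measurable f : L2 f -> cmeasurable f.
Proof. by case/L2P. Qed.

Lemma L2normE_L2 f : L2 f -> L2norm f = (Num.sqrt (sqint f))%:E.
Proof.
move=> /L2P[mf if2]; rewrite L2normE /sqint /Rintegral.
have /fineK <- := integrable_fin_num measurableT if2.
by rewrite poweR_EFin powR12_sqrt // fine_ge0 // integral_ge0 // => x _; rewrite lee_fin sqr_ge0.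
Qed.

Lemma L2_le f g : cmeasurable f -> L2 g -> (forall x, cmod (f x) <= cmod (g x)) -> L2 f.
Proof.
move=> mf /L2P[mg ig] fg; apply/L2P; split => //.
apply: (rintegrable_le _ ig); first by apply: measurable_funX; exact: measurable_cmod.
move=> x; rewrite ger0_norm ?sqr_ge0 //.
by rewrite ler_pXn2r ?nnegrE ?cmod_ge0.
Qed.

Lemma L2D f g : L2 f -> L2 g -> L2 (fun x => f x + g x).
Proof.
move=> /L2P[mf if2] /L2P[mg ig2]; apply/L2P.
have mfg := cmeasurableD mf mg; split => //.
apply: (rintegrable_le _ (rintegrableZ 2 (rintegrableD if2 ig2))).
  by apply: measurable_funX; exact: measurable_cmod.
move=> x; rewrite ger0_norm ?sqr_ge0 //.
have := cmodD (f x) (g x); have := cmod_ge0 (f x + g x).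
have := sqr_ge0 (cmod (f x) - cmod (g x)).
by move: (cmod _) (cmod _) (cmod _) => a b c; nra.
Qed.

Lemma L2Ml B f g : cmeasurable f -> (forall x, cmod (f x) <= B) -> L2 g ->
  L2 (fun x => f x * g x).
Proof.
move=> mf fB g2; have mg := L2_measurable g2.
have /L2P[_ ig] := g2; apply/L2P; split; first exact: cmeasurableM.
apply: (rintegrable_le _ (rintegrableZ (B ^+ 2) ig)).
  by apply: measurable_funX; apply: measurable_cmod; exact: cmeasurableM.
move=> x; rewrite ger0_norm ?sqr_ge0 // cmodM exprMn ler_wpM2r ?sqr_ge0 //.
by rewrite ler_pXn2r ?nnegrE ?cmod_ge0 // (le_trans (cmod_ge0 (f x))).
Qed.

Lemma L2Z c f : L2 f -> L2 (fun x => c * f x).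
Proof. by apply: (@L2Ml (cmod c) (fun=> c)) => //; exact: cmeasurable_cst. Qed.

Lemma L2N f : L2 f -> L2 (fun x => - f x).
Proof. by under [X in _ -> L2 X]eq_fun do rewrite -mulN1r; exact: L2Z. Qed.

Lemma L2B f g : L2 f -> L2 g -> L2 (fun x => f x - g x).
Proof. by move=> f2 g2; apply: L2D => //; exact: L2N. Qed.

Lemma L2_0 : L2 (0 : R -> C).
Proof.
apply/L2P; split; first exact: cmeasurable_cst.
have -> : (fun x => cmod ((0 : R -> C) x) ^+ 2) = (fun=> 0).
  by apply/funext => x; rewrite cmod0 expr0n.
exact: integrable0.
Qed.

Lemma L2J f : L2 f -> L2 (fun x => (f x)^*).
Proof.
by move=> f2; apply: (L2_le _ f2); [exact/cmeasurableJ/L2_measurable|move=> x; rewrite cmod_conj].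
Qed.

Lemma L2M_cintegrable f g : L2 f -> L2 g -> cintegrable (fun x => f x * g x).
Proof.
move=> /L2P[mf if2] /L2P[mg ig2].
apply: (cintegrable_le (cmeasurableM mf mg) (rintegrableD if2 ig2)) => x.
rewrite cmodM; have := sqr_ge0 (cmod (f x) - cmod (g x)).
have := cmod_ge0 (f x); have := cmod_ge0 (g x).
by move: (cmod _) (cmod _) => a b; nra.
Qed.

Lemma inner_cintegrable f g : L2 f -> L2 g -> cintegrable (fun x => f x * (g x)^*).
Proof. by move=> f2 g2; apply: L2M_cintegrable => //; exact: L2J. Qed.

Lemma inner_self f : inner f f = (sqint f)%:C.
Proof.
apply: complex_ext; rewrite /inner /=.
  by apply: eq_Rintegral => x _; rewrite mulcJ.
under eq_Rintegral do rewrite mulcJ /=.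
by rewrite /Rintegral integral0.
Qed.

(** [C^o] is the field seen as a module over itself, which gives functions their pointwise module
    structure. *)
Definition L2pred : {pred R -> C^o} := fun f => `[< L2 f >].

Lemma L2pred_submod : submod_closed L2pred.
Proof.
split; first by apply/asboolP; exact: L2_0.
by move=> a f g /asboolP f2 /asboolP g2; apply/asboolP; apply: L2D => //; exact: L2Z.
Qed.

HB.instance Definition _ := GRing.isSubmodClosed.Build _ _ L2pred L2pred_submod.

Definition L2fun : Type := {f : R -> C^o | L2pred f}.
HB.instance Definition _ := SubType.on L2fun.
HB.instance Definition _ := [Choice of L2fun by <:].
HB.instance Definition _ := [SubChoice_isSubLmodule of L2fun by <:].

End L2Space.
Arguments L2fun : clear implicits.

(** * Completeness of L^2 *)

Section RieszFischer.
Context {R : realType}.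
Local Notation mu := (@lebesgue_measure R).

(** Nested intervals [a n, b n] around [v n]: the radius 2 s / 2^n is the tail of the geometric
    series of steps. The explicit rate is what yields a pointwise majorant later. *)
Lemma geometric_limit (v : nat -> R) (s : R) :
  (forall n, `|v n.+1 - v n| <= s / 2 ^+ n) ->
  exists l, forall n, `|v n - l| <= 2 * s / 2 ^+ n.
Proof.
move=> hv; pose a n := v n - 2 * s / 2 ^+ n; pose b n := v n + 2 * s / 2 ^+ n.
have s0 : 0 <= s by have := hv 0%N; rewrite expr0 divr1; exact: le_trans.
have step n : 2 * s / 2 ^+ n = 2 * s / 2 ^+ n.+1 + s / 2 ^+ n.
  by rewrite exprS; field.
have aS n : a n <= a n.+1.
  by rewrite /a [in leLHS]step; have := hv n; rewrite ler_norml => /andP[]; lra.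
have bS n : b n.+1 <= b n.
  by rewrite /b [in leRHS]step; have := hv n; rewrite ler_norml => /andP[]; lra.
have nda : {homo a : n m / (n <= m)%N >-> n <= m} by exact/nondecreasing_seqP.
have nib : {homo b : n m / (n <= m)%N >-> m <= n}.
  by move=> n m; elim: m n => [|m ih] n; [rewrite leqn0 => /eqP ->|
    rewrite leq_eqVlt => /predU1P[-> //|/ih/(le_trans (bS m))]].
have p0 n : 0 <= 2 * s / 2 ^+ n by rewrite divr_ge0 ?mulr_ge0 // exprn_ge0.
have ab n m : a n <= b m.
  apply: (le_trans (nda _ _ (leq_maxl n m))); apply: le_trans (nib _ _ (leq_maxr n m)).
  by rewrite /a /b; have := p0 (maxn n m); lra.
exists (sup (range a)) => n.
have h1 : a n <= sup (range a).
  by apply: ub_le_sup; [exists (b 0%N) => _ [m _ <-]|exists n].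
have h2 : sup (range a) <= b n.
  by apply: ge_sup; [exists (a 0%N), 0%N|move=> _ [m _ <-]].
by move: h1 h2; rewrite /a /b ler_norml => h1 h2; apply/andP; split; lra.
Qed.

Lemma nneseries_le (a : nat -> \bar R) (B : \bar R) : (forall n, 0 <= a n)%E ->
  (forall n, \sum_(0 <= k < n) a k <= B)%E -> (\sum_(k <oo) a k <= B)%E.
Proof.
move=> a0 aB; apply: lime_le; first exact: is_cvg_nneseries.
exact: nearW.
Qed.

(* Along a subsequence with [\int d_k^2 <= 8^-k], where [d_k] are the successive
   differences, [G = \sum 4^k d_k^2] is integrable and [|d_k| <= sqrt G / 2^k]. *)
Lemma riesz_fischer_real (u : nat -> R -> R) :
  (forall n, measurable_fun setT (u n)) ->
  (forall m n, rintegrable (fun x => (u m x - u n x) ^+ 2)) ->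
  (forall e, 0 < e -> exists N, forall m n, (N <= m)%N -> (N <= n)%N ->
     \int[mu]_x (u m x - u n x) ^+ 2 <= e) ->
  exists f : R -> R, [/\ measurable_fun setT f,
    forall n, rintegrable (fun x => (u n x - f x) ^+ 2) &
    forall e, 0 < e -> exists N, forall n, (N <= n)%N ->
      \int[mu]_x (u n x - f x) ^+ 2 <= e].
Proof.
move=> mu_ iu cu.
(* The rate 8^-k leaves 4^k * 8^-k = 2^-k after weighting, so that [G] has integral at most 2. *)
have /choice[N hN] : forall k : nat, exists N, forall m n, (N <= m)%N -> (N <= n)%N ->
    \int[mu]_x (u m x - u n x) ^+ 2 <= (8 ^+ k)^-1.
  by move=> k; apply: cu; rewrite invr_gt0 exprn_gt0.
pose K := fix K k := if k is j.+1 then maxn (K j) (N j.+1) else N 0%N.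
have NK k : (N k <= K k)%N by case: k => //= k; exact: leq_maxr.
have KS k : (K k <= K k.+1)%N by exact: leq_maxl.
pose v k := u (K k); pose d k x := v k.+1 x - v k x.
have id k : rintegrable (fun x => d k x ^+ 2) by exact: iu.
have dk k : \int[mu]_x d k x ^+ 2 <= (8 ^+ k)^-1.
  by apply: hN => //; exact: leq_trans (KS k).
pose G x := (\sum_(k <oo) (4 ^+ k * d k x ^+ 2)%:E)%E.
have t0 k x : (0 <= (4 ^+ k * d k x ^+ 2)%:E)%E.
  by rewrite lee_fin mulr_ge0 ?sqr_ge0 // exprn_ge0.
have mt k : measurable_fun setT (fun x => (4 ^+ k * d k x ^+ 2)%:E).
  by apply/measurable_EFinP; apply: rintegrable_measurable; exact: rintegrableZ.
have mG : measurable_fun setT G.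
  apply: (@ge0_emeasurable_sum _ _ R setT (fun k x => (4 ^+ k * d k x ^+ 2)%:E) xpredT).
    by move=> k x _ _; exact: t0.
  by move=> k _; exact: mt.
have G0 x : (0 <= G x)%E by apply: nneseries_ge0 => k _ _; exact: t0.
have iG2 : (\int[mu]_x G x <= 2%:E)%E.
  rewrite integral_nneseries //.
  apply: nneseries_le => [k|n]; first by apply: integral_ge0 => x _; exact: t0.
  (* This is the exact value of the sum of 2^-k over k < n, which makes the induction close. *)
  apply: (@le_trans _ _ (2 - 2 / 2 ^+ n)%:E); last first.
    by rewrite lee_fin gerBl divr_ge0 // exprn_ge0.
  elim: n => [|n ih]; first by rewrite big_nil expr0 divr1 subrr.
  rewrite big_nat_recr //=; apply: le_trans (leeD ih (_ : (_ <= ((2 ^+ n)^-1)%R%:E)%E)) _.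
    have /fineK <- := integrable_fin_num measurableT (rintegrableZ (4 ^+ n) (id n)).
    rewrite lee_fin -[fine _]/(\int[mu]_x (4 ^+ n * d n x ^+ 2)) RintegralZl //; last exact: id.
    apply: (@le_trans _ _ (4 ^+ n * (8 ^+ n)^-1)); first by rewrite ler_pM2l ?exprn_gt0.
    have -> : (8 : R) ^+ n = 4 ^+ n * 2 ^+ n by rewrite -exprMn; congr (_ ^+ _); ring.
    by rewrite invfM mulrA mulfV ?mul1r // gt_eqF // exprn_gt0.
  rewrite -EFinD lee_fin exprS.
  have : 2 * (2 ^+ n)^-1 = 2 / (2 * 2 ^+ n) + (2 ^+ n)^-1 :> R by field.
  by move: ((2 ^+ n)^-1) => q; lra.
have iG : mu.-integrable setT G.
  apply/integrableP; split => //; under eq_integral do rewrite gee0_abs //.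
  by rewrite (le_lt_trans iG2) // ltry.
pose A := [set x | (G x < +oo)%E].
have mA : measurable A.
  by rewrite -[A]setTI; exact: emeasurable_fun_infty_o.
have aeA : {ae mu, forall x, A x}.
  apply: aeS (integrable_ae measurableT iG) => x /(_ I).
  by rewrite ge0_fin_numE.
(* Cutting off to the set where [G] is finite makes the sequence converge at every point, so that
   its limit is measurable. *)
pose w k x := \1_A x * v k x.
pose g x := fine (\1_A x)%:E * fine (G x).
have gG x : ((g x)%:E <= G x)%E.
  rewrite /g /= indicE; case: (boolP (x \in A)) => xA; last by rewrite mul0r.
  by rewrite mul1r fineK // ge0_fin_numE //; exact: (set_mem xA).
have g0 x : 0 <= g x by rewrite mulr_ge0 // fine_ge0.
have mg : measurable_fun setT g.
  apply: measurable_funM; first exact: measurable_indic.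
  by apply: (@measurableT_comp _ _ _ _ _ _ fine) => //; exact: fine_measurable.
have ig : rintegrable g.
  apply: (le_integrable _ _ _ iG) => //; first exact/measurable_EFinP.
  by move=> x _; rewrite gee0_abs ?lee_fin //= gee0_abs.
have wstep x k : `|w k.+1 x - w k x| <= Num.sqrt (g x) / 2 ^+ k.
  rewrite /w -mulrBr -/(d k x) /g /= indicE; case: (boolP (x \in A)) => xA; last first.
    by rewrite !mul0r normr0 sqrtr0 mul0r.
  rewrite !mul1r ler_pdivlMr ?exprn_gt0 //.
  rewrite -(ger0_norm (exprn_ge0 k (ler0n _ 2))) -normrM -sqrtr_sqr ler_wsqrtr //.
  rewrite -lee_fin fineK ?ge0_fin_numE //; last exact: (set_mem xA).
  have -> : ((d k x * 2 ^+ k) ^+ 2)%:E = (4 ^+ k * d k x ^+ 2)%:E.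
    by congr (_%:E); rewrite exprMn mulrC exprAC; congr (_ ^+ _ * _); ring.
  have := @nneseries_lim_ge R (fun k => (4 ^+ k * d k x ^+ 2)%:E) xpredT 0 k.+1.
  move=> /(_ (fun k _ _ => t0 k x)); apply: le_trans.
  rewrite big_nat_recr //= leeDr //.
  by apply: sume_ge0 => i _; exact: t0.
have /choice[f hf] : forall x, exists l, forall n, `|w n x - l| <= 2 * Num.sqrt (g x) / 2 ^+ n.
  by move=> x; apply: geometric_limit => n; exact: wstep.
have mf : measurable_fun setT f.
  apply: (@measurable_fun_cvg _ _ _ setT w).
    by move=> n; apply: measurable_funM; [exact: measurable_indic|exact: mu_].
  move=> x _; apply/cvgrPdist_le => e e0.
  have : (fun n => 2 * Num.sqrt (g x) / 2 ^+ n) @ \oo --> 2 * Num.sqrt (g x) * 0.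
    apply: cvgMr; under eq_fun do rewrite -exprVn.
    by apply: cvg_expr; rewrite ger0_norm ?invr_ge0 // invf_lt1 // ltr1n.
  rewrite mulr0 => /cvgrPdist_le /(_ e e0); apply: filterS => n.
  rewrite sub0r normrN distrC => h; apply: le_trans (hf x n) _.
  exact: le_trans (ler_norm _) h.
have wf x k : (w k x - f x) ^+ 2 <= 4 / 4 ^+ k * g x.
  have p0 : 0 <= 2 * Num.sqrt (g x) / 2 ^+ k.
    by rewrite divr_ge0 ?exprn_ge0 // mulr_ge0 // sqrtr_ge0.
  have := hf x k; rewrite -(ler_pXn2r (ltn0Sn 1)) ?nnegrE //.
  rewrite real_normK ?num_real // => /le_trans; apply.
  rewrite !exprMn sqr_sqrtr // exprVn exprAC.
  have -> : (2 : R) ^+ 2 = 4 by ring.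
  by rewrite mulrAC.
have vw k : {ae mu, forall x, w k x = v k x}.
  by apply: aeS aeA => x Ax; rewrite /w indicE mem_set // mul1r.
have mwf k : measurable_fun setT (fun x => (w k x - f x) ^+ 2).
  apply: measurable_funX; apply: measurable_funB => //.
  by apply: measurable_funM; [exact: measurable_indic|exact: mu_].
have mvf n : measurable_fun setT (fun x => (u n x - f x) ^+ 2).
  by apply: measurable_funX; apply: measurable_funB.
have iwf k : rintegrable (fun x => (w k x - f x) ^+ 2).
  apply: (rintegrable_le _ (rintegrableZ (4 / 4 ^+ k) ig)) => // x.
  by rewrite ger0_norm ?sqr_ge0.
have ivf k : rintegrable (fun x => (v k x - f x) ^+ 2).
  by apply: (ae_eq_rintegrable (mvf (K k)) _ (iwf k)); apply: aeS (vw k) => x ->.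
have ivfk k : \int[mu]_x (v k x - f x) ^+ 2 <= 8 / 4 ^+ k.
  have -> : \int[mu]_x (v k x - f x) ^+ 2 = \int[mu]_x (w k x - f x) ^+ 2.
    by apply: (ae_eq_Rintegral (mvf (K k)) (mwf k)); apply: aeS (vw k) => x ->.
  apply: (@le_trans _ _ (\int[mu]_x (4 / 4 ^+ k * g x))).
    by apply: le_Rintegral => //; [exact: iwf|exact: rintegrableZ].
  rewrite RintegralZl // mulrAC ler_pM2r ?invr_gt0 ?exprn_gt0 //.
  have : \int[mu]_x g x <= 2.
    rewrite -lee_fin /Rintegral fineK; last exact: integrable_fin_num.
    apply: le_trans iG2; apply: ge0_le_integral => //; first by move=> x _; rewrite lee_fin.
    exact/measurable_EFinP.
  lra.
have bnd n k x : (u n x - f x) ^+ 2 <= 2 * (u n x - v k x) ^+ 2 + 2 * (v k x - f x) ^+ 2.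
  by have := sqr_ge0 ((u n x - v k x) - (v k x - f x)); lra.
have iuf n : rintegrable (fun x => (u n x - f x) ^+ 2).
  have i1 := rintegrableZ 2 (iu n (K 0%N)); have i2 := rintegrableZ 2 (ivf 0%N).
  apply: (rintegrable_le _ (rintegrableD i1 i2)) => // x.
  by rewrite ger0_norm ?sqr_ge0 //; exact: (bnd n 0%N).
exists f; split => // e e0.
(* 18 = 2 + 16: twice 8^-k <= 4^-k from the Cauchy estimate, and twice 8 / 4^k from the
   subsequence. *)
have [k hk] : exists k : nat, 18 / 4 ^+ k <= e.
  have : (fun n => 18 / 4 ^+ n) @ \oo --> (18 * 0 : R).
    apply: cvgMr; under eq_fun do rewrite -exprVn.
    by apply: cvg_expr; rewrite ger0_norm ?invr_ge0 // invf_lt1 // ltr1n.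
  rewrite mulr0 => /cvgrPdist_le /(_ e e0) [k _ /(_ k (leqnn k))].
  by rewrite /= sub0r normrN => h; exists k; exact: le_trans (ler_norm _) h.
exists (N k) => n hn; apply: le_trans hk.
have i1 := rintegrableZ 2 (iu n (K k)); have i2 := rintegrableZ 2 (ivf k).
apply: (@le_trans _ _ (\int[mu]_x (2 * (u n x - v k x) ^+ 2 + 2 * (v k x - f x) ^+ 2))).
  by apply: le_Rintegral => //; [exact: iuf|exact: rintegrableD].
rewrite RintegralD // !RintegralZl //; [|exact: ivf|exact: iu].
have h1 := hN k n (K k) hn (NK k); have h2 := ivfk k.
have h3 : (8 ^+ k)^-1 <= (4 ^+ k)^-1 :> R.
  by rewrite lef_pV2 ?posrE ?exprn_gt0 // lerXn2r ?nnegrE // ler_nat.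
move: h1 h2 h3; rewrite -/(v k).
by move: ((8 ^+ k)^-1) ((4 ^+ k)^-1) => p q; lra.
Qed.

End RieszFischer.

(** * Inner product of L^2 and translation invariance *)

Section L2InnerProduct.
Context {R : realType}.
Local Notation mu := (@lebesgue_measure R).
Local Notation C := R[i].
Implicit Types (f g : R -> C) (h : R -> R).

Definition toL2 f (hf : L2 f) : L2fun R := exist _ (f : R -> C^o) (asboolT hf).

Lemma L2funP (x : L2fun R) : L2 (val x).
Proof. by case: x => f /= /asboolP. Qed.

Definition ipL2 (x y : L2fun R) : C := inner (val x) (val y).

Lemma ipL2_inner_product : inner_product ipL2.
Proof.
split=> [x y z|a x z|x y|x]; rewrite /ipL2 /inner.
- rewrite -cintegralD; try exact: inner_cintegrable (L2funP _) (L2funP _).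
  by congr cintegral; apply/funext => t /=; rewrite -mulrDl.
- rewrite -cintegralZ; last exact: inner_cintegrable (L2funP _) (L2funP _).
  by congr cintegral; apply/funext => t /=; rewrite mulrA.
- rewrite -cintegralJ; last exact: inner_cintegrable (L2funP _) (L2funP _).
  by congr cintegral; apply/funext => t /=; rewrite rmorphM /= conjCK mulrC.
- by rewrite -[cintegral _]/(inner _ _) inner_self sqint_ge0.
Qed.

Lemma hnormL2_sqr (x : L2fun R) : hnorm ipL2 x ^+ 2 = sqint (val x).
Proof. by rewrite (hnorm_sqr ipL2_inner_product) /ipL2 inner_self. Qed.

Lemma L2norm_hnorm (x : L2fun R) : L2norm (val x) = (hnorm ipL2 x)%:E.
Proof. by rewrite L2normE_L2 ?/hnorm ?/ipL2 ?inner_self //; exact: L2funP. Qed.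

Lemma sqint_ReIm f : L2 f ->
  sqint f = \int[mu]_x Re (f x) ^+ 2 + \int[mu]_x Im (f x) ^+ 2.
Proof.
move=> /L2P[[mr mi] if2]; rewrite -RintegralD //.
- by apply: eq_Rintegral => x _; rewrite cmod_sqr.
- apply: (rintegrable_le _ if2); first exact: measurable_funX.
  by move=> x; rewrite ger0_norm ?sqr_ge0 // cmod_sqr lerDl sqr_ge0.
- apply: (rintegrable_le _ if2); first exact: measurable_funX.
  by move=> x; rewrite ger0_norm ?sqr_ge0 // cmod_sqr lerDr sqr_ge0.
Qed.

Lemma L2_ReIm (h k : R -> R) : measurable_fun setT h -> measurable_fun setT k ->
  rintegrable (fun x => h x ^+ 2) -> rintegrable (fun x => k x ^+ 2) ->
  L2 (fun x => h x +i* k x).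
Proof.
move=> mh mk ih ik; apply/L2P; split; first by split.
by under eq_fun do rewrite cmod_sqr /=; exact: rintegrableD.
Qed.

Lemma L2_rintegrable_Re f : L2 f -> rintegrable (fun x => Re (f x) ^+ 2).
Proof.
move=> /L2P[[mr mi] if2]; apply: (rintegrable_le _ if2); first exact: measurable_funX.
by move=> x; rewrite ger0_norm ?sqr_ge0 // cmod_sqr lerDl sqr_ge0.
Qed.

Lemma L2_rintegrable_Im f : L2 f -> rintegrable (fun x => Im (f x) ^+ 2).
Proof.
move=> /L2P[[mr mi] if2]; apply: (rintegrable_le _ if2); first exact: measurable_funX.
by move=> x; rewrite ger0_norm ?sqr_ge0 // cmod_sqr lerDr sqr_ge0.
Qed.

Lemma ipL2_complete : ip_complete ipL2.
Proof.
move=> u cu.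
have hB (x y : L2fun R) : hnorm ipL2 (x - y) ^+ 2 = \int[mu]_t (Re (val x t) - Re (val y t)) ^+ 2
   + \int[mu]_t (Im (val x t) - Im (val y t)) ^+ 2.
  rewrite hnormL2_sqr (sqint_ReIm (L2funP _)).
  by congr (_ + _); apply: eq_Rintegral => t _; rewrite -?cReB -?cImB.
have cRe e : 0 < e -> exists N, forall m n, (N <= m)%N -> (N <= n)%N ->
    \int[mu]_t (Re (val (u m) t) - Re (val (u n) t)) ^+ 2 <= e.
  move=> e0; have [|N hN] := cu (Num.sqrt e); first by rewrite sqrtr_gt0.
  exists N => m n hm hn.
  have : hnorm ipL2 (u m - u n) ^+ 2 <= Num.sqrt e ^+ 2.
    by rewrite ler_pXn2r ?nnegrE ?hnorm_ge0 ?sqrtr_ge0 //; exact: hN.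
  rewrite [Num.sqrt e ^+ 2]sqr_sqrtr ?(ltW e0) // hB.
  by apply: le_trans; rewrite lerDl; apply: Rintegral_ge0 => x _; exact: sqr_ge0.
have cIm e : 0 < e -> exists N, forall m n, (N <= m)%N -> (N <= n)%N ->
    \int[mu]_t (Im (val (u m) t) - Im (val (u n) t)) ^+ 2 <= e.
  move=> e0; have [|N hN] := cu (Num.sqrt e); first by rewrite sqrtr_gt0.
  exists N => m n hm hn.
  have : hnorm ipL2 (u m - u n) ^+ 2 <= Num.sqrt e ^+ 2.
    by rewrite ler_pXn2r ?nnegrE ?hnorm_ge0 ?sqrtr_ge0 //; exact: hN.
  rewrite [Num.sqrt e ^+ 2]sqr_sqrtr ?(ltW e0) // hB.
  by apply: le_trans; rewrite lerDr; apply: Rintegral_ge0 => x _; exact: sqr_ge0.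
have iRe m n : rintegrable (fun t => (Re (val (u m) t) - Re (val (u n) t)) ^+ 2).
  by under eq_fun do rewrite -cReB; exact: (L2_rintegrable_Re (L2funP (u m - u n))).
have iIm m n : rintegrable (fun t => (Im (val (u m) t) - Im (val (u n) t)) ^+ 2).
  by under eq_fun do rewrite -cImB; exact: (L2_rintegrable_Im (L2funP (u m - u n))).
have mR n : measurable_fun setT (fun t => Re (val (u n) t)).
  by case: (L2_measurable (L2funP (u n))).
have mI n : measurable_fun setT (fun t => Im (val (u n) t)).
  by case: (L2_measurable (L2funP (u n))).
have [fr [mfr ifr hfr]] := riesz_fischer_real mR iRe cRe.
have [fi [mfi ifi hfi]] := riesz_fischer_real mI iIm cIm.
pose f t := fr t +i* fi t.
(* Only differences from the limit are known to be square integrable; [f] is recovered by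
   subtracting one from [u 0]. *)
have d2 : L2 (fun t => val (u 0%N) t - f t).
  have := @L2_ReIm (fun t => Re (val (u 0%N) t) - fr t) (fun t => Im (val (u 0%N) t) - fi t).
  move=> /(_ (measurable_funB (mR 0%N) mfr) (measurable_funB (mI 0%N) mfi) (ifr 0%N) (ifi 0%N)).
  by congr L2; apply/funext => t; apply: complex_ext; rewrite ?cReB ?cImB.
have f2 : L2 f.
  have := L2B (L2funP (u 0%N)) d2; congr L2; apply/funext => t.
  by rewrite opprB addrC subrK.
exists (toL2 f2) => e e0.
have e2 : 0 < e ^+ 2 / 2 by rewrite divr_gt0 // exprn_gt0.
have [N1 h1] := hfr _ e2; have [N2 h2] := hfi _ e2.
exists (maxn N1 N2) => n; rewrite geq_max => /andP[/h1 {}h1 /h2 {}h2].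
rewrite -(ler_pXn2r (ltn0Sn 1)) ?nnegrE ?hnorm_ge0 //; last exact: ltW.
by rewrite hB /=; lra.
Qed.

Lemma ae_eq_L2 f g : cmeasurable g -> {ae mu, forall x, f x = g x} -> L2 f -> L2 g.
Proof.
move=> mg fg /L2P[mf if2]; apply/L2P; split => //.
apply: (ae_eq_rintegrable _ _ if2); last by apply: aeS fg => x ->.
by apply: measurable_funX; exact: measurable_cmod.
Qed.

Lemma measurable_shift (a : R) (h : R -> R) : measurable_fun setT h ->
  measurable_fun setT (fun x : R => h (x + a)).
Proof.
move=> mh; apply: (measurableT_comp mh); exact: measurable_funD.
Qed.

(** The translated measure agrees with Lebesgue measure on half-open intervals, which determine
    it. *)
Lemma lebesgue_measure_shift (a : R) (A : set R) : measurable A ->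
  pushforward mu (fun x : measurableTypeR R => x + a : measurableTypeR R) A = mu A.
Proof.
move=> mA; apply/esym; have mS : measurable_fun setT (fun x : measurableTypeR R => x + a : measurableTypeR R).
  exact: measurable_funD.
apply: (@lebesgue_measure_unique R (pushforward mu (fun x : measurableTypeR R => x + a : measurableTypeR R))) => // _ [[b c]] _ <-.
rewrite [RHS]/= /pushforward (_ : _ @^-1` _ = `]b - a, c - a]%classic); last first.
  by apply/seteqP; split => x /=; rewrite !in_itv /= ltrBlDr lerBrDr.
rewrite !lebesgue_measure_itv /= !lte_fin ltrD2r.
by case: ifP => // _; rewrite -!EFinB; congr (_%:E); ring.
Qed.

Lemma ge0_integral_shift (a : R) (F : R -> \bar R) : measurable_fun setT F ->
  (forall x, 0 <= F x)%E -> (\int[mu]_x F (x + a)%R = \int[mu]_x F x)%E.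
Proof.
move=> mF F0.
have mS : measurable_fun setT (fun x : measurableTypeR R => x + a : measurableTypeR R).
  exact: measurable_funD.
pose S := fun x : measurableTypeR R => x + a : measurableTypeR R.
transitivity (\int[pushforward mu S]_x F x)%E.
  by rewrite (ge0_integral_pushforward mS) //.
by apply: eq_measure_integral => A mA _; exact: lebesgue_measure_shift.
Qed.

Lemma Rintegral_shift (a : R) h : measurable_fun setT h ->
  \int[mu]_x h (x + a) = \int[mu]_x h x.
Proof.
move=> mh; have mE : measurable_fun setT (EFin \o h) by exact/measurable_EFinP.
congr fine; rewrite integralE [RHS]integralE; congr (_ - _)%E.
  rewrite -(ge0_integral_shift a (measurable_funepos mE)) => [|x]; last exact: funepos_ge0.
  by apply: eq_integral => x _; rewrite !funeposE.
rewrite -(ge0_integral_shift a (measurable_funeneg mE)) => [|x]; last exact: funeneg_ge0.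
by apply: eq_integral => x _; rewrite !funenegE.
Qed.

Lemma rintegrable_shift (a : R) h : rintegrable h -> rintegrable (fun x => h (x + a)).
Proof.
move=> ih; have mh := rintegrable_measurable ih; have /integrableP[_] := ih.
rewrite -(@ge0_integral_shift a) // => [hlt|].
  by apply/integrableP; split => //; apply/measurable_EFinP; exact: measurable_shift.
by apply: measurableT_comp => //; exact/measurable_EFinP.
Qed.

Lemma cmeasurable_shift (a : R) f : cmeasurable f -> cmeasurable (fun x => f (x + a)).
Proof. by move=> [mr mi]; split; [exact: (measurable_shift a mr)|exact: (measurable_shift a mi)]. Qed.

Lemma cintegrable_shift (a : R) f : cintegrable f -> cintegrable (fun x => f (x + a)).
Proof. by move=> [mr mi]; split; [exact: (rintegrable_shift a mr)|exact: (rintegrable_shift a mi)]. Qed.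

Lemma cintegral_shift (a : R) f : cmeasurable f ->
  cintegral (fun x => f (x + a)) = cintegral f.
Proof.
by move=> [mr mi]; apply: complex_ext; [exact: (Rintegral_shift a mr)|exact: (Rintegral_shift a mi)].
Qed.

Lemma L2_shift (a : R) f : L2 f -> L2 (fun x => f (x + a)).
Proof.
move=> /L2P[mf if2]; apply/L2P; split; first exact: cmeasurable_shift.
exact: (rintegrable_shift a if2).
Qed.

Lemma L2_translate k f : L2 f -> L2 (translate k f).
Proof. exact: L2_shift. Qed.

End L2InnerProduct.

(** * Uniqueness of Fourier coefficients *)

Section Cis.
Context {R : realType}.
Local Notation C := R[i].
Implicit Types s t : R.

Lemma cisD s t : cis (s + t) = cis s * cis t.
Proof.
apply: complex_ext; rewrite ?cReM ?cImM /cis /= ?cosD ?sinD //; ring.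
Qed.

Lemma cisN t : cis (- t) = (cis t)^*.
Proof. by apply: complex_ext; rewrite ?cReJ ?cImJ /cis /= ?cosN ?sinN. Qed.

Lemma cmod_cis t : cmod (cis t) = 1.
Proof.
apply: (@pexpIrn _ 2); rewrite ?nnegrE ?cmod_ge0 //.
by rewrite cmod_sqr /cis /= cos2Dsin2 expr1n.
Qed.

Lemma cis0 : cis (0 : R) = 1.
Proof. by rewrite /cis cos0 sin0. Qed.

Lemma cis2pi (n : int) : cis (2 * pi * n%:~R : R) = 1.
Proof.
have pos (m : nat) : cis (2 * pi * m%:R : R) = 1.
  have -> : 2 * pi * m%:R = 0 + (pi *+ 2) *+ m :> R 
    by rewrite add0r -mulrnA -[RHS]mulr_natr natrM mulrA [pi * 2]mulrC.
  rewrite /cis (periodicn (@cosD2pi R)) (periodicn (@sinD2pi R)).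
  exact: cis0.
case: n => m; first exact: pos.
rewrite NegzE rmorphN /= mulrN cisN; have -> := pos m.+1.
by apply: complex_ext; rewrite ?cReJ ?cImJ /= ?oppr0.
Qed.

Lemma cmeasurable_cis (c : R) : cmeasurable (fun x : R => cis (c * x)).
Proof.
split=> /=.
  apply: (@measurableT_comp _ _ _ _ _ _ (@cos R)).
    by apply: continuous_measurable_fun; exact: continuous_cos.
  exact: mulrl_measurable.
apply: (@measurableT_comp _ _ _ _ _ _ (@sin R)).
  by apply: continuous_measurable_fun; exact: continuous_sin.
exact: mulrl_measurable.
Qed.

End Cis.

(** * Polynomials approximating a step at 1/2 *)

Section PeakPolynomial.
Context {R : realType}.

Lemma bernoulli_ge (y : R) N : 0 <= y -> y <= 1 -> 1 - N%:R * y <= (1 - y) ^+ N.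
Proof.
move=> y0 y1; elim: N => [|N ih]; first by rewrite mul0r subr0 expr0.
rewrite exprS -natr1; apply: le_trans (ler_wpM2l _ ih); last lra.
have : 0 <= N%:R :> R by []. nra.
Qed.

(** Bernoulli's inequality for (1 + y)^N, combined with (1 - y)^N (1 + y)^N <= 1. *)
Lemma bernoulli_le (y : R) N : 0 <= y -> y <= 1 -> (1 - y) ^+ N * (N%:R * y) <= 1.
Proof.
move=> y0 y1.
have h : 1 + N%:R * y <= (1 + y) ^+ N.
  elim: N => [|N ih]; first by rewrite mul0r addr0 expr0.
  rewrite exprS -natr1; apply: le_trans (ler_wpM2l _ ih); last lra.
  have : 0 <= N%:R :> R by []. nra.
have p0 : 0 <= (1 - y) ^+ N by rewrite exprn_ge0 //; lra.
apply: (@le_trans _ _ ((1 - y) ^+ N * (1 + y) ^+ N)).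
  by rewrite ler_wpM2l //; lra.
rewrite -exprMn exprn_ile1 //; nra.
Qed.

(** The polynomial of the Brosowski-Deutsch proof of the Stone-Weierstrass theorem. On [0, 1] it is
    at most (2 t)^n, and differs from 1 by at most (2 t)^-n for t > 0, so 1/2 is its threshold. *)
Definition peak (t : R) n := 1 - (1 - t ^+ n) ^+ (2 ^ n).

Lemma peak_itv (t : R) n : 0 <= t <= 1 -> 0 <= peak t n <= 1.
Proof.
move=> /andP[t0 t1]; rewrite /peak.
have h1 : 0 <= t ^+ n <= 1 by rewrite exprn_ge0 // exprn_ile1.
have h2 : 0 <= (1 - t ^+ n) ^+ (2 ^ n) <= 1.
  by rewrite exprn_ge0 ?exprn_ile1 //; lra.
by apply/andP; split; lra.
Qed.

Lemma peak_cvg0 (t : R) : 0 <= t -> t < 1 / 2 -> peak t n @[n --> \oo] --> (0 : R).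
Proof.
move=> t0 t1.
have h : (2 * t) ^+ n @[n --> \oo] --> (0 : R).
  by apply: cvg_expr; rewrite ger0_norm ?mulr_ge0 //; lra.
apply: (squeeze_cvgr _ (cvg_cst (0 : R)) h); apply: nearW => n.
have tn : 0 <= t ^+ n <= 1 by rewrite exprn_ge0 // exprn_ile1 //; lra.
have t01 : 0 <= t <= 1 by apply/andP; split; lra.
have /andP[-> _] /= := peak_itv n t01.
have /andP[h1 h2] := tn.
have := bernoulli_ge (2 ^ n)%N h1 h2.
by rewrite /peak exprMn natrX; lra.
Qed.

Lemma peak_cvg1 (t : R) : 1 / 2 < t -> t <= 1 -> peak t n @[n --> \oo] --> (1 : R).
Proof.
move=> t0 t1.
have h : 1 - (2 * t)^-1 ^+ n @[n --> \oo] --> (1 - 0 : R).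
  apply: cvgB; first exact: cvg_cst.
  apply: cvg_expr; rewrite ger0_norm ?invr_ge0 ?mulr_ge0 //; last lra.
  by rewrite invf_lt1; lra.
rewrite subr0 in h.
apply: (squeeze_cvgr _ h (cvg_cst (1 : R))); apply: nearW => n.
have tn : 0 <= t ^+ n <= 1 by rewrite exprn_ge0 ?exprn_ile1 //; lra.
have t01 : 0 <= t <= 1 by apply/andP; split; lra.
have /andP[_ ->] := peak_itv n t01; rewrite andbT.
have /andP[h1 h2] := tn.
have := bernoulli_le (2 ^ n)%N h1 h2.
rewrite natrX -exprMn => h3.
have p : 0 < (2 * t) ^+ n by rewrite exprn_gt0 //; lra.
by rewrite /peak lerD2l lerN2 exprVn -[leRHS]mul1r ler_pdivlMr.
Qed.

End PeakPolynomial.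

(** * Multipliers preserving the vanishing of Fourier coefficients *)

Section FourierUniqueness.
Context {R : realType}.
Local Notation mu := (@lebesgue_measure R).
Local Notation C := R[i].
Context (p : R) (p0 : 0 < p).
Implicit Types (g m : R -> C).

Definition expi (n : int) (x : R) : C := cis (2 * pi * n%:~R / p * x).

Lemma expiD n k x : expi (n + k) x = expi n x * expi k x.
Proof. by rewrite /expi -cisD; congr cis; rewrite rmorphD /=; ring. Qed.

Lemma expi0 x : expi 0 x = 1.
Proof. by rewrite /expi mulr0 !mul0r cis0. Qed.

Lemma expiN n x : expi (- n) x = (expi n x)^*.
Proof. by rewrite /expi -cisN; congr cis; rewrite rmorphN /=; ring. Qed.

Lemma cmod_expi n x : cmod (expi n x) = 1.
Proof. exact: cmod_cis. Qed.

Lemma cmeasurable_expi n : cmeasurable (expi n).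
Proof. exact: cmeasurable_cis. Qed.

Definition coef0 g := cintegrable g /\
  forall n, cintegral (fun x => expi n x * g x) = 0.

(** These multipliers form an algebra containing the exponentials; a polynomial in a trigonometric
    polynomial is thus admissible without being expanded. *)
Definition coef0_stable m := cmeasurable m /\ (exists B, forall x, cmod (m x) <= B) /\
  forall g, coef0 g -> coef0 (fun x => m x * g x).

Lemma stable_cst (c : C) : coef0_stable (fun=> c).
Proof.
split; first exact: cmeasurable_cst; split; first by exists (cmod c).
move=> g [ig g0]; split=> [|n]; first exact: cintegrableZ.
under eq_fun do rewrite mulrCA.
rewrite cintegralZ ?g0 ?mulr0 //.
by apply: (@cintegrableMl _ 1) => //; [exact: cmeasurable_expi|move=> x; rewrite cmod_expi].
Qed.

Lemma stable_expi k : coef0_stable (expi k).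
Proof.
split; first exact: cmeasurable_expi; split; first by exists 1 => x; rewrite cmod_expi.
move=> g [ig g0]; split=> [|n].
  by apply: (@cintegrableMl _ 1) => //; [exact: cmeasurable_expi|move=> x; rewrite cmod_expi].
by under eq_fun do rewrite mulrA -expiD; exact: g0.
Qed.

Lemma stableM m m' : coef0_stable m -> coef0_stable m' ->
  coef0_stable (fun x => m x * m' x).
Proof.
move=> [mm [[B hB] sm]] [mm' [[B' hB'] sm']]; split; first exact: cmeasurableM.
split; first by exists (B * B') => x; rewrite cmodM ler_pM // cmod_ge0.
by move=> g /sm' /sm; under [X in _ -> coef0 X]eq_fun do rewrite -mulrA.
Qed.

Lemma stableD m m' : coef0_stable m -> coef0_stable m' ->
  coef0_stable (fun x => m x + m' x).
Proof.
move=> [mm [[B hB] sm]] [mm' [[B' hB'] sm']]; split; first exact: cmeasurableD.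
split; first by exists (B + B') => x; rewrite (le_trans (cmodD _ _)) // lerD.
move=> g cg; have [i1 z1] := sm g cg; have [i2 z2] := sm' g cg.
split=> [|n]; first by under eq_fun do rewrite mulrDl; exact: cintegrableD.
have bE k : forall x, cmod (expi k x) <= 1 by move=> x; rewrite cmod_expi.
under eq_fun do rewrite mulrDl mulrDr.
by rewrite cintegralD ?z1 ?z2 ?addr0 //; apply: (cintegrableMl _ (bE n)) => //;
  exact: cmeasurable_expi.
Qed.

Lemma stableX m N : coef0_stable m -> coef0_stable (fun x => m x ^+ N).
Proof.
move=> sm; elim: N => [|N ih]; first by under eq_fun do rewrite expr0; exact: stable_cst.
by under eq_fun do rewrite exprS; exact: stableM.
Qed.

Context (a : R).

(* A trigonometric polynomial of period [p] although each sine has period [2 p];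
   on [a, a + p] it is positive exactly between [a] and [d]. *)
Definition bump d (x : R) := sin (pi / p * (x - a)) * sin (pi / p * (d - x)).

Definition bump_arg d := - (pi / p * (a + d)).

(** Product-to-sum formula: the two arguments have a constant sum, and their difference advances by
    2 pi over a period, so only the frequencies 1, -1 and 0 occur. *)
Lemma bumpE d x : (bump d x)%:C =
  ((2^-1)%:C * ((2^-1)%:C * (cis (bump_arg d) * expi 1 x) +
     (2^-1)%:C * ((cis (bump_arg d))^* * expi (-1) x)
     + (- cos (pi / p * (d - a)))%:C)).
Proof.
rewrite expiN -cisN /expi -cisN -!cisD.
set s := pi / p * (x - a); set t := pi / p * (d - x).
have -> : bump_arg d + 2 * pi * 1%:~R / p * x = s - t.
  by rewrite /bump_arg /s /t; field; rewrite gt_eqF.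
have -> : - bump_arg d - 2 * pi * 1%:~R / p * x = - (s - t).
  by rewrite /bump_arg /s /t; field; rewrite gt_eqF.
have -> : pi / p * (d - a) = s + t by rewrite /s /t; ring.
apply: complex_ext.
  by rewrite /bump -/s -/t /cis /= cosN sinN cosB cosD; field.
by rewrite /cis /= cosN sinN; ring.
Qed.

(** The map t |-> (1 + t) / 2 turns the sign of [bump] into a position relative to 1/2, the
    threshold of [peak]. *)
Lemma stable_peak d (n : nat) : coef0_stable (fun x => (peak (2^-1 * (1 + bump d x)) n)%:C).
Proof.
have sb : coef0_stable (fun x => (bump d x)%:C).
  under eq_fun do rewrite bumpE.
  apply: stableM; first exact: stable_cst.
  apply: stableD; last exact: stable_cst.
  by apply: stableD; (apply: stableM; first exact: stable_cst);
    (apply: stableM; first exact: stable_cst); exact: stable_expi.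
have st : coef0_stable (fun x => (2^-1 * (1 + bump d x))%:C).
  under eq_fun do rewrite rmorphM rmorphD /=.
  by apply: stableM; [exact: stable_cst|apply: stableD => //; exact: stable_cst].
have sN m : coef0_stable m -> coef0_stable (fun x => 1 - m x).
  move=> sm; under eq_fun do rewrite -mulN1r.
  by apply: stableD; [exact: stable_cst|apply: stableM => //; exact: stable_cst].
have -> : (fun x => (peak (2^-1 * (1 + bump d x)) n)%:C)
   = (fun x => 1 - (1 - ((2^-1 * (1 + bump d x))%:C) ^+ n) ^+ (2 ^ n)).
  by apply/funext => x; rewrite /peak rmorphB rmorphXn rmorphB rmorphXn rmorph1.
exact: (sN _ (stableX (2 ^ n) (sN _ (stableX n st)))).
Qed.

Lemma bump_itv d x : 0 <= 2^-1 * (1 + bump d x) <= 1.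
Proof.
have h (s t : R) : `|sin s * sin t| <= 1.
  have hs (u : R) : `|sin u| <= 1 by rewrite ler_norml sin_geN1 sin_le1.
  by rewrite normrM -[leRHS]mulr1 ler_pM.
have := h (pi / p * (x - a)) (pi / p * (d - x)); rewrite -/(bump d x) ler_norml.
by move=> /andP[h1 h2]; apply/andP; split; lra.
Qed.

Lemma bump_gt0 d x : d <= a + p -> a < x < d -> 0 < bump d x.
Proof.
move=> da /andP[ax xd]; have q0 : 0 < pi / p :> R by rewrite divr_gt0 // pi_gt0.
have pE : pi / p * p = pi :> R by rewrite divfK // gt_eqF.
apply: mulr_gt0; apply: sin_gt0_pi; rewrite mulr_gt0 ?subr_gt0 //= -[ltRHS]pE ltr_pM2l //; lra.
Qed.

Lemma bump_lt0 d x : a <= d -> d < x -> x < a + p -> bump d x < 0.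
Proof.
move=> ad dx xp; have q0 : 0 < pi / p :> R by rewrite divr_gt0 // pi_gt0.
have pE : pi / p * p = pi :> R by rewrite divfK // gt_eqF.
have h1 : 0 < sin (pi / p * (x - a)).
  apply: sin_gt0_pi; rewrite mulr_gt0 ?subr_gt0 ?(le_lt_trans ad) //= -[ltRHS]pE ltr_pM2l //; lra.
have h2 : 0 < sin (pi / p * (x - d)).
  apply: sin_gt0_pi; rewrite mulr_gt0 ?subr_gt0 //= -[ltRHS]pE ltr_pM2l //; lra.
by rewrite /bump -(opprB x d) mulrN sinN pmulr_rlt0 // oppr_lt0.
Qed.

Definition cind (A : set R) (x : R) : C := (\1_A x)%:C.

Lemma cind_in (A : set R) x : A x -> cind A x = 1.
Proof. by move=> Ax; rewrite /cind indicE mem_set. Qed.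

Lemma cind_out (A : set R) x : ~ A x -> cind A x = 0.
Proof. by move=> Ax; rewrite /cind indicE memNset. Qed.

Lemma cmod_cind (A : set R) x : cmod (cind A x) <= 1.
Proof.
have [Ax|Ax] := pselect (A x); first by rewrite cind_in // cmod1.
by rewrite cind_out // cmod0.
Qed.

Lemma cmeasurable_cind (A : set R) : measurable A -> cmeasurable (cind A).
Proof. by move=> mA; apply: cmeasurable_real; exact: measurable_indic. Qed.

Let D : set R := `[a, a + p[%classic.

Lemma ae_neq (c : R) : {ae mu, forall x, x != c}.
Proof.
exists [set c]; split => //; first exact: lebesgue_measure_set1.
by move=> x /=; case: eqP.
Qed.

(** On the period, away from [a] and [d], the multipliers of [stable_peak] converge to the indicator
    of ]-oo, d]; elsewhere [g] vanishes. Each product has zero coefficient at frequency 0, and |g|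
    dominates them. *)
Lemma primitive_eq0 g d : coef0 g -> (forall x, ~ D x -> g x = 0) ->
  a < d < a + p -> cintegral (fun x => cind `]-oo, d] x * g x) = 0.
Proof.
move=> cg gD /andP[ad dp]; have [ig _] := cg; have mg := cintegrable_measurable ig.
pose u n x := (peak (2^-1 * (1 + bump d x)) n)%:C * g x.
have su n : coef0 (u n) by have [_ [_ h]] := stable_peak d n; exact: h.
have u0 n : cintegral (u n) = 0.
  have [_ /(_ 0)] := su n; by under eq_fun do rewrite expi0 mul1r.
have mf : cmeasurable (fun x => cind `]-oo, d] x * g x).
  by apply: cmeasurableM => //; apply: cmeasurable_cind.
have [] := @dominated_cintegral R u _ _ (fun n => cintegrable_measurable (su n).1)
    mf (cintegrable_cmod ig).
- apply: aeS2 (ae_neq a) (ae_neq d) => x xa xd.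
  have [Dx|/gD gx] := pselect (D x); last first.
    rewrite /ccvg /u gx !mulr0; under eq_fun do rewrite mulr0 subr0 cmod0.
    exact: cvg_cst.
  move: Dx; rewrite /D /= in_itv /= => /andP[ax xp].
  have ax' : a < x by rewrite lt_neqAle eq_sym xa.
  suff h : peak (2^-1 * (1 + bump d x)) n @[n --> \oo] --> (\1_`]-oo, d] x : R).
    rewrite /ccvg /u; under eq_fun do rewrite -mulrBl cmodM -rmorphB cmod_real.
    rewrite -(mul0r (cmod (g x))); apply: cvgMl.
    rewrite -(normr0 R) -[in X in _ --> X](subrr (\1_`]-oo, d] x)).
    by apply: cvg_norm; apply: cvgB => //; exact: cvg_cst.
  have /andP[b0 b1] := bump_itv d x.
  have [xd'|dx] := ltP x d.
    rewrite indicE mem_set /= ?in_itv /= ?ltW //; apply: peak_cvg1 => //.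
    by have := @bump_gt0 d x (ltW dp) ltac:(by rewrite ax' xd'); lra.
  have dx' : d < x by rewrite lt_neqAle eq_sym xd.
  rewrite indicE memNset /= ?in_itv /= ?leNgt ?dx' //; apply: peak_cvg0 => //.
  by have := @bump_lt0 d x (ltW ad) dx' xp; lra.
- apply: aeW => x n; rewrite /u cmodM cmod_real.
  have /andP[h1 h2] := peak_itv n (bump_itv d x).
  by rewrite ger0_norm // ler_piMl // cmod_ge0.
move=> _ h; apply: (ccvg_unique h); rewrite /ccvg.
under eq_fun do rewrite u0 subrr cmod0; exact: cvg_cst.
Qed.

(** Lebesgue differentiation: at almost every [x] the primitive has derivative [h x], and it
    vanishes on the open period. *)
Lemma ae_eq0_primitive (h : R -> R) : rintegrable h -> (forall x, ~ D x -> h x = 0) ->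
  (forall d, a < d < a + p -> \int[mu]_(x in `]-oo, d]) h x = 0) ->
  {ae mu, forall x, h x = 0}.
Proof.
move=> ih hD hint.
have mh := rintegrable_measurable ih.
have loc : locally_integrable setT h by exact: (open_integrable_locally openT ih).
have iy y : mu.-integrable `]-oo, y] (EFin \o h) by exact: integrableS ih.
have := FTC1Ny iy loc; set F := (fun x => \int[mu]_(t in _) _) => hF.
apply: aeS2 (ae_neq a) hF => x xa [_ Fx].
have [Dx|/hD//] := pselect (D x).
move: Dx; rewrite /D /= in_itv /= => /andP[ax xp].
have ax' : a < x by rewrite lt_neqAle eq_sym xa.
rewrite -Fx derive1E (@near_eq_derive _ _ _ F (cst 0)) ?derive_cst //.
have : x \in `]a, a + p[ by rewrite in_itv /= ax' xp.
move=> /near_in_itvoo; apply: filterS => y; rewrite in_itv /= => hy.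
exact: hint.
Qed.

Lemma fourier_unique g : coef0 g -> (forall x, ~ D x -> g x = 0) ->
  {ae mu, forall x, g x = 0}.
Proof.
move=> cg gD; have [[ir ii] _] := cg.
have indE h d : rintegrable h ->
    \int[mu]_(x in `]-oo, d]) h x = \int[mu]_x (\1_`]-oo, d] x * h x).
  move=> ih; rewrite Rintegral_mkcond; apply: eq_Rintegral => x _.
  rewrite /restrict indicE; case: (x \in _); by rewrite ?mul1r ?mul0r.
apply: aeS2 _ (ae_eq0_primitive ir _ _) (ae_eq0_primitive ii _ _).
- by move=> x hr hi; apply: complex_ext; rewrite ?hr ?hi.
- by move=> x /gD ->.
- move=> d hd; rewrite indE //; have := primitive_eq0 cg gD hd.
  move=> /(congr1 (@complex.Re R)) /= <-; apply: eq_Rintegral => x _.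
  by rewrite /cind cReZ.
- by move=> x /gD ->.
- move=> d hd; rewrite indE //; have := primitive_eq0 cg gD hd.
  move=> /(congr1 (@complex.Im R)) /= <-; apply: eq_Rintegral => x _.
  by rewrite /cind cImZ.
Qed.

End FourierUniqueness.

(** * Parseval's identity on a period *)

Section SumsOverFsets.
Context {R : realType} {I : choiceType}.
Local Open Scope ereal_scope.

Lemma le_esum_fset (a : I -> \bar R) (J : {fset I}) : (forall k, 0 <= a k) ->
  \sum_(k <- J) a k <= \esum_(k in [set: I]) a k.
Proof.
move=> a0; apply: esum_ge; exists [set` J]; first by split => //; exact: finite_fset.
by rewrite fsbig_finite ?set_fsetK //; exact: finite_fset.
Qed.

Lemma esum_le_fset (a : I -> \bar R) (B : \bar R) :
  (forall J : {fset I}, \sum_(k <- J) a k <= B) -> \esum_(k in [set: I]) a k <= B.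
Proof.
move=> aB; apply: ge_ereal_sup => _ [X [fX _] <-].
by rewrite fsbig_finite.
Qed.

Lemma csum_esum (r : I -> R) (s : R) : (forall k, (0 <= r k)%R) ->
  csum (fun k => (r k)%:C%C) s%:C%C -> \esum_(k in [set: I]) (r k)%:E = s%:E.
Proof.
move=> r0 hs; apply/eqP; rewrite eq_le; apply/andP; split.
  apply: esum_le_fset => J; rewrite sumEFin lee_fin; apply/ler_addgt0Pr => e e0.
  have [K hK] := hs e e0; have := hK _ (fsubsetUl K J).
  rewrite -rmorph_sum -rmorphB cmod_real ler_norml => /andP[_].
  rewrite (fset_sumD r (fsubsetUr K J)).
  have : (0 <= \sum_(k <- ((K `|` J) `\` J)%fset) r k)%R by apply: sumr_ge0.
  lra.
apply/lee_addgt0Pr => e e0; have [K hK] := hs e e0.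
have := hK K (fsubset_refl K); rewrite -rmorph_sum -rmorphB cmod_real ler_norml => /andP[h _].
apply: (@le_trans _ _ ((\sum_(k <- K) r k)%R%:E + e%:E)).
  by rewrite -EFinD lee_fin; lra.
by rewrite leeD2r // -sumEFin; apply: le_esum_fset => k; rewrite lee_fin.
Qed.

Lemma csum_delta (c : I -> R[i]) m : csum (fun k => c k * (k == m)%:R)%R (c m).
Proof.
move=> e e0; exists [fset m]%fset => K /fsubsetP mK.
rewrite (big_fsetD1 m) ?mK ?inE //= eqxx mulr1 big_seq big1 ?addr0 ?subrr ?cmod0 ?ltW //.
by move=> k; rewrite !inE => /andP[/negbTE -> _]; rewrite mulr0.
Qed.

End SumsOverFsets.

Lemma orthonormal_synthesis (R : realType) (H : lmodType R[i]) (ip : H -> H -> R[i])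
  (hip : inner_product ip) (I : choiceType) (E : I -> H) :
  (forall k l, ip (E k) (E l) = (k == l)%:R) -> bounded_synthesis ip 1 E.
Proof.
move=> oE c J; rewrite mul1r (hnorm_sqr hip) (ip_suml hip) Re_sum big_seq.
rewrite [leRHS]big_seq; apply: ler_sum => k kJ.
rewrite (ip_sumr hip) (big_fsetD1 k) //= big_seq big1 => [|l]; last first.
  rewrite !inE => /andP[/negbTE lk _].
  by rewrite (ipZl hip) (ipZr hip) oE eq_sym lk !mulr0.
by rewrite addr0 (ipZl hip) (ipZr hip) oE eqxx mulr1 mulcJ.
Qed.

Section Parseval.
Context {R : realType}.
Local Notation mu := (@lebesgue_measure R).
Local Notation C := R[i].
Context (p : R) (p0 : 0 < p) (a : R).
Local Notation expi := (expi p).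
Let D : set R := `[a, a + p[%classic.

Lemma Rintegral_derive (F f : R -> R) (b c : R) : b < c ->
  (forall x : R, is_derive x 1 F (f x)) -> continuous f ->
  \int[mu]_(x in `[b, c]) f x = F c - F b.
Proof.
move=> bc dF cf; rewrite /Rintegral.
have cF : continuous F.
  by move=> x; apply: differentiable_continuous; apply/derivable1_diffP; case: (dF x).
rewrite (@continuous_FTC2 R f F) //.
- exact: continuous_subspaceT.
- split.
  + by move=> x _; case: (dF x).
  + by apply: cvg_at_right_filter; exact: cF.
  + by apply: cvg_at_left_filter; exact: cF.
- by move=> x _; rewrite derive1E; case: (dF x).
Qed.

Lemma Rintegral_trig (c : R) : c != 0 -> cis (c * p) = 1 ->
  \int[mu]_(x in `[a, a + p]) cos (c * x) = 0 /\
  \int[mu]_(x in `[a, a + p]) sin (c * x) = 0.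
Proof.
move=> c0 cp; have ap : a < a + p by rewrite ltrDl.
have [hc hs] : cos (c * (a + p)) = cos (c * a) /\ sin (c * (a + p)) = sin (c * a).
  have := cisD (c * a) (c * p); rewrite cp mulr1 -mulrDr => h.
  by split; [have := congr1 (@complex.Re R) h|have := congr1 (@complex.Im R) h].
have cM : continuous (fun x : R => c * x) by exact: mulrl_continuous.
have dM (x : R) : is_derive x 1 (fun x : R => c * x) c.
  by have := @is_deriveZ R R R id c x 1 1 (is_derive_id _ _); rewrite -[c *: 1]/(c * 1) mulr1.
have dS (x : R) : is_derive x 1 (fun x => c^-1 * sin (c * x)) (cos (c * x)).
  have h := @is_derive1_comp R sin (fun x => c * x) x _ _ (is_derive_sin _) (dM x).
  have := @is_deriveZ R R R (sin \o (fun x => c * x)) c^-1 x 1 _ h.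
  by congr is_derive; rewrite -[LHS]/(_ * _); field.
have dC (x : R) : is_derive x 1 (fun x => - c^-1 * cos (c * x)) (sin (c * x)).
  have h := @is_derive1_comp R cos (fun x => c * x) x _ _ (is_derive_cos _) (dM x).
  have := @is_deriveZ R R R (cos \o (fun x => c * x)) (- c^-1) x 1 _ h.
  by congr is_derive; rewrite -[LHS]/(_ * _); field.
split.
  rewrite (Rintegral_derive ap dS) ?hs ?subrr //.
  by move=> x; apply: continuous_comp; [exact: cM|exact: continuous_cos].
rewrite (Rintegral_derive ap dC) ?hc ?subrr //.
by move=> x; apply: continuous_comp; [exact: cM|exact: continuous_sin].
Qed.

Lemma cintegrable_cind (b c : R) (f : R -> C) B : cmeasurable f ->
  (forall x, cmod (f x) <= B) -> cintegrable (fun x => cind `[b, c[ x * f x).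
Proof.
move=> mf fB.
have i1 : rintegrable (\1_`[b, c[ : R -> R) by apply: integrable_indic_itv.
apply: (cintegrable_le _ (rintegrableZ B i1)).
  by apply: cmeasurableM => //; exact: cmeasurable_cind.
move=> x; rewrite cmodM /cind cmod_real ger0_norm // mulrC ler_wpM2r //.
Qed.

Lemma cintegral_expi k : cintegral (fun x => cind D x * expi k x) = (p * (k == 0)%:R)%:C.
Proof.
have mD : measurable D by exact: measurable_itv.
have [->|k0] := eqVneq k 0.
  under eq_fun do rewrite expi0 mulr1.
  have mC : \int[mu]_x \1_D x = p.
    have muD : mu D = p%:E by rewrite /D lebesgue_measure_itv /= lte_fin ltrDl p0 -EFinB addrC addKr.
    rewrite /Rintegral integral_indic // setIT. by rewrite [X in fine X]muD.
  apply: complex_ext; rewrite /= ?mulr1 //.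
  by rewrite /Rintegral integral0.
rewrite mulr0; set c := 2 * pi * k%:~R / p.
have c0 : c != 0.
  by rewrite !mulf_neq0 ?invr_neq0 ?intr_eq0 // ?gt_eqF ?pi_gt0.
have cp : cis (c * p) = 1 by rewrite /c divfK ?gt_eqF // cis2pi.
have [hc hs] := Rintegral_trig c0 cp.
(* The half-open and the closed period differ by the null set {a + p}. *)
have itvE (h : R -> R) : measurable_fun setT h ->
    \int[mu]_x (\1_D x * h x) = \int[mu]_(x in `[a, a + p]) h x.
  move=> mh; have -> : \int[mu]_(x in `[a, a + p]) h x = \int[mu]_x (\1_(`[a, a + p]) x * h x).
    rewrite Rintegral_mkcond; apply: eq_Rintegral => x _.
    by rewrite /restrict indicE; case: (x \in _); rewrite ?mul1r ?mul0r.
  apply: ae_eq_Rintegral.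
  - by apply: measurable_funM => //; exact: measurable_indic.
  - by apply: measurable_funM => //; exact: measurable_indic.
  - apply: aeS (ae_neq (a + p)) => x xap; congr (_ * _); rewrite !indicE.
    congr ((nat_of_bool _)%:R).
    by apply/idP/idP => /set_mem hx; apply/mem_set; move: hx; rewrite /D /= !in_itv /= => /andP[-> h1];
      [exact: ltW|rewrite lt_neqAle xap].
have [mc ms] := cmeasurable_expi p k.
apply: complex_ext.
  rewrite -[LHS]/(\int[mu]_x Re (cind D x * expi k x)).
  by under eq_Rintegral do rewrite /cind cReZ; rewrite itvE.
rewrite -[LHS]/(\int[mu]_x Im (cind D x * expi k x)).
by under eq_Rintegral do rewrite /cind cImZ; rewrite itvE.
Qed.

Lemma cintegrable_L2_itv (f : R -> C) : L2 f -> cintegrable (fun x => cind D x * f x).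
Proof.
move=> f2; apply: L2M_cintegrable => //; apply/L2P.
have mD : measurable D by exact: measurable_itv.
split; first exact: cmeasurable_cind.
have : rintegrable (\1_D : R -> R) by apply: integrable_indic_itv.
congr rintegrable; apply/funext => x; rewrite /cind cmod_real ger0_norm //.
by rewrite indicE; case: (x \in _); rewrite ?expr0n ?expr1n.
Qed.

Lemma conj_cind (A : set R) x : (cind A x)^* = cind A x.
Proof. by rewrite /cind; apply: complex_ext; rewrite ?cReJ ?cImJ /= ?oppr0. Qed.

(** Conjugated so that the inner product with this element integrates against [expi k] itself, as
    [pcoef] does. *)
Definition period_exp k (x : R) : C := (Num.sqrt p)^-1%:C * (cind D x * (expi k x)^*).

Lemma L2_period_exp k : L2 (period_exp k).
Proof.
have mD : measurable D by exact: measurable_itv.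
apply: L2Z; apply/L2P; split.
  apply: cmeasurableM; first exact: cmeasurable_cind.
  by apply: cmeasurableJ; exact: cmeasurable_expi.
have : rintegrable (\1_D : R -> R) by apply: integrable_indic_itv.
congr rintegrable; apply/funext => x.
rewrite cmodM cmod_conj cmod_expi mulr1 /cind cmod_real ger0_norm //.
by rewrite indicE; case: (x \in _); rewrite ?expr0n ?expr1n.
Qed.

Definition period_basis k : L2fun R := toL2 (L2_period_exp k).

Definition pcoef (U : R -> C) k : C := (Num.sqrt p)^-1%:C * cintegral (fun x => expi k x * U x).

Lemma pcoefE (f : L2fun R) k :
  ipL2 f (period_basis k) = pcoef (fun x => cind D x * val f x) k.
Proof.
have i1 := cintegrable_L2_itv (L2funP f).
have i2 : cintegrable (fun x => expi k x * (cind D x * val f x)).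
  by apply: (@cintegrableMl _ 1) => //; [exact: cmeasurable_expi|move=> x; rewrite cmod_expi].
rewrite /pcoef -cintegralZ //; congr cintegral; apply/funext => x /=.
rewrite /period_exp conjZ rmorphM /= conjCK.
rewrite conj_cind; ring.
Qed.

Lemma period_basis_orthonormal k l : ipL2 (period_basis k) (period_basis l) = (k == l)%:R.
Proof.
rewrite pcoefE /pcoef /=.
have cc x : cind D x * cind D x = cind D x.
  have [Dx|Dx] := pselect (D x); first by rewrite cind_in // mulr1.
  by rewrite cind_out // mulr0.
have -> : (fun x => expi l x * (cind D x * period_exp k x))
    = (fun x => (Num.sqrt p)^-1%:C * (cind D x * expi (l - k) x)).
  apply/funext => x; rewrite /period_exp expiD expiN -[in RHS](cc x); ring.
have s0 : 0 < Num.sqrt p by rewrite sqrtr_gt0.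
have bE : forall x, cmod (expi (l - k) x) <= 1 by move=> x; rewrite cmod_expi.
rewrite cintegralZ; last exact: cintegrable_cind (cmeasurable_expi _ _) bE.
rewrite cintegral_expi mulrA -!rmorphM subr_eq0 eq_sym.
have -> : (Num.sqrt p)^-1 * (Num.sqrt p)^-1 = p^-1.
  by rewrite -invfM -expr2 sqr_sqrtr // ltW.
have pn0 : p != 0 by rewrite gt_eqF.
by rewrite mulKf //; case: (k == l); rewrite ?rmorph1 ?rmorph0.
Qed.

Definition supported (f : R -> C) := forall x, ~ D x -> f x = 0.

Lemma supportedE (f : R -> C) : supported f -> (fun x => cind D x * f x) = f.
Proof.
move=> sf; apply/funext => x; have [Dx|Dx] := pselect (D x).
  by rewrite cind_in // mul1r.
by rewrite sf // mulr0.
Qed.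

(* An integrable function with square-summable Fourier coefficients agrees a.e.
   with the sum of its Fourier series, by uniqueness of the coefficients. *)
Lemma parseval_L1 (U : R -> C) : cintegrable U -> supported U -> sq_summable (pcoef U) ->
  L2 U /\ forall V : L2fun R,
    csum (fun k => pcoef U k * ipL2 (period_basis k) V) (inner U (val V)).
Proof.
move=> iU sU sc.
have mD : measurable D by exact: measurable_itv.
have hip := @ipL2_inner_product R.
have sE := orthonormal_synthesis hip period_basis_orthonormal.
have [g hg] := hsum_exists hip ltr01 (@ipL2_complete R) sE sc.
have gV V := hsum_ip hip V hg.
have gE k : ipL2 g (period_basis k) = pcoef U k.
  apply: (csum_unique (gV (period_basis k))); have := @csum_delta R int (pcoef U) k.
  congr csum; apply/funext => l.
  by rewrite (ipZl hip) period_basis_orthonormal.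
(* [fourier_unique] needs support in one period, which the limit [g], determined only up to null
   sets, need not have. *)
pose g' x := cind D x * val g x.
have ig' : cintegrable g' by exact: cintegrable_L2_itv (L2funP g).
have sg' : supported g' by move=> x Dx; rewrite /g' cind_out // mul0r.
have s0 : (Num.sqrt p)^-1%:C != 0 :> C.
  by rewrite (inj_eq (@complexI R)) invr_eq0 gt_eqF // sqrtr_gt0.
have c0 : coef0 p (fun x => U x - g' x).
  split=> [|k]; first exact: cintegrableB.
  have bE : forall x, cmod (expi k x) <= 1 by move=> x; rewrite cmod_expi.
  under eq_fun do rewrite mulrBr.
  rewrite cintegralB; try exact: cintegrableMl (cmeasurable_expi _ _) bE _.
  apply/eqP; rewrite -(inj_eq (mulfI s0)) mulr0 mulrBr -![_ * cintegral _]/(pcoef _ _).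
  by rewrite -gE pcoefE subrr.
have Ug : {ae mu, forall x, g' x = U x}.
  have := fourier_unique p0 c0 (a := a).
  case=> [x Dx|N hN]; first by rewrite sU // sg' // subrr.
  by exists N; move: hN => [mN N0 sN]; split => // x /= nx; apply: sN => /= /eqP;
    rewrite subr_eq0 => /eqP h; apply: nx.
have mU := cintegrable_measurable iU.
have g'2 : L2 g'.
  apply: (@L2Ml _ 1) (L2funP g); first exact: cmeasurable_cind.
  by move=> x; exact: cmod_cind.
have U2 : L2 U by exact: ae_eq_L2 Ug g'2.
(* Cutting off [V] instead of [g] moves the indicator across the inner product. *)
split=> // V; pose V' := toL2 (L2Ml (cmeasurable_cind mD) (@cmod_cind _ D) (L2funP V)).
have -> : inner U (val V) = ipL2 g V'.
  rewrite /inner; apply: ae_eq_cintegral.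
  - exact/cintegrable_measurable/inner_cintegrable/L2funP.
  - exact: cintegrable_measurable (inner_cintegrable (L2funP g) (L2funP V')).
  - apply: aeS Ug => x <-; rewrite /= rmorphM /= /g'.
    by rewrite conj_cind mulrA [_ * cind D x]mulrC.
have := gV V'; congr csum; apply/funext => k.
rewrite (ipZl hip); congr (_ * _).
rewrite /ipL2 /inner; congr cintegral; apply/funext => x /=.
rewrite rmorphM /= /period_exp.
rewrite conj_cind.
have [Dx|Dx] := pselect (D x); first by rewrite cind_in // !mul1r.
by rewrite cind_out // !(mul0r, mulr0).
Qed.

Lemma bessel_period (f : L2fun R) : supported (val f) -> sq_summable (pcoef (val f)).
Proof.
move=> sf; have hip := @ipL2_inner_product R.
have sE := orthonormal_synthesis hip period_basis_orthonormal.
have bE := bounded_synthesis_bessel hip ltr01 sE.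
exists (hnorm (@ipL2 R) f ^+ 2) => J; have := bE f J I.
rewrite mul1r; congr (_ <= _); apply: eq_bigr => k _.
by rewrite pcoefE supportedE.
Qed.

Lemma parseval_L2 (f : L2fun R) : supported (val f) ->
  (\esum_(k in [set: int]) ((cmod (pcoef (val f) k)) ^+ 2)%:E = (sqint (val f))%:E)%E.
Proof.
move=> sf; have hip := @ipL2_inner_product R.
have i1 : cintegrable (val f) by rewrite -(supportedE sf); exact: cintegrable_L2_itv (L2funP f).
have [_ /(_ f)] := parseval_L1 i1 sf (bessel_period sf).
rewrite inner_self => h; apply: csum_esum => [k|]; first exact: sqr_ge0.
move: h; congr csum; apply/funext => k.
by rewrite (ipJ hip f) pcoefE supportedE // mulcJ.
Qed.

End Parseval.

(** * Sums over the integers and periodization *)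

Section IntEnum.

(** The order 0, -1, 1, -2, 2, ... reduces sums over the integers to series, where monotone and
    dominated convergence apply. *)
Definition int_enum (m : nat) : int := if odd m then Negz m./2 else Posz m./2.
Definition int_rank (n : int) : nat := match n with Posz k => k.*2 | Negz k => k.*2.+1 end.

Lemma int_enumK : cancel int_enum int_rank.
Proof.
move=> m; rewrite /int_enum; have := odd_double_half m.
by case: (odd m) => /=; rewrite ?add0n ?add1n.
Qed.

Lemma int_rankK : cancel int_rank int_enum.
Proof.
case=> k; rewrite /int_enum /= ?odd_double /= ?doubleK //.
by rewrite uphalf_double.
Qed.

Lemma esum_int {R : realType} (a : int -> \bar R) : (forall n, 0 <= a n)%E ->
  (\esum_(n in [set: int]) a n = \sum_(m <oo) a (int_enum m))%E.
Proof.
move=> a0; rewrite nneseries_esumT // (@reindex_esum _ _ _ setT setT int_enum) //.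
split=> //; first by move=> m m' _ _ /(can_inj int_enumK).
by move=> n _; exists (int_rank n) => //; exact: int_rankK.
Qed.

Lemma csum_int {R : realType} (u : int -> R[i]) s : csum u s ->
  ccvg (fun N => \sum_(0 <= m < N) u (int_enum m)) s.
Proof.
move=> us; apply/cvgrPdist_le => e e0; have [J hJ] := us e e0.
exists (\max_(k <- J) (int_rank k).+1)%N => // N /= hN.
rewrite sub0r normrN ger0_norm ?cmod_ge0 //.
have -> : \sum_(0 <= m < N) u (int_enum m)
    = \sum_(k <- [fset int_enum m | m in iota 0 N]%fset) u k.
  rewrite big_imfset /=; last by move=> m m' _ _ /(can_inj int_enumK).
  rewrite /index_iota subn0; apply/perm_big.
  by apply: uniq_perm => [||m]; rewrite ?iota_uniq ?undup_uniq ?mem_undup ?inE.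
apply: hJ; apply/fsubsetP => k kJ; apply/imfsetP; exists (int_rank k); last by rewrite int_rankK.
rewrite /= mem_iota add0n; apply: leq_trans hN.
by rewrite (big_rem k) //= leq_maxl.
Qed.

End IntEnum.

#[local] Existing Instance totally_filter.

Section AbsoluteSums.
Context {R : realType} {I : choiceType}.
Implicit Types (u v : I -> R[i]) (r : I -> R).

Lemma csumD u v s t : csum u s -> csum v t -> csum (fun k => u k + v k) (s + t).
Proof.
move=> hs ht e e0.
have [J hJ] := hs (e / 2) ltac:(by rewrite divr_gt0).
have [K hK] := ht (e / 2) ltac:(by rewrite divr_gt0).
exists (fsetU J K) => L JKL.
have := hJ _ (fsubset_trans (fsubsetUl J K) JKL).
have := hK _ (fsubset_trans (fsubsetUr J K) JKL).
rewrite big_split /=; set x := \sum_(k <- _) v k; set y := \sum_(k <- _) u k => h1 h2.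
have -> : y + x - (s + t) = (y - s) + (x - t) by rewrite opprD addrACA.
by have := cmodD (y - s) (x - t); lra.
Qed.

Lemma csumZ c u s : csum u s -> csum (fun k => c * u k) (c * s).
Proof.
move=> hs e e0; have p0 : 0 < cmod c + 1 by rewrite ltr_wpDl // cmod_ge0.
have [J hJ] := hs (e / (cmod c + 1)) (divr_gt0 e0 p0).
exists J => K /hJ; rewrite -mulr_sumr -mulrBr cmodM ler_pdivlMr // => h.
apply: le_trans h; rewrite mulrC ler_wpM2l ?cmod_ge0 //; lra.
Qed.

Lemma csum_ge0_exists r B : (forall k, 0 <= r k) ->
  (forall J : {fset I}, \sum_(k <- J) r k <= B) -> exists s, csum (fun k => (r k)%:C) s.
Proof.
move=> r0 rB; pose E := [set S | exists J : {fset I}, S = \sum_(k <- J) r k].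
have supE : has_sup E.
  split; first by exists (\sum_(k <- fset0) r k); exists fset0.
  by exists B => _ [J ->].
exists (sup E)%:C => e e0; have [_ [J ->] hJ] := sup_adherent e0 supE.
exists J => K JK; rewrite -rmorph_sum -rmorphB cmod_real.
have h1 : \sum_(k <- K) r k <= sup E by apply: ub_le_sup; [case: supE|exists K].
have h2 : \sum_(k <- J) r k <= \sum_(k <- K) r k.
  by rewrite (fset_sumD r JK) lerDl sumr_ge0.
by rewrite ler_norml; apply/andP; split; lra.
Qed.

(** Each component r is (|r| + r) - |r|, a difference of nonnegative families with bounded finite
    sums, whose sums are suprema. *)
Lemma csum_abs_exists u B : (forall J : {fset I}, \sum_(k <- J) cmod (u k) <= B) ->
  exists s, csum u s.
Proof.
move=> uB.
have real r : (forall k, `|r k| <= cmod (u k)) -> exists s, csum (fun k => (r k)%:C) s.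
  move=> ru.
  have [s hs] := @csum_ge0_exists (fun k => `|r k| + r k) (2 * B)
    ltac:(by move=> k; have := ler_norm (- r k); rewrite normrN; lra)
    ltac:(by move=> J; have := uB J; rewrite -(ler_pM2l (ltr0n _ 2)) => /(le_trans _); apply;
      rewrite mulr_sumr; apply: ler_sum => k _; have := ru k; have := ler_norm (r k); lra).
  have [t ht] := @csum_ge0_exists (fun k => `|r k|) B (fun k => normr_ge0 _)
    (fun J => le_trans (ler_sum _ (fun k _ => ru k)) (uB J)).
  exists (s + -1 * t); have := csumD hs (csumZ (-1) ht).
  by congr csum; apply/funext => k; rewrite mulN1r -rmorphB /= addrC addKr.
have [s hs] := real _ (fun k => ler_Re_cmod (u k)).
have [t ht] := real _ (fun k => ler_Im_cmod (u k)).
exists (s + 'i%C * t); have := csumD hs (csumZ 'i%C ht).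
by congr csum; apply/funext => k; rewrite -complexE.
Qed.

Lemma zsum_csum (u : int -> R[i]) s : csum u s -> zsum u = s.
Proof.
move=> us.
have psE (x : int -> R) (J : {fset int}) : partial_sum x J = \sum_(k <- J) x k.
  by rewrite /partial_sum big_seq_fsetE.
apply: complex_ext; rewrite /zsum /=; apply: (@cvg_lim _ (@Rhausdorff R)).
  apply/cvgrPdist_le => e e0; have [J hJ] := us e e0; exists J => // K /hJ /=.
  by rewrite psE -Re_sum distrC -cReB; exact: le_trans (ler_Re_cmod _).
apply/cvgrPdist_le => e e0; have [J hJ] := us e e0; exists J => // K /hJ /=.
by rewrite psE -Im_sum distrC -cImB; exact: le_trans (ler_Im_cmod _).
Qed.

End AbsoluteSums.

Section Periodization.
Context {R : realType}.
Local Notation mu := (@lebesgue_measure R).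
Local Notation C := R[i].
Context (p : R) (p0 : 0 < p).
Let D : set R := `[0, p[%classic.

Lemma integral_esum_int (F : int -> R -> \bar R) :
  (forall n, measurable_fun setT (F n)) -> (forall n x, 0 <= F n x)%E ->
  (\int[mu]_x (\esum_(n in [set: int]) F n x) = \esum_(n in [set: int]) \int[mu]_x F n x)%E.
Proof.
move=> mF F0; rewrite esum_int => [|n]; last exact: integral_ge0.
under eq_integral do rewrite esum_int //.
rewrite (@integral_nneseries _ _ _ mu setT measurableT (fun m => F (int_enum m))) //.
by move=> n; exact: mF.
Qed.

Lemma measurable_esum_int (F : int -> R -> \bar R) :
  (forall n, measurable_fun setT (F n)) -> (forall n x, 0 <= F n x)%E ->
  measurable_fun setT (fun x => \esum_(n in [set: int]) F n x)%E.
Proof.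
move=> mF F0; under eq_fun do rewrite esum_int //.
apply: (@ge0_emeasurable_sum _ _ R setT (fun m => F (int_enum m)) xpredT).
  by move=> k x _ _; exact: F0.
by move=> k _; exact: mF.
Qed.

Definition tile (x : R) : int := Num.floor (x / p).

Lemma tileP (n : int) x : D (x - n%:~R * p) <-> n = tile x.
Proof.
rewrite /D /= in_itv /= /tile; split=> [/andP[h1 h2]|->].
  apply/esym/floor_def; rewrite ler_pdivlMr // ltr_pdivrMr //.
  by rewrite intrD mulrDl mul1r; apply/andP; split; lra.
have := floor_itv (x / p); rewrite intrD ler_pdivlMr // ltr_pdivrMr //.
by rewrite mulrDl mul1r => /andP[h1 h2]; apply/andP; split; lra.
Qed.

Lemma esum_single (b : \bar R) (n0 : int) (c : int -> \bar R) : (0 <= b)%E ->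
  (forall n, c n = if n == n0 then b else 0%E) ->
  (\esum_(n in [set: int]) c n = b)%E.
Proof.
move=> b0 cE; apply/eqP; rewrite eq_le; apply/andP; split.
  apply: esum_le_fset => J; have [nJ|nJ] := boolP (n0 \in J).
    rewrite (big_fsetD1 n0) //= big_seq big1 => [|k]; first by rewrite cE eqxx adde0.
    by rewrite !inE cE => /andP[/negbTE ->].
  rewrite big_seq big1 // => k kJ; rewrite cE; case: eqP => // kn.
  by move: nJ; rewrite -kn kJ.
apply: le_trans (@le_esum_fset R int c [fset n0]%fset _) => [|n].
  by rewrite big_seq_fset1 cE eqxx.
by rewrite cE; case: ifP.
Qed.

(** Insert 1 = \sum_n 1_D(x - n p), exchange sum and integral, and translate the n-th term by n
    p. *)
Lemma ge0_integral_periodize (F : R -> \bar R) : measurable_fun setT F ->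
  (forall x, 0 <= F x)%E ->
  (\int[mu]_x F x =
   \int[mu]_x (\esum_(n in [set: int]) ((\1_D x)%:E * F (x + n%:~R * p)%R)))%E.
Proof.
move=> mF F0.
have mD : measurable D by exact: measurable_itv.
have mI : measurable_fun setT (fun x => (\1_D x : R)%:E).
  by apply/measurable_EFinP; exact: measurable_indic.
have shift_m (G : R -> \bar R) (b : R) : measurable_fun setT G ->
    measurable_fun setT (fun x : R => G (x + b)).
  by move=> mG; apply: (measurableT_comp mG); exact: measurable_funD.
pose T n x := ((\1_D (x - n%:~R * p))%:E * F x)%E.
have T0 n x : (0 <= T n x)%E by rewrite mule_ge0 // lee_fin.
have mT n : measurable_fun setT (T n).
  by apply: emeasurable_funM => //; exact: (shift_m _ (- (n%:~R * p)) mI).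
have -> : (\int[mu]_x F x = \int[mu]_x (\esum_(n in [set: int]) T n x))%E.
  apply: eq_integral => x _; rewrite (@esum_single (F x) (tile x)) // => n.
  rewrite /T indicE; case: eqP => h; first by rewrite mem_set ?mul1e //; apply/tileP.
  by rewrite memNset ?mul0e // => /tileP.
rewrite integral_esum_int // integral_esum_int; first last.
- by move=> n x; rewrite mule_ge0 // lee_fin.
- by move=> n; apply: emeasurable_funM => //; exact: shift_m.
apply: eq_esum => n _; rewrite -(ge0_integral_shift (n%:~R * p) (mT n)) //.
by apply: eq_integral => x _; rewrite /T addrK.
Qed.

End Periodization.

Section ComplexPeriodization.
Context {R : realType}.
Local Notation mu := (@lebesgue_measure R).
Local Notation C := R[i].
Context (p : R) (p0 : 0 < p).
Let D : set R := `[0, p[%classic.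

Lemma sum_int_enum_single (t : int) N :
  \sum_(0 <= k < N) ((int_enum k == t)%:R : R) = (int_rank t < N)%N%:R.
Proof.
elim: N => [|N ih]; first by rewrite big_nil.
rewrite big_nat_recr //= ih ltnS [in RHS]leq_eqVlt.
have -> : (int_enum N == t) = (int_rank t == N).
  by apply/eqP/eqP => [<-|<-]; [exact: int_enumK|exact: int_rankK].
by have [->|] := eqVneq (int_rank t) N; rewrite ?ltnn ?add0r ?addr0.
Qed.

Lemma cind_tile (n : int) (x : R) : cind D (x - n%:~R * p) = (n == tile p x)%:R.
Proof.
by case: eqP => h; [rewrite cind_in //; apply/(tileP p0)|rewrite cind_out // => /(tileP p0)].
Qed.

Lemma cmod_sum_tiles N (x : R) :
  cmod (\sum_(0 <= k < N) cind D (x - (int_enum k)%:~R * p)) <= 1.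
Proof.
have -> : \sum_(0 <= k < N) cind D (x - (int_enum k)%:~R * p) =
    (\sum_(0 <= k < N) ((int_enum k == tile p x)%:R : R))%:C.
  by rewrite rmorph_sum; apply: eq_bigr => k _; rewrite cind_tile /= rmorph_nat.
by rewrite [X in X%:C]sum_int_enum_single cmod_real ger0_norm // lern1 leq_b1.
Qed.

(** Complex periodization, with the multiplier [m] present so that one [B] serves all the
    exponentials at once: its Fourier coefficients become integrals of [F] over the line. *)
Lemma periodize_cintegral (F : R -> C) : cintegrable F ->
  exists B : R -> C, [/\ cintegrable B, forall x, ~ D x -> B x = 0,
    {ae mu, forall x, D x -> csum (fun n : int => F (x + n%:~R * p)) (B x)} &
    forall (m : R -> C) (K : R), cmeasurable m -> (forall x, cmod (m x) <= K) ->
      (forall x (n : int), m (x + n%:~R * p) = m x) ->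
      cintegral (fun x => m x * F x) = cintegral (fun x => m x * B x)].
Proof.
move=> iF; have mF := cintegrable_measurable iF; have iF1 := cintegrable_cmod iF.
have mD : measurable D by exact: measurable_itv.
have mF1 := rintegrable_measurable iF1.
pose G x := (\esum_(n in [set: int]) ((\1_D x)%:E * (cmod (F (x + n%:~R * p)))%:E))%E.
have t0 (n : int) (x : R) : (0 <= (\1_D x : R)%:E * (cmod (F (x + n%:~R * p)))%:E)%E.
  by rewrite mule_ge0 // lee_fin // cmod_ge0.
have mt (n : int) : measurable_fun setT
    (fun x : R => ((\1_D x : R)%:E * (cmod (F (x + n%:~R * p)))%:E)%E).
  apply/measurable_EFinP; apply: measurable_funM; first exact: measurable_indic.
  exact: (measurable_shift (n%:~R * p) mF1).
have mG : measurable_fun setT G by exact: (measurable_esum_int mt t0).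
have G0 x : (0 <= G x)%E by apply: esum_ge0 => n _; exact: t0.
have iG : mu.-integrable setT G.
  apply/integrableP; split => //; under eq_integral do rewrite gee0_abs //.
  rewrite -(ge0_integral_periodize p0 (F := fun x => (cmod (F x))%:E)).
  - have /integrableP[_] := iF1; under eq_integral do rewrite /= ger0_norm ?cmod_ge0 //.
    by [].
  - exact/measurable_EFinP.
  - by move=> x; rewrite lee_fin cmod_ge0.
pose A := [set x | (G x < +oo)%E].
have mA : measurable A by rewrite -[A]setTI; exact: emeasurable_fun_infty_o.
have aeA : {ae mu, forall x, A x}.
  apply: aeS (integrable_ae measurableT iG) => x /(_ I).
  by rewrite ge0_fin_numE.
pose g x := \1_A x * fine (G x).
have g0 x : 0 <= g x by rewrite mulr_ge0 // fine_ge0.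
have mg : measurable_fun setT g.
  apply: measurable_funM; first exact: measurable_indic.
  by apply: (@measurableT_comp _ _ _ _ _ _ fine) => //; exact: fine_measurable.
have ig : rintegrable g.
  apply: (le_integrable _ _ _ iG) => //; first exact/measurable_EFinP.
  move=> x _; rewrite gee0_abs ?lee_fin //= gee0_abs //.
  rewrite /g indicE; case: (boolP (x \in A)) => xA; last by rewrite mul0r.
  by rewrite mul1r fineK // ge0_fin_numE //; exact: (set_mem xA).
(* Restricting to the set [A] of absolute convergence gives a family summable at every point, so
   that [B] is an everywhere limit and hence measurable. *)
pose v (n : int) (x : R) : C := cind A x * (cind D x * F (x + n%:~R * p)).
have mv n : cmeasurable (v n).
  apply: cmeasurableM; first exact: cmeasurable_cind.
  apply: cmeasurableM; first exact: cmeasurable_cind.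
  exact: cmeasurable_shift.
have vg (J : {fset int}) x : \sum_(n <- J) cmod (v n x) <= g x.
  have [Ax|Ax] := pselect (A x); last first.
    rewrite /g indicE memNset // mul0r /v big1 // => n _.
    by rewrite cind_out // mul0r cmod0.
  rewrite /g indicE mem_set // mul1r -lee_fin fineK ?ge0_fin_numE //.
  rewrite -sumEFin; apply: le_trans (le_esum_fset J (t0 ^~ x)).
  apply: lee_sum => n _; rewrite /v cind_in // mul1r cmodM /cind cmod_real.
  by rewrite EFinM ger0_norm.
have /choice[B hB] : forall x, exists s, csum (v ^~ x) s.
  by move=> x; exact: (csum_abs_exists (fun J => vg J x)).
pose u N x := \sum_(0 <= k < N) v (int_enum k) x.
have mu_ N : cmeasurable (u N) by apply: cmeasurable_sum => k; exact: mv.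
have uB x : ccvg (u ^~ x) (B x) by exact: (csum_int (hB x)).
have mB : cmeasurable B by exact: (cmeasurable_cvg mu_ uB).
have ug N x : cmod (u N x) <= g x.
  have -> : u N x = \sum_(k <- [fset int_enum m | m in iota 0 N]%fset) v k x.
    rewrite big_imfset /=; last by move=> m m' _ _ /(can_inj int_enumK).
    rewrite /u /index_iota subn0; apply/perm_big.
    by apply: uniq_perm => [||m]; rewrite ?iota_uniq ?undup_uniq ?mem_undup ?inE.
  exact: le_trans (cmod_sum _ _) (vg _ x).
have dct (m : R -> C) (K : R) : cmeasurable m -> (forall x, cmod (m x) <= K) ->
    cintegrable (fun x => m x * B x) /\
    ccvg (fun N => cintegral (fun x => m x * u N x)) (cintegral (fun x => m x * B x)).
  move=> mm mK; apply: (@dominated_cintegral _ _ _ (fun x => K * g x)).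
  - by move=> N; exact: cmeasurableM.
  - exact: cmeasurableM.
  - exact: rintegrableZ.
  - apply: aeW => x; rewrite /ccvg; under eq_fun do rewrite -mulrBr cmodM.
    by rewrite -(mulr0 (cmod (m x))); apply: cvgMr; exact: uB.
  - by apply: aeW => x N; rewrite cmodM ler_pM ?cmod_ge0.
exists B; split.
- have [h _] := dct (fun=> 1) 1 (cmeasurable_cst _) (fun x => ltac:(by rewrite cmod1)).
  by move: h; under eq_fun do rewrite mul1r.
- move=> x Dx; apply: (csum_unique (hB x)) => e e0; exists fset0 => J _.
  rewrite big1 ?subrr ?cmod0 ?ltW // => n _; by rewrite /v (cind_out Dx) mul0r mulr0.
- apply: aeS aeA => x Ax Dx; have := hB x; congr csum; apply/funext => n.
  by rewrite /v !cind_in // !mul1r.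
move=> m K mm mK mper; have [_ h1] := dct m K mm mK.
have imF : cintegrable (fun x => m x * F x) by exact: cintegrableMl mK iF.
have cD n : forall x, cmod (cind D (x - n%:~R * p)) <= 1 by move=> x; exact: cmod_cind.
have mcD n : cmeasurable (fun x => cind D (x - n%:~R * p)).
  by apply: (cmeasurable_shift (- (n%:~R * p))); exact: cmeasurable_cind.
(* The integral over the line is the limit of integrals over finitely many tiles; by periodicity of
   [m], each tile translates to a term of the series for [B]. *)
have [_ h2] := @dominated_cintegral R
  (fun N x => \sum_(0 <= k < N) cind D (x - (int_enum k)%:~R * p) * (m x * F x))
  (fun x => m x * F x) _
  (fun N => cmeasurable_sum _ (fun k => cmeasurableM (mcD (int_enum k)) (cintegrable_measurable imF)))
  (cintegrable_measurable imF) (cintegrable_cmod imF)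
  ltac:(by apply: aeW => x; apply: (csum_int (u := fun n => cind D (x - n%:~R * p) * (m x * F x)));
    have := @csum_delta R int (fun=> m x * F x) (tile p x);
    congr csum; apply/funext => n; rewrite cind_tile mulrC)
  ltac:(by apply: aeW => x N; rewrite -mulr_suml cmodM ler_piMl ?cmod_ge0 // cmod_sum_tiles).
apply: (ccvg_unique h2); move: h1; congr ccvg; apply/funext => N.
have iDF n : cintegrable (fun x => cind D (x - n%:~R * p) * (m x * F x)).
  exact: cintegrableMl (mcD n) (cD n) imF.
have imv n : cintegrable (fun x => m x * v n x).
  apply: cintegrableMl mm mK _; apply: (@cintegrableMl _ 1) => //.
  - exact: cmeasurable_cind.
  - exact: cmod_cind.
  apply: (@cintegrableMl _ 1) => //.
  - exact: cmeasurable_cind.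
  - exact: cmod_cind.
  - exact: cintegrable_shift.
rewrite [RHS]cintegral_sum //; under eq_fun do rewrite mulr_sumr.
rewrite cintegral_sum //; apply: eq_bigr => k _; set n := int_enum k.
rewrite -(@cintegral_shift _ (n%:~R * p) _ (cintegrable_measurable (iDF n))).
apply: ae_eq_cintegral.
- exact: cintegrable_measurable.
- exact: (cintegrable_measurable (cintegrable_shift (n%:~R * p) (iDF n))).
- by apply: aeS aeA => x Ax; rewrite /v cind_in // mul1r addrK mper mulrCA.
Qed.

End ComplexPeriodization.

(** * Plancherel's theorem and the Fourier transform *)

Section FourierIntegral.
Context {R : realType}.
Local Notation mu := (@lebesgue_measure R).
Local Notation C := R[i].
Implicit Types (f g : R -> C).

Lemma cintegrable_L1 f : L1 f <-> cintegrable f.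
Proof.
rewrite cintegrableP /L1 /= /L1norm Lnorm1; split=> [[mf fi]|[mf fi]]; split=> //.
  apply/integrableP; split; first by apply/measurable_EFinP; exact: measurable_cmod.
  exact: fi.
by have /integrableP[_] := fi.
Qed.

Definition wave (c x : R) : C := cis (- (2 * pi * x * c)).

Lemma cmeasurable_wave c : cmeasurable (wave c).
Proof.
have -> : wave c = fun x => cis (- (2 * pi * c) * x).
  by apply/funext => x; rewrite /wave; congr cis; ring.
exact: cmeasurable_cis.
Qed.

Lemma cmod_wave c x : cmod (wave c x) <= 1.
Proof. by rewrite /wave cmod_cis. Qed.

Lemma fourier_integrable f c : cintegrable f -> cintegrable (fun x => f x * wave c x).
Proof.
move=> cf; under eq_fun do rewrite mulrC.
exact: (cintegrableMl (cmeasurable_wave c) (cmod_wave c) cf).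
Qed.

Lemma fourier_integralD f g c : cintegrable f -> cintegrable g ->
  fourier_integral (fun x => f x + g x) c = fourier_integral f c + fourier_integral g c.
Proof.
move=> cf cg; rewrite /fourier_integral -cintegralD; try exact: fourier_integrable.
by congr cintegral; apply/funext => x; rewrite mulrDl.
Qed.

Lemma fourier_integralZ (z : C) f c : cintegrable f ->
  fourier_integral (fun x => z * f x) c = z * fourier_integral f c.
Proof.
move=> cf; rewrite /fourier_integral -cintegralZ; last exact: fourier_integrable.
by congr cintegral; apply/funext => x; rewrite mulrA.
Qed.

Lemma fourier_integral_translate k f c : cintegrable f ->
  fourier_integral (translate k f) c = cis (- (2 * pi * k%:~R * c)) * fourier_integral f c.
Proof.
move=> cf; have cfw := fourier_integrable c cf.
rewrite /fourier_integral -cintegralZ //.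
rewrite -[RHS](@cintegral_shift _ (- k%:~R)).
  congr cintegral; apply/funext => x; rewrite /translate /wave mulrCA -cisD.
  by congr (_ * cis _); ring.
by apply: cintegrable_measurable; exact: cintegrableZ.
Qed.

(** Continuity in the frequency, by dominated convergence; it provides the measurability of the
    transform. *)
Lemma fourier_integral_seq f (c : nat -> R) l : cintegrable f -> c n @[n --> \oo] --> l ->
  ccvg (fun n => fourier_integral f (c n)) (fourier_integral f l).
Proof.
move=> cf cl.
have [] // := @dominated_cintegral R (fun n x => f x * wave (c n) x) (fun x => f x * wave l x) _
  (fun n => cintegrable_measurable (fourier_integrable (c n) cf))
  (cintegrable_measurable (fourier_integrable l cf)) (cintegrable_cmod cf).
  apply: aeW => x; rewrite /ccvg.
  under eq_fun do rewrite -mulrBr cmodM.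
  rewrite -(mulr0 (cmod (f x))); apply: cvgMr.
  have h : - (2 * pi * x * c n) @[n --> \oo] --> - (2 * pi * x * l).
    by apply: cvgN; apply: cvgMr.
  apply/ccvgP; split => /=.
    by apply: (continuous_cvg _ (@continuous_cos R _)).
  by apply: (continuous_cvg _ (@continuous_sin R _)).
by apply: aeW => x n; rewrite cmodM ler_piMr ?cmod_ge0 ?cmod_wave.
Qed.

Lemma cmeasurable_fourier_integral f : cintegrable f -> cmeasurable (fourier_integral f).
Proof.
move=> cf; split; apply: continuous_measurable_fun => l; apply/(@cvg_nbhsP R R^o) => c cl.
  by have /ccvgP[] := fourier_integral_seq cf cl.
by have /ccvgP[] := fourier_integral_seq cf cl.
Qed.

End FourierIntegral.

Section Plancherel.
Context {R : realType}.
Local Notation mu := (@lebesgue_measure R).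
Local Notation C := R[i].
Implicit Types (f g : R -> C).

(* On each coset [c + Z / P] the values of the transform of [u] are the Fourier
   coefficients of [u(x) exp(-2 i pi c x)] on the period [a, a + P[. *)
Lemma plancherel_supported (a P : R) (u : L2fun R) : 0 < P -> supported P a (val u) ->
  (\int[mu]_c (cmod (fourier_integral (val u) c) ^+ 2)%:E = (sqint (val u))%:E)%E.
Proof.
move=> P0 su.
have iu : cintegrable (val u).
  by rewrite -(supportedE su); exact: cintegrable_L2_itv (L2funP u).
pose h := fourier_integral (val u).
have mh : cmeasurable h by exact: cmeasurable_fourier_integral.
have P'0 : 0 < P^-1 by rewrite invr_gt0.
have key c : (\esum_(n in [set: int]) (P^-1 * cmod (h (c + n%:~R * P^-1)) ^+ 2)%:E
    = (sqint (val u))%:E)%E.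
  (* The conjugate matches the sign convention of [pcoef]: its n-th coefficient is, up to
     normalization, the conjugate of h (c + n / P). *)
  have w2 : L2 (fun x => (val u x * wave c x)^*).
    apply: L2J; under eq_fun do rewrite mulrC.
    by apply: (L2Ml (cmeasurable_wave c) (cmod_wave c)); exact: L2funP.
  have sw : supported P a (val (toL2 w2)).
    by move=> x Dx /=; rewrite su // mul0r rmorph0.
  have -> : sqint (val u) = sqint (val (toL2 w2)).
    apply: eq_Rintegral => x _; rewrite /= cmod_conj cmodM.
    by rewrite [cmod (wave _ _)]cmod_cis mulr1.
  rewrite -(parseval_L2 P0 sw); apply: eq_esum => n _; congr (_%:E).
  rewrite /pcoef cmodM exprMn cmod_real ger0_norm ?invr_ge0 ?sqrtr_ge0 //.
  rewrite exprVn [Num.sqrt P ^+ 2]sqr_sqrtr ?(ltW P0) //. congr (_ * _); congr (_ ^+ 2).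
  rewrite -[LHS]cmod_conj; congr cmod; rewrite /h /fourier_integral -cintegralJ; last first.
    exact: (fourier_integrable (c + n%:~R * P^-1) iu).
  congr cintegral; apply/funext => x /=.
  rewrite !rmorphM /= mulrCA; congr (_ * _); rewrite /wave /expi -!cisN -cisD.
  by congr cis; ring.
have mh2 : measurable_fun setT (fun c => cmod (h c) ^+ 2).
  by apply: measurable_funX; exact: measurable_cmod.
have E := @ge0_integral_periodize R P^-1 P'0 (fun c => (P^-1 * cmod (h c) ^+ 2)%:E).
have E1 : (\int[mu]_c (P^-1 * cmod (h c) ^+ 2)%:E = (P^-1 * sqint (val u))%:E)%E.
  rewrite E; first last.
  - by move=> c; rewrite lee_fin mulr_ge0 ?sqr_ge0 // ltW.
  - by apply/measurable_EFinP; apply: measurable_funM.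
  (* The periodized function is the constant |u|^2, to be integrated over a period of length 1 /
     P. *)
  transitivity (\int[mu]_c ((\1_(`[0%R, P^-1[%classic) c : R)%:E * (sqint (val u))%:E))%E.
    apply: eq_integral => c _; rewrite indicE; case: (c \in _).
      by rewrite mul1e -(key c); apply: eq_esum => n _; rewrite mul1e.
    by rewrite mul0e esum1 // => n _; rewrite mul0e.
  rewrite ge0_integralZr //; last 2 first.
  - by apply/measurable_EFinP; exact: measurable_indic.
  - by rewrite lee_fin sqint_ge0.
  rewrite integral_indic // setIT EFinM; congr (_ * _)%E.
  by rewrite [LHS]lebesgue_measure_itv /= lte_fin P'0 oppr0 adde0.
have -> : (\int[mu]_c (cmod (h c) ^+ 2)%:E = P%:E * \int[mu]_c (P^-1 * cmod (h c) ^+ 2)%:E)%E.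
  rewrite -ge0_integralZl //; first last.
  - by rewrite lee_fin ltW.
  - by move=> c _; rewrite lee_fin mulr_ge0 ?sqr_ge0 // ltW.
  - by apply/measurable_EFinP; apply: measurable_funM.
  by apply: eq_integral => c _; rewrite -EFinM mulrA mulfV ?gt_eqF // mul1r.
by rewrite E1 -EFinM mulrA mulfV ?gt_eqF // mul1r.
Qed.

End Plancherel.

Section FourierTransform.
Context {R : realType}.
Local Notation mu := (@lebesgue_measure R).
Local Notation C := R[i].
Local Notation H := (L2fun R).
Local Notation nrm := (hnorm (@ipL2 R)).
Implicit Types (f g u v : H).
Let hip := @ipL2_inner_product R.

(** This is [-n, n + 1[, in the shape [a, a + P[ of a period; the extra 1 keeps P positive at n =
    0. *)
Definition trunc_set (n : nat) : set R := `[- n%:R, - n%:R + (2 * n%:R + 1)[%classic.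

Lemma measurable_trunc n : measurable (trunc_set n).
Proof. exact: measurable_itv. Qed.

Definition truncL2 (n : nat) u : H :=
  toL2 (L2Ml (cmeasurable_cind (measurable_trunc n)) (@cmod_cind R (trunc_set n)) (L2funP u)).

Lemma trunc_in (x : R) : exists N, forall n, (N <= n)%N -> trunc_set n x.
Proof.
exists (Num.truncn `|x|).+1 => n hn.
have h : `|x| <= n%:R.
  by apply: le_trans (_ : (Num.truncn `|x|).+1%:R <= _); rewrite ?ler_nat // ltW // truncnS_gt.
by move: h; rewrite ler_norml /trunc_set /= in_itv /= => /andP[h1 h2]; apply/andP; split; lra.
Qed.

Lemma trunc_cvg u (x : R) : ccvg (fun n => val (truncL2 n u) x) (val u x).
Proof.
have [N hN] := trunc_in x; apply: cvg_near_cst; exists N => // n /= /hN hx.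
by rewrite cind_in // mul1r subrr cmod0.
Qed.

Lemma truncL2_cvg u : nrm (truncL2 n u - u) @[n --> \oo] --> (0 : R).
Proof.
have u2 := L2funP u; have /L2P[mu_ iu2] := u2.
have sq : sqint (val (truncL2 n u - u)) @[n --> \oo] --> (0 : R).
  have mS n : measurable_fun setT (fun x => cmod (val (truncL2 n u - u) x) ^+ 2).
    by apply: measurable_funX; apply: measurable_cmod; exact: L2_measurable (L2funP _).
  have [] := @dominated_Rintegral R (fun n x => cmod (val (truncL2 n u - u) x) ^+ 2) (fun=> 0)
    (fun x => cmod (val u x) ^+ 2) mS (measurable_cst _) iu2 _ _.
  - apply: aeW => x; have h := trunc_cvg u x.
    by rewrite -(mulr0 (0 : R)); apply: cvgM; exact: h.
  - apply: aeW => x n; rewrite ger0_norm ?sqr_ge0 // ler_pXn2r ?nnegrE ?cmod_ge0 //.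
    rewrite -[val _ x]/(cind (trunc_set n) x * val u x - val u x).
    have [Dx|Dx] := pselect (trunc_set n x).
      by rewrite cind_in // mul1r subrr cmod0 cmod_ge0.
    by rewrite cind_out // mul0r sub0r cmodN.
  move=> _; have -> : \int[mu]_x (0 : R) = 0 by rewrite /Rintegral integral0.
  by [].
have -> : (fun n => nrm (truncL2 n u - u)) = Num.sqrt \o (fun n => sqint (val (truncL2 n u - u))).
  apply/funext => n; rewrite -[LHS]ger0_norm ?hnorm_ge0 // -sqrtr_sqr.
  by congr (Num.sqrt _); exact: hnormL2_sqr.
by rewrite -(sqrtr0 R); apply: continuous_cvg sq; exact: sqrt_continuous.
Qed.

Lemma trunc_supported n u : supported (2 * n%:R + 1) (- n%:R) (val (truncL2 n u)).
Proof. by move=> x Dx; rewrite /= cind_out // mul0r. Qed.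

Lemma trunc_cintegrable n u : cintegrable (val (truncL2 n u)).
Proof.
rewrite -(supportedE (@trunc_supported n u)); exact: cintegrable_L2_itv (L2funP _).
Qed.

Lemma L2_sq_finite (h : R -> C) : cmeasurable h ->
  (\int[mu]_c (cmod (h c) ^+ 2)%:E < +oo)%E -> L2 h.
Proof.
move=> mh fin; apply/L2P; split => //; apply/integrableP; split.
  by apply/measurable_EFinP; apply: measurable_funX; exact: measurable_cmod.
by under eq_integral do rewrite /= ger0_norm ?sqr_ge0 //.
Qed.

Lemma sqintE (h : R -> C) : L2 h -> (\int[mu]_c (cmod (h c) ^+ 2)%:E = (sqint h)%:E)%E.
Proof.
by move=> /L2P[_ ih]; rewrite /sqint /Rintegral fineK //; exact: (integrable_fin_num _ ih).
Qed.

(** Transforms of truncations converge pointwise since [u] is integrable. Fatou's lemma gives only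
    an inequality, but this already makes the transform continuous for the L^2 norm. *)
Lemma plancherel_le u : cintegrable (val u) ->
  (\int[mu]_c (cmod (fourier_integral (val u) c) ^+ 2)%:E <= (sqint (val u))%:E)%E.
Proof.
move=> iu; pose w n := fourier_integral (val (truncL2 n u)).
have mw n : cmeasurable (w n) by exact/cmeasurable_fourier_integral/trunc_cintegrable.
have wE n : (\int[mu]_c (cmod (w n c) ^+ 2)%:E = (sqint (val (truncL2 n u)))%:E)%E.
  apply: plancherel_supported (@trunc_supported n u).
  by rewrite ltr_wpDl // mulr_ge0.
have wle n : (\int[mu]_c (cmod (w n c) ^+ 2)%:E <= (sqint (val u))%:E)%E.
  rewrite wE lee_fin; apply: le_Rintegral => //.
  - by have /L2P[_] := L2funP (truncL2 n u).
  - by have /L2P[_] := L2funP u.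
  move=> x _; rewrite ler_pXn2r ?nnegrE ?cmod_ge0 //= cmodM.
  by rewrite ler_piMl ?cmod_ge0 ?cmod_cind.
have wcv c : ccvg (w ^~ c) (fourier_integral (val u) c).
  have [] // := @dominated_cintegral R (fun n x => val (truncL2 n u) x * wave c x)
    (fun x => val u x * wave c x) (fun x => cmod (val u x))
    (fun n => cintegrable_measurable (fourier_integrable c (trunc_cintegrable n u)))
    (cintegrable_measurable (fourier_integrable c iu)) (cintegrable_cmod iu).
    apply: aeW => x; rewrite /ccvg; under eq_fun do rewrite -mulrBl cmodM.
    by rewrite -(mul0r (cmod (wave c x))); apply: cvgMl; exact: trunc_cvg.
  apply: aeW => x n; rewrite /= !cmodM [cmod (wave c x)]cmod_cis mulr1.
  by rewrite ler_piMl ?cmod_ge0 ?cmod_cind.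
have cv c : (cmod (w n c) ^+ 2)%:E @[n --> \oo] --> (cmod (fourier_integral (val u) c) ^+ 2)%:E.
  have hc : cmod (w n c) @[n --> \oo] --> cmod (fourier_integral (val u) c); last first.
    by apply: cvg_EFin; [exact: nearW|exact: (cvgM hc hc)].
  apply/cvgrPdist_le => e e0; have /cvgrPdist_le/(_ e e0) := wcv c; apply: filterS => n.
  rewrite sub0r normrN ger0_norm ?cmod_ge0 // => h; apply: le_trans h.
  have h1 := cmodD (fourier_integral (val u) c - w n c) (w n c).
  have h2 := cmodD (w n c - fourier_integral (val u) c) (fourier_integral (val u) c).
  rewrite !subrK in h1 h2; rewrite [cmod (_ - w n c)]cmodC in h1.
  by rewrite ler_norml; apply/andP; split; lra.
have -> : (fun c => (cmod (fourier_integral (val u) c) ^+ 2)%:E)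
    = (fun c => limn_einf (fun n => (cmod (w n c) ^+ 2)%:E)).
  apply/funext => c; rewrite is_cvg_limn_einfE; last by apply/cvg_ex; eexists; exact: cv.
  by apply/esym/cvg_lim => //; exact: cv.
apply: le_trans (fatou mu measurableT _ _) _.
- by move=> n; apply/measurable_EFinP; apply: measurable_funX; exact: measurable_cmod.
- by move=> n c _; rewrite lee_fin sqr_ge0.
rewrite limn_einf_lim; apply: lime_le; first exact: is_cvg_einfs.
apply: nearW => n; apply: le_trans (wle n); apply: ereal_inf_lbound.
by exists n => /=.
Qed.

Lemma L2_fourier_integral u : cintegrable (val u) -> L2 (fourier_integral (val u)).
Proof.
move=> iu; apply: L2_sq_finite; first exact: cmeasurable_fourier_integral.
exact: le_lt_trans (plancherel_le iu) (ltry _).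
Qed.

Definition is_hat u (w : H) := cintegrable (val u) /\ val w = fourier_integral (val u) :> (R -> C).

Lemma is_hatD u v w z : is_hat u w -> is_hat v z -> is_hat (u + v) (w + z).
Proof.
move=> [iu wE] [iv zE]; split; first exact: cintegrableD.
by apply/funext => c; rewrite [RHS]fourier_integralD // -wE -zE.
Qed.

Lemma is_hatZ a u w : is_hat u w -> is_hat (a *: u) (a *: w).
Proof.
move=> [iu wE]; split; first exact: cintegrableZ.
by apply/funext => c; rewrite [RHS]fourier_integralZ // -wE.
Qed.

Lemma is_hatB u v w z : is_hat u w -> is_hat v z -> is_hat (u - v) (w - z).
Proof. by move=> hu hv; rewrite -[- v]scaleN1r -[- z]scaleN1r; apply: is_hatD => //; exact: is_hatZ. Qed.

Lemma is_hat_exists u : cintegrable (val u) -> exists w, is_hat u w.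
Proof. by move=> iu; exists (toL2 (L2_fourier_integral iu)). Qed.

Lemma hnorm_hat_le u w : is_hat u w -> nrm w <= nrm u.
Proof.
move=> [iu wE]; rewrite -(ler_pXn2r (ltn0Sn 1)) ?nnegrE ?hnorm_ge0 // !hnormL2_sqr.
by rewrite -lee_fin -[leLHS]sqintE ?wE; [exact: plancherel_le|rewrite -wE; exact: L2funP].
Qed.

Lemma hnorm_hat_trunc n u w : is_hat (truncL2 n u) w -> nrm w = nrm (truncL2 n u).
Proof.
move=> [iu wE]; apply: (@pexpIrn _ 2); rewrite ?nnegrE ?hnorm_ge0 // !hnormL2_sqr.
have : (sqint (val w))%:E = (sqint (val (truncL2 n u)))%:E.
  rewrite -sqintE; last exact: L2funP.
  rewrite wE; apply: plancherel_supported (@trunc_supported n u).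
  by rewrite ltr_wpDl // mulr_ge0.
by case.
Qed.

(** Equality holds for truncations and passes to the limit through [hnorm_hat_le] applied to the
    difference; the distance to the truncation is paid twice, hence e / 2. *)
Lemma hnorm_hat u w : is_hat u w -> nrm w = nrm u.
Proof.
move=> hu; apply/eqP; rewrite eq_le hnorm_hat_le //=; apply/ler_addgt0Pr => e e0.
have /cvgrPdist_le/(_ (e / 2) ltac:(by rewrite divr_gt0))[N _ /(_ N (leqnn N)) /=] := truncL2_cvg u.
rewrite sub0r normrN ger0_norm ?hnorm_ge0 // => hN.
have [z hz] := is_hat_exists (trunc_cintegrable N u).
have h1 := hnorm_hat_le (is_hatB hz hu).
have h2 := hnorm_hat_trunc hz.
have h3 := ler_hnormD hip (u - truncL2 N u) (truncL2 N u); rewrite subrK in h3.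
have h4 := ler_hnormD hip (z - w) w; rewrite subrK in h4.
rewrite (hnormC hip) in h3; lra.
Qed.

End FourierTransform.

Lemma ler_dist_hnorm (R : realType) (H : lmodType R[i]) (ip : H -> H -> R[i])
  (hip : inner_product ip) (x y : H) : `|hnorm ip x - hnorm ip y| <= hnorm ip (x - y).
Proof.
have h1 := ler_hnormD hip (x - y) y; rewrite subrK in h1.
have h2 := ler_hnormD hip (y - x) x; rewrite subrK (hnormC hip) in h2.
by rewrite ler_norml; apply/andP; split; lra.
Qed.

(** * The Fourier transform on L^2 as a relation *)

Section FourierRelation.
Context {R : realType}.
Local Notation mu := (@lebesgue_measure R).
Local Notation C := R[i].
Local Notation H := (L2fun R).
Local Notation nrm := (hnorm (@ipL2 R)).
Implicit Types (f g u v w : H).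
Let hip := @ipL2_inner_product R.

(** The graph of the transform. Linearity and isometry are proved for this relation because
    [fourier] selects an arbitrary representative of an a.e. class. *)
Definition fourier_rel f g := exists u w : nat -> H,
  [/\ forall n, is_hat (u n) (w n), nrm (u n - f) @[n --> \oo] --> (0 : R) &
      nrm (w n - g) @[n --> \oo] --> (0 : R)].

Lemma L2norm_cvg0 (u : nat -> H) f :
  (L2norm (val (u n) - val f : R -> C) @[n --> \oo] --> 0%E) <->
  (nrm (u n - f) @[n --> \oo] --> (0 : R)).
Proof.
have -> : (fun n => L2norm (val (u n) - val f : R -> C)) = (fun n => (nrm (u n - f))%:E).
  by apply/funext => n; rewrite -L2norm_hnorm.
split=> h; first exact: (fine_cvg h).
by apply: cvg_EFin => //; exact: nearW.
Qed.

Lemma is_fourierP f g : is_fourier (val f) (val g) <-> fourier_rel f g.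
Proof.
split=> [[_ [u [uL uf ug]]]|[u [w [hw uf wg]]]].
  pose u' n : H := toL2 (uL n).2.
  have iu n : cintegrable (val (u' n)) by apply/cintegrable_L1; case: (uL n).
  have /choice[w hw] : forall n, exists w, is_hat (u' n) w.
    by move=> n; exact: is_hat_exists.
  exists u', w; split=> //; apply/L2norm_cvg0; first exact: uf.
  by under eq_fun => n do rewrite (hw n).2; exact: ug.
split; first exact: L2funP.
exists (fun n => val (u n) : R -> C); split=> [n||].
- by split; [apply/cintegrable_L1; case: (hw n)|exact: L2funP].
- exact/L2norm_cvg0.
- by move/L2norm_cvg0: wg; under eq_fun => n do rewrite (hw n).2.
Qed.

Lemma cvg0_close (s : nat -> R) : (forall n, 0 <= s n) ->
  s n @[n --> \oo] --> (0 : R) ->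
  forall e, 0 < e -> exists N, forall n, (N <= n)%N -> s n <= e.
Proof.
move=> s0 /cvgrPdist_le h e /h [N _ hN]; exists N => n /hN /=.
by rewrite sub0r normrN ger0_norm.
Qed.

Lemma close_cvg0 (s : nat -> R) : (forall n, 0 <= s n) ->
  (forall e, 0 < e -> exists N, forall n, (N <= n)%N -> s n <= e) ->
  s n @[n --> \oo] --> (0 : R).
Proof.
move=> s0 h; apply/cvgrPdist_le => e /h [N hN]; exists N => // n /hN /=.
by rewrite sub0r normrN ger0_norm.
Qed.

Lemma cvg0_le (s t r : nat -> R) : (forall n, 0 <= s n) -> (forall n, s n <= t n + r n) ->
  t n @[n --> \oo] --> (0 : R) -> r n @[n --> \oo] --> (0 : R) ->
  s n @[n --> \oo] --> (0 : R).
Proof.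
move=> s0 str t0 r0.
have h : t n + r n @[n --> \oo] --> (0 + 0 : R) by exact: cvgD.
rewrite addr0 in h; apply: (squeeze_cvgr _ (cvg_cst (0 : R)) h).
by apply: nearW => n; rewrite s0 str.
Qed.

Lemma fourier_rel_exists f : exists g, fourier_rel f g.
Proof.
have /choice[w hw] : forall n, exists w, is_hat (truncL2 n f) w.
  by move=> n; apply: is_hat_exists; exact: trunc_cintegrable.
have tf := cvg0_close (fun n => hnorm_ge0 _ _) (truncL2_cvg f).
have [|g hg] := @ipL2_complete R w.
  move=> e e0; have [N hN] := tf (e / 2) ltac:(by rewrite divr_gt0).
  exists N => m n hm hn; rewrite (hnorm_hat (is_hatB (hw m) (hw n))).
  apply: le_trans (hnorm_dist hip _ f _) _; rewrite (hnormC hip f) [leRHS]splitr.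
  by apply: lerD; exact: hN.
exists g; exists (fun n => truncL2 n f), w; split=> //; first exact: truncL2_cvg.
by apply: close_cvg0 => // n; exact: hnorm_ge0.
Qed.

Lemma fourier_spec f : exists2 g, val g = fourier (val f) :> (R -> C) & fourier_rel f g.
Proof.
have [g0 hg0] := fourier_rel_exists f.
have h : is_fourier (val f) (fourier (val f)).
  by apply: (@xgetPex _ 0 (is_fourier (val f))); exists (val g0); exact/is_fourierP.
by have [g2 _] := h; exists (toL2 g2) => //; exact/is_fourierP.
Qed.

Lemma fourier_relD f g f' g' : fourier_rel f g -> fourier_rel f' g' ->
  fourier_rel (f + f') (g + g').
Proof.
move=> [u [w [hw uf wg]]] [u' [w' [hw' uf' wg']]].
exists (fun n => u n + u' n), (fun n => w n + w' n); split=> [n||].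
- exact: is_hatD.
- apply: (cvg0_le (fun n => hnorm_ge0 _ _) _ uf uf') => n.
  by rewrite opprD addrACA; exact: ler_hnormD.
- apply: (cvg0_le (fun n => hnorm_ge0 _ _) _ wg wg') => n.
  by rewrite opprD addrACA; exact: ler_hnormD.
Qed.

Lemma fourier_relZ a f g : fourier_rel f g -> fourier_rel (a *: f) (a *: g).
Proof.
move=> [u [w [hw uf wg]]].
exists (fun n => a *: u n), (fun n => a *: w n); split=> [n||].
- exact: is_hatZ.
- under eq_fun do rewrite -scalerBr (hnormZ hip).
  by rewrite -(mulr0 (cmod a)); exact: cvgMr.
- under eq_fun do rewrite -scalerBr (hnormZ hip).
  by rewrite -(mulr0 (cmod a)); exact: cvgMr.
Qed.

Lemma fourier_rel_norm f g : fourier_rel f g -> nrm g = nrm f.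
Proof.
have close (s : nat -> H) x : nrm (s n - x) @[n --> \oo] --> (0 : R) ->
    nrm (s n) @[n --> \oo] --> nrm x.
  move=> sx; apply/cvgrPdist_le => e e0.
  have [N hN] := cvg0_close (fun n => hnorm_ge0 _ _) sx e0.
  exists N => // n /hN; rewrite distrC; exact: le_trans (ler_dist_hnorm hip _ _).
move=> [u [w [hw /close uf /close wg]]].
have E : (fun n => nrm (w n)) = (fun n => nrm (u n)).
  by apply/funext => n; exact: hnorm_hat.
by rewrite E in wg; exact: (cvg_unique (@Rhausdorff R) wg uf).
Qed.

(** Polarization: equality of norms for f + a f', with a = 1 for the real part and a = i for the
    imaginary part. *)
Lemma fourier_rel_ip f g f' g' : fourier_rel f g -> fourier_rel f' g' ->
  ipL2 f f' = ipL2 g g'.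
Proof.
move=> hf hf'.
have key a : Re (ipL2 f (a *: f')) = Re (ipL2 g (a *: g')).
  have hZ := fourier_relZ a hf'.
  have := fourier_rel_norm (fourier_relD hf hZ) => /(congr1 (fun z => z ^+ 2)).
  rewrite (hnormD_sqr hip g (a *: g')) (hnormD_sqr hip f (a *: f')).
  rewrite (fourier_rel_norm hf) (fourier_rel_norm hZ).
  by move=> /addIr /addrI /mulfI h; apply/esym/h; rewrite pnatr_eq0.
apply: complex_ext; first by have := key 1; rewrite !scale1r.
have := key 'i%C; rewrite !(ipZr hip).
by move: (ipL2 _ _) (ipL2 _ _) => [x y] [x' y'] /=; lra.
Qed.

Definition translateL2 (k : int) f : H := toL2 (L2_translate k (L2funP f)).

Lemma cmeasurable_modulation (k : int) : cmeasurable (fun c : R => cis (- (2 * pi * k%:~R * c))).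
Proof. by under eq_fun do rewrite -mulNr; exact: cmeasurable_cis. Qed.

Lemma cmod_modulation (k : int) (c : R) : cmod (cis (- (2 * pi * k%:~R * c))) <= 1.
Proof. by rewrite cmod_cis. Qed.

Definition modulateL2 (k : int) g : H :=
  toL2 (L2Ml (cmeasurable_modulation k) (cmod_modulation k) (L2funP g)).

Lemma hnorm_translate k f : nrm (translateL2 k f) = nrm f.
Proof.
apply: (@pexpIrn _ 2); rewrite ?nnegrE ?hnorm_ge0 // !hnormL2_sqr.
have /L2P[_ if2] := L2funP f.
exact: (Rintegral_shift (- k%:~R) (rintegrable_measurable if2)).
Qed.

Lemma hnorm_modulate k g : nrm (modulateL2 k g) = nrm g.
Proof.
apply: (@pexpIrn _ 2); rewrite ?nnegrE ?hnorm_ge0 // !hnormL2_sqr.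
by apply: eq_Rintegral => c _ /=; rewrite cmodM cmod_cis mul1r.
Qed.

(** Translation and modulation are isometries, so they carry an approximating sequence to an
    approximating sequence. *)
Lemma fourier_rel_translate k f g : fourier_rel f g ->
  fourier_rel (translateL2 k f) (modulateL2 k g).
Proof.
move=> [u [w [hw uf wg]]].
exists (fun n => translateL2 k (u n)), (fun n => modulateL2 k (w n)); split=> [n||].
- have [iu wE] := hw n; split; first exact: (cintegrable_shift (- k%:~R)).
  apply/funext => c /=; rewrite wE.
  by rewrite -(fourier_integral_translate k c iu).
- have E : (fun n => nrm (translateL2 k (u n) - translateL2 k f)) = (fun n => nrm (u n - f)).
    apply/funext => n; rewrite -(hnorm_translate k (u n - f)); congr (hnorm _ _).
    exact: val_inj.
  by rewrite E.
- have E : (fun n => nrm (modulateL2 k (w n) - modulateL2 k g)) = (fun n => nrm (w n - g)).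
    apply/funext => n; rewrite -(hnorm_modulate k (w n - g)); congr (hnorm _ _).
    by apply: val_inj; apply/funext => c /=; rewrite [RHS]mulrBr.
  by rewrite E.
Qed.

Lemma L2_fourier (f : R -> C) : L2 f -> L2 (fourier f).
Proof. by move=> f2; have [g <- _] := fourier_spec (toL2 f2); exact: L2funP. Qed.

End FourierRelation.

(** [k] equals max(h, k) a.e., and the latter dominates [h] everywhere. *)
Lemma ae_le_Rintegral (R : realType) (h k : R -> R) : rintegrable h -> rintegrable k ->
  {ae (@lebesgue_measure R), forall x, h x <= k x} ->
  \int[@lebesgue_measure R]_x h x <= \int[@lebesgue_measure R]_x k x.
Proof.
move=> ih ik hk; pose m x := Num.max (h x) (k x).
have mm : measurable_fun setT m.
  by apply: measurable_maxr; exact: rintegrable_measurable.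
have mk : {ae (@lebesgue_measure R), forall x, k x = m x}.
  by apply: aeS hk => x xk; rewrite /m max_r.
have im := ae_eq_rintegrable mm mk ik.
rewrite (ae_eq_Rintegral (rintegrable_measurable ik) mm mk).
by apply: le_Rintegral => // x _; rewrite /m le_max lexx.
Qed.

(** * The Gram form of two families of translates *)

Section GramForm.
Context {R : realType}.
Local Notation mu := (@lebesgue_measure R).
Local Notation C := R[i].
Local Notation H := (L2fun R).
Local Notation nrm := (hnorm (@ipL2 R)).
Local Notation e := (expi (1 : R)).
Let hip := @ipL2_inner_product R.
Let D : set R := `[0, 1[%classic.

Lemma gram_fourier (j k : int) (f h : H) :
  ipL2 (translateL2 j f) (translateL2 k h) =
  cintegral (fun c => e (k - j) c * (fourier (val f) c * (fourier (val h) c)^*)).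
Proof.
have [g gE hg] := fourier_spec f; have [g' gE' hg'] := fourier_spec h.
rewrite (fourier_rel_ip (fourier_rel_translate j hg) (fourier_rel_translate k hg')).
rewrite /ipL2 /inner; congr cintegral; apply/funext => c /=.
rewrite -gE -gE' rmorphM /= -cisN opprK.
have -> : e (k - j) c = cis (- (2 * pi * j%:~R * c)) * cis (2 * pi * k%:~R * c).
  by rewrite /expi -cisD; congr cis; rewrite rmorphB /= divr1; ring.
ring.
Qed.

Lemma expi_periodic (k : int) (x : R) (n : int) : e k (x + n%:~R * 1) = e k x.
Proof.
rewrite /expi mulrDr cisD; have -> : 2 * pi * k%:~R / 1 * (n%:~R * 1) = 2 * pi * (k * n)%:~R :> R.
  by rewrite intrM divr1 mulr1; ring.
by rewrite cis2pi mulr1.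
Qed.

(** [B] is an integrable version of the bracket on one period, extended by 0; the last clause says
    that its Fourier coefficients are the mixed Gram entries of the translates. *)
Definition is_bracket (f h : H) (B : R -> C) :=
  [/\ cintegrable B, forall x, ~ D x -> B x = 0,
   {ae mu, forall x, D x -> csum (fun n : int =>
      fourier (val f) (x + n%:~R) * (fourier (val h) (x + n%:~R))^*) (B x)} &
   forall j k, ipL2 (translateL2 j f) (translateL2 k h) =
      cintegral (fun c => e (k - j) c * B c)].

Lemma is_bracket_exists f h : exists B, is_bracket f h B.
Proof.
have iF : cintegrable (fun c => fourier (val f) c * (fourier (val h) c)^*).
  by apply: inner_cintegrable; apply: L2_fourier; exact: L2funP.
have [B [iB B0 hB mB]] := periodize_cintegral ltr01 iF.
exists B; split=> //.
  apply: aeS hB => x h' Dx; have := h' Dx; congr csum; apply/funext => n.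
  by rewrite mulr1.
move=> j k; rewrite gram_fourier; apply: (mB _ 1).
- exact: cmeasurable_expi.
- by move=> x; rewrite cmod_expi.
- by move=> x n; exact: expi_periodic.
Qed.

(** Conjugated because translation by [j] multiplies the transform by the conjugate of [e j]: this
    is the factor A in the transform of [comb f s]. *)
Definition trig (s : seq (int * C)) (c : R) : C := \sum_(q <- s) q.2 * (e q.1 c)^*.

Definition comb (f : H) (s : seq (int * C)) : H := \sum_(q <- s) q.2 *: translateL2 q.1 f.

Lemma cmeasurable_trig s : cmeasurable (trig s).
Proof.
apply: cmeasurable_sum => q; apply: cmeasurableZ; apply: cmeasurableJ.
exact: cmeasurable_expi.
Qed.

Lemma cmod_trig s c : cmod (trig s c) <= \sum_(q <- s) cmod q.2.
Proof.
apply: le_trans (cmod_sum _ _) _; apply: ler_sum => q _.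
by rewrite cmodM cmod_conj cmod_expi mulr1.
Qed.

(** Identifies the Fourier coefficients of A B with analysis coefficients, to which Bessel's
    inequality applies. *)
Lemma comb_coef f h B s k : is_bracket f h B ->
  ipL2 (comb f s) (translateL2 k h) = cintegral (fun c => e k c * (trig s c * B c)).
Proof.
move=> [iB _ _ hB]; rewrite /comb (ip_suml hip).
have iE j : cintegrable (fun c => e j c * B c).
  by apply: (cintegrableMl (cmeasurable_expi _ _) _ iB) => x; rewrite cmod_expi.
have -> : (fun c => e k c * (trig s c * B c)) =
    (fun c => \sum_(q <- s) q.2 * (e (k - q.1) c * B c)).
  apply/funext => c; rewrite /trig mulr_suml mulr_sumr; apply: eq_bigr => q _.
  by rewrite expiD expiN; ring.
rewrite cintegral_sum; last by move=> q; exact: cintegrableZ.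
by apply: eq_bigr => q _; rewrite (ipZl hip) hB cintegralZ.
Qed.

Lemma comb_ip f B s t : is_bracket f f B ->
  ipL2 (comb f s) (comb f t) = cintegral (fun c => trig s c * (trig t c)^* * B c).
Proof.
move=> hb; have [iB _ _ _] := hb; rewrite {2}/comb (ip_sumr hip).
have isB : cintegrable (fun c => trig s c * B c).
  exact: cintegrableMl (cmeasurable_trig s) (cmod_trig s) iB.
have iE j : cintegrable (fun c => e j c * (trig s c * B c)).
  by apply: (cintegrableMl (cmeasurable_expi _ _) _ isB) => x; rewrite cmod_expi.
have -> : (fun c => trig s c * (trig t c)^* * B c) =
    (fun c => \sum_(q <- t) (q.2)^* * (e q.1 c * (trig s c * B c))).
  apply/funext => c; rewrite {2}/trig rmorph_sum mulr_sumr mulr_suml; apply: eq_bigr => q _.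
  by rewrite rmorphM /= conjCK; ring.
rewrite cintegral_sum; last by move=> q; exact: cintegrableZ.
by apply: eq_bigr => q _; rewrite (ipZr hip) (comb_coef _ _ hb) cintegralZ.
Qed.

(** The finite sums are real and nonnegative, and zero as soon as the periodization is; each
    property survives the limit. *)
Lemma bracket_self f B : is_bracket f f B ->
  {ae mu, forall c, [/\ 0 <= Re (B c), Im (B c) = 0 &
     (periodization (fourier (val f)) c = 0%E -> B c = 0)]}.
Proof.
move=> [_ B0 hB _]; apply: aeS hB => c hc.
have [Dc|/B0 ->] := pselect (D c); last by split=> //=.
have {}hc := hc Dc.
have r0 (J : {fset int}) : \sum_(k <- J) (fourier (val f) (c + k%:~R) * (fourier (val f) (c + k%:~R))^*)
   = (\sum_(k <- J) cmod (fourier (val f) (c + k%:~R)) ^+ 2)%:C.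
  by rewrite rmorph_sum; apply: eq_bigr => k _; rewrite mulcJ.
split.
- rewrite leNgt; apply/negP => neg.
  have [J hJ] := hc (- Re (B c) / 2) ltac:(by rewrite divr_gt0 ?oppr_gt0).
  have := hJ J (fsubset_refl _); rewrite r0.
  move=> /(le_trans (ler_Re_cmod _)); rewrite cReB /= => /(le_trans (ler_norm _)).
  have : 0 <= \sum_(k <- J) cmod (fourier (val f) (c + k%:~R)) ^+ 2.
    by apply: sumr_ge0 => k _; exact: sqr_ge0.
  by move: (\sum_(k <- J) _) (Re _) neg => S b; lra.
- apply/eqP; rewrite -normr_eq0 eq_le normr_ge0 andbT; apply/ler_addgt0Pr => d d0.
  have [J hJ] := hc d d0.
  have := hJ J (fsubset_refl _); rewrite r0 add0r.
  by move=> /(le_trans (ler_Im_cmod _)); rewrite cImB /= sub0r normrN.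
move=> P0; apply: (csum_unique hc) => d d0; exists fset0 => J _.
have z k : fourier (val f) (c + k%:~R) = 0.
  have := @le_esum_fset R int (fun k => ((cmod (fourier (val f) (c + k%:~R))) ^+ 2)%:E) [fset k]%fset.
  rewrite big_seq_fset1 -[X in (_ <= X)%E]/(periodization (fourier (val f)) c) P0.
  move=> /(_ (fun k => ltac:(by rewrite lee_fin sqr_ge0))); rewrite lee_fin => h.
  apply: cmod_eq0; apply/eqP; rewrite -sqrf_eq0 eq_le h sqr_ge0 //.
by rewrite big1 ?subrr ?cmod0 ?ltW // => k _; rewrite z mul0r.
Qed.

Lemma form_bound (f h : H) (K M : R) s t : 0 <= K ->
  bessel_on (@ipL2 R) (fun=> True) M (translateL2^~ h) ->
  bessel_on (@ipL2 R) (fun=> True) M (translateL2^~ f) ->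
  {ae mu, forall c, periodization (fourier (val f)) c <> 0%E ->
    cmod (bracket (fourier (val f)) (fourier (val h)) c - 1) <= K} ->
  exists2 q, csum (fun k : int => ipL2 (comb f s) (translateL2 k h) *
       ipL2 (translateL2 k f) (comb f t)) q &
    cmod (ipL2 (comb f s) (comb f t) - q) <= K * nrm (comb f s) * nrm (comb f t).
Proof.
move=> K0 bh bf hK.
have [P hP] := is_bracket_exists f f; have [B hB] := is_bracket_exists f h.
have [iP P0 _ _] := hP; have [iB B0 cB _] := hB.
have mP := cintegrable_measurable iP; have mB := cintegrable_measurable iB.
pose U c := trig s c * B c; pose V c := trig t c * P c.
have iU : cintegrable U by exact: cintegrableMl (cmeasurable_trig s) (cmod_trig s) iB.
have iV : cintegrable V by exact: cintegrableMl (cmeasurable_trig t) (cmod_trig t) iP.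
have sD : (`[0, 0 + 1[%classic : set R) = D by rewrite add0r.
have sU : supported 1 0 U by move=> x; rewrite sD => Dx; rewrite /U B0 ?mulr0.
have sV : supported 1 0 V by move=> x; rewrite sD => Dx; rewrite /V P0 ?mulr0.
have pc1 X k : pcoef (1 : R) X k = cintegral (fun c => e k c * X c).
  by rewrite /pcoef sqrtr1 invr1 mul1r.
have cU k : pcoef (1 : R) U k = ipL2 (comb f s) (translateL2 k h).
  by rewrite pc1 (comb_coef _ _ hB).
have cV k : pcoef (1 : R) V k = ipL2 (comb f t) (translateL2 k f).
  by rewrite pc1 (comb_coef _ _ hP).
(* The Bessel bounds are the source of the square integrability of [U] and [V] obtained below. *)
have ssU : sq_summable (pcoef (1 : R) U).
  exists (M * nrm (comb f s) ^+ 2) => J; under eq_bigr do rewrite cU; exact: bh.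
have ssV : sq_summable (pcoef (1 : R) V).
  exists (M * nrm (comb f t) ^+ 2) => J; under eq_bigr do rewrite cV; exact: bf.
have [U2 pU] := parseval_L1 ltr01 iU sU ssU.
have [V2 _] := parseval_L1 ltr01 iV sV ssV.
exists (inner U V).
  have := pU (toL2 V2); congr csum; apply/funext => k; rewrite cU; congr (_ * _).
  rewrite (ipJ hip (toL2 V2)) pcoefE (supportedE sV) cV.
  by rewrite -(ipJ hip).
have mA := cmeasurable_trig s; have mA' := cmeasurable_trig t.
(* The density |A|^2 Phi, whose integral is the squared norm of the combination. *)
pose alpha r c := cmod (trig r c) ^+ 2 * Re (P c).
have ialpha r : rintegrable (alpha r) /\ \int[mu]_c alpha r c = nrm (comb f r) ^+ 2.
  have icc : cintegrable (fun c => trig r c * (trig r c)^* * P c).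
    under eq_fun do rewrite -mulrA.
    apply: (cintegrableMl (cmeasurable_trig r) (cmod_trig r)).
    apply: (@cintegrableMl _ (\sum_(q <- r) cmod q.2) _ _ _ _ iP).
      by apply: cmeasurableJ; exact: cmeasurable_trig.
    by move=> c; rewrite cmod_conj cmod_trig.
  have E : alpha r = fun c => Re (trig r c * (trig r c)^* * P c).
    by apply/funext => c; rewrite mulcJ cReZ.
  rewrite E; split; first by case: icc.
  by rewrite (hnorm_sqr hip) (comb_ip _ _ hP).
have iPc : cintegrable (fun c => trig s c * (trig t c)^* * P c).
  under eq_fun do rewrite -mulrA.
  apply: (cintegrableMl mA (cmod_trig s)).
  apply: (@cintegrableMl _ (\sum_(q <- t) cmod q.2) _ _ _ _ iP); first exact: cmeasurableJ.
  by move=> c; rewrite cmod_conj cmod_trig.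
have iUV : cintegrable (fun c => U c * (V c)^*) by exact: inner_cintegrable.
have -> : ipL2 (comb f s) (comb f t) - inner U V =
    cintegral (fun c => trig s c * (trig t c)^* * P c - U c * (V c)^*).
  by rewrite cintegralB // (comb_ip _ _ hP).
have iD := cintegrableB iPc iUV.
(* Cauchy-Schwarz for the weight Phi in additive form: for each [tau] it becomes a pointwise
   inequality between integrands. *)
apply: amgm_product => //; try exact: hnorm_ge0.
move=> tau tau0; apply: le_trans (cmod_cintegral_le iD) _.
have [i1 <-] := ialpha s; have [i2 <-] := ialpha t.
have i3 := rintegrableZ tau i1; have i4 := rintegrableZ tau^-1 i2.
have -> : K * (tau * \int[mu]_c alpha s c + (\int[mu]_c alpha t c) / tau) / 2 =
    \int[mu]_c (K / 2 * (tau * alpha s c + tau^-1 * alpha t c)).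
  rewrite RintegralZl //; last exact: rintegrableD.
  rewrite RintegralD // !RintegralZl //.
  by move: (\int[mu]_c _) (\int[mu]_c _) => x y; rewrite [x / tau]mulrC mulrAC.
apply: ae_le_Rintegral; first exact: cintegrable_cmod.
  by apply: rintegrableZ; exact: rintegrableD.
apply: aeS2 (aeS2 (fun c a b => Logic.conj a b) hK cB) (bracket_self hP) => c [hKc cBc] [rP iPc0 P00].
have PE : P c = (Re (P c))%:C by apply: complex_ext.
have rP0 := rP.
have -> : trig s c * (trig t c)^* * P c - U c * (V c)^* =
    (trig s c * (trig t c)^* * P c) * (1 - B c).
  rewrite /U /V rmorphM /=.
  have -> : (P c)^* = P c by rewrite PE; apply: complex_ext; rewrite ?cReJ ?cImJ /= ?oppr0.
  ring.
rewrite !cmodM cmod_conj.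
have aP : cmod (P c) = Re (P c) by rewrite {1}PE cmod_real ger0_norm.
rewrite aP /alpha.
(* Off the period and on the zero set of the periodization, Phi kills both sides; elsewhere on the
   period [B c] is the bracket and the hypothesis applies. *)
have bnd : Re (P c) * cmod (1 - B c) <= Re (P c) * K.
  have [Dc|/P0 ->] := pselect (D c); last by rewrite /= !mul0r.
  have [per0|pern] := pselect (periodization (fourier (val f)) c = 0%E).
    by rewrite P00 //= !mul0r.
  rewrite ler_wpM2l // cmodC; have := hKc pern.
  by rewrite /bracket (zsum_csum (cBc Dc)).
have a0 := cmod_ge0 (trig s c); have b0 := cmod_ge0 (trig t c).
move: (cmod (trig s c)) (cmod (trig t c)) (cmod (1 - B c)) (Re (P c)) a0 b0 bnd rP0
  => x y z r x0 y0 hz r0.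
rewrite -mulrA; apply: (@le_trans _ _ (x * y * (r * K))).
  by rewrite ler_wpM2l // mulr_ge0.
have am : x * y <= 2^-1 * (tau * x ^+ 2 + tau^-1 * y ^+ 2).
  have := sqr_ge0 (tau * x - y) => sq.
  rewrite -(ler_pM2l tau0).
  have -> : tau * (2^-1 * (tau * x ^+ 2 + tau^-1 * y ^+ 2)) = 2^-1 * (tau ^+ 2 * x ^+ 2 + y ^+ 2).
    by field; rewrite gt_eqF.
  nra.
have rK : 0 <= r * K by rewrite mulr_ge0.
by have := ler_wpM2r rK am; lra.
Qed.

End GramForm.

(** * Sums and frames of functions in terms of the abstract ones *)

Section L2Sums.
Context {R : realType}.
Local Notation C := R[i].
Local Notation H := (L2fun R).
Local Notation nrm := (hnorm (@ipL2 R)).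
Let hip := @ipL2_inner_product R.

Lemma val_partial_sum (c : int -> C) (F : int -> H) (J : {fset int}) :
  partial_sum (fun k => scalef (c k) (val (F k))) J =
  val (\sum_(k <- J) c k *: F k) :> (R -> C).
Proof.
rewrite /partial_sum big_seq_fsetE /=.
by apply/esym/(big_morph (fun x : H => val x : R -> C)).
Qed.

Lemma is_L2_sumP (c : int -> C) (F : int -> H) (s : H) :
  is_L2_sum (fun k => scalef (c k) (val (F k))) (val s) <->
  hsum (@ipL2 R) (fun k => c k *: F k) s.
Proof.
have E : (fun J => L2norm (partial_sum (fun k => scalef (c k) (val (F k))) J - val s : R -> C))
    = (fun J : {fset int} => (nrm (\sum_(k <- J) c k *: F k - s))%:E).
  by apply/funext => J; rewrite val_partial_sum -L2norm_hnorm.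
split=> [[_]|hs].
  rewrite E => /fine_cvg /cvgrPdist_le h e e0; have [J _ hJ] := h e e0.
  exists J => K /hJ /=; rewrite sub0r normrN; exact: le_trans (ler_norm _).
split; first exact: L2funP.
rewrite E; apply: cvg_EFin; first exact: nearW.
apply/cvgrPdist_le => e e0; have [J hJ] := hs e e0; exists J => // K /hJ /=.
by rewrite sub0r normrN ger0_norm ?hnorm_ge0.
Qed.

Lemma L2norm_sqr (x : H) : (L2norm (val x) ^+ 2 = (nrm x ^+ 2)%:E)%E.
Proof. by rewrite L2norm_hnorm. Qed.

(** Restates the extended-real frame inequalities through finite sums: an upper bound for every
    finite set, and a lower bound attained up to [e] by some finite set. *)
Lemma frame_bounds (W : set (R -> C)) (F : int -> H) :
  frame W (fun k => val (F k)) ->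
  (forall k, W (val (F k))) /\ exists a b : R, [/\ 0 < a, a <= b,
    bessel_on (@ipL2 R) (fun x => W (val x)) b F &
    forall x : H, W (val x) -> forall e, 0 < e ->
      exists J : {fset int}, a * nrm x ^+ 2 <= \sum_(k <- J) cmod (ipL2 x (F k)) ^+ 2 + e].
Proof.
move=> [WF [a [b [a0 ab h]]]]; split=> //; exists a, b.
have t0 (x : H) (k : int) : (0 <= (cmod (inner (val x) (val (F k))) ^+ 2)%:E)%E.
  by rewrite lee_fin sqr_ge0.
split=> //.
- move=> x J Wx; have [_] := h _ Wx; rewrite L2norm_sqr -EFinM => hb.
  by rewrite -lee_fin -sumEFin; exact: le_trans (le_esum_fset J (t0 x)) hb.
- move=> x Wx e e0; apply: contrapT => nJ; have [+ _] := h _ Wx.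
  rewrite L2norm_sqr -EFinM; apply/negP; rewrite -ltNge.
  apply: (@le_lt_trans _ _ (a * nrm x ^+ 2 - e)%:E); last by rewrite lte_fin gtrBl.
  apply: esum_le_fset => J; rewrite sumEFin lee_fin lerBrDr leNgt; apply/negP => hlt.
  by apply: nJ; exists J; exact: ltW.
Qed.

End L2Sums.

Theorem corollary8p1 (R : realType) (W V : set (R -> R[i]))
  (hW : closed_subspace W) (hV : closed_subspace V)
  (hWV : L2_direct_sum W (orthocomp V))
  (phi phit : R -> R[i]) (hphi : L2 phi) (hphit : L2 phit)
  (frame_phi : frame W (fun k : int => translate k phi))
  (frame_phit : frame V (fun k : int => translate k phit))
  (eps : R) (heps : 0 <= eps)
  (hbracket : {ae (@lebesgue_measure R), forall gamma : R,
     (~` zero_set (periodization (fourier phi))) gamma ->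
     ((cmod (bracket (fourier phi) (fourier phit) gamma - 1))%:E
        <= eps%:E / opnorm (oblique_proj W (orthocomp V)))%E}) :
  approx_oblique_dual_frames eps W V
    (fun k : int => translate k phi) (fun k : int => translate k phit).
Proof.
have hip := @ipL2_inner_product R.
pose F k := translateL2 k (toL2 hphi); pose G k := translateL2 k (toL2 hphit).
have [WF [a [M [a0 aM bF lF]]]] := @frame_bounds R W F frame_phi.
have [VG [a' [M' [a'0 aM' bG _]]]] := @frame_bounds R V G frame_phit.
have M0 : 0 < M by exact: lt_le_trans aM.
have M'0 : 0 < M' by exact: lt_le_trans aM'.
have WD (x y : L2fun R) : W (val x) -> W (val y) -> W (val (x + y)).
  exact: (subspaceD hW).
have WZ (z : R[i]) (x : L2fun R) : W (val x) -> W (val (z *: x)).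
  exact: (subspaceZ hW).
have W0 : W (val (0 : L2fun R)) by exact: (subspace0 hW).
have VD (x y : L2fun R) : V (val x) -> V (val y) -> V (val (x + y)).
  exact: (subspaceD hV).
have VZ (z : R[i]) (x : L2fun R) : V (val x) -> V (val (z *: x)).
  exact: (subspaceZ hV).
have V0 : V (val (0 : L2fun R)) by exact: (subspace0 hV).
have cW (v : nat -> L2fun R) (l : L2fun R) : (forall n, W (val (v n))) ->
    (forall e, 0 < e -> exists N, forall n, (N <= n)%N -> hnorm (@ipL2 R) (v n - l) <= e) ->
    W (val l).
  move=> Wv vl; apply: (closed_lim hW (u := fun n => val (v n)) Wv (L2funP l)).
  by apply/L2norm_cvg0; apply: close_cvg0 => // n; exact: hnorm_ge0.
have sF := bessel_bounded_synthesis hip M0 WD WZ W0 WF bF.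
have sG := bessel_bounded_synthesis hip M'0 VD VZ V0 VG bG.
have bF' := bounded_synthesis_bessel hip M0 sF.
have bG' := bounded_synthesis_bessel hip M'0 sG.
have sq w : sq_summable (fun k => ipL2 w (G k)).
  by exists (M' * hnorm (@ipL2 R) w ^+ 2) => J; exact: bG'.
(* [K] stays free: it will be eps / |P| when the norm of the projection is finite and 0 when it is
   infinite. *)
have defect K : 0 <= K ->
    {ae (@lebesgue_measure R), forall c, periodization (fourier phi) c <> 0%E ->
      cmod (bracket (fourier phi) (fourier phit) c - 1) <= K} ->
    forall w s : L2fun R, W (val w) -> hsum (@ipL2 R) (fun k => ipL2 w (G k) *: F k) s ->
    hnorm (@ipL2 R) (w - s) <= K * hnorm (@ipL2 R) w.
  move=> K0 hK; apply: (dual_defect_bound hip a0 aM M'0 K0 (@ipL2_complete R)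
    WD WZ W0 WF cW bF lF sG).
  move=> w h [s ->] [t ->].
  have bM0 : bessel_on (@ipL2 R) (fun=> True) (Num.max M M') F.
    move=> x J _; apply: le_trans (bF' x J I) _.
    by rewrite ler_wpM2r ?sqr_ge0 // le_max lexx.
  have bM1 : bessel_on (@ipL2 R) (fun=> True) (Num.max M M') G.
    move=> x J _; apply: le_trans (bG' x J I) _.
    by rewrite ler_wpM2r ?sqr_ge0 // le_max lexx orbT.
  exact: (form_bound s t K0 bM1 bM0 hK).
(* Settles a null [P f] without the bracket: its coefficients vanish by Bessel's inequality, hence
   so does the norm of the sum. *)
have defect0 (w s : L2fun R) : hnorm (@ipL2 R) w = 0 ->
    hsum (@ipL2 R) (fun k => ipL2 w (G k) *: F k) s -> hnorm (@ipL2 R) (w - s) <= 0.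
  move=> w0 hs; apply: le_trans (ler_hnormB hip w s) _; rewrite w0 add0r.
  rewrite -(mulr0 (Num.sqrt M)); apply: (hsum_bound hip M0 sF _ (lexx 0) hs) => J.
  by apply: le_trans (bG' w J I) _; rewrite w0 expr0n mulr0.
split=> //; apply: ge_ereal_sup => _ [f [f2 f1] <-].
set P := oblique_proj W (orthocomp V) in hbracket *.
set N := opnorm P in hbracket.
have [WP OP] : W (P f) /\ orthocomp V (f - P f).
  have [b [c [Wb Oc fE]]] := hWV.1 f f2.
  apply: (@xgetPex _ 0 [set a | W a /\ orthocomp V (f - a)]); exists b; split=> //.
  by rewrite fE addrC addKr.
have P2 := subspace_L2 hW WP; pose w := toL2 P2.
have wN : ((hnorm (@ipL2 R) w)%:E <= N)%E.
  by rewrite -L2norm_hnorm; apply: ereal_sup_ubound; exists f.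
have cE : analysis_op (fun k => translate k phit) f = fun k => ipL2 w (G k).
  apply/funext => k; have := OP.2 _ (VG k).
  rewrite -[inner _ _]/(ipL2 (toL2 f2 - w) (G k)) (ipBl hip) => /eqP.
  by rewrite subr_eq0 => /eqP.
set s := synthesis_op _ _.
have : is_L2_sum (fun k => scalef (ipL2 w (G k)) (translate k phi)) s.
  rewrite /s cE; have [t ht] := hsum_exists hip M0 (@ipL2_complete R) sF (sq w).
  apply: (@xgetPex _ 0 [set u | is_L2_sum (fun k => scalef (ipL2 w (G k)) (translate k phi)) u]).
  by exists (val t); exact: ((is_L2_sumP (fun k => ipL2 w (G k)) F t).2 ht).
move=> hs; have s2 := hs.1; have {}hs := (is_L2_sumP (fun k => ipL2 w (G k)) F (toL2 s2)).1 hs.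
rewrite -[L2norm _]/(L2norm (val (w - toL2 s2))) L2norm_hnorm lee_fin.
have [w0|wn0] := eqVneq (hnorm (@ipL2 R) w) 0.
  exact: le_trans (defect0 _ _ w0 hs) heps.
have wpos : 0 < hnorm (@ipL2 R) w by rewrite lt_neqAle eq_sym wn0 hnorm_ge0.
case: N => [r| |] in wN hbracket *; last by rewrite leeNy_eq in wN.
  (* A non-null [P f] with |f| <= 1 forces |P| > 0, so the extended inverse is the real one. *)
  have r0 : 0 < r by rewrite -lte_fin; apply: lt_le_trans wN.
  apply: (@le_trans _ _ (eps / r * hnorm (@ipL2 R) w)).
    apply: defect => //; first by rewrite divr_ge0 // ltW.
    by apply: aeS hbracket => c /[apply]; rewrite inver gt_eqF // -EFinM lee_fin.
  by rewrite mulrAC ler_pdivrMr // ler_wpM2l // -lee_fin.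
(* Infinite norm: the inverse of +oo is 0, so the bracket equals 1 a.e. off the zero set and the
   defect vanishes. *)
apply: (@le_trans _ _ (0 * hnorm (@ipL2 R) w)); last by rewrite mul0r.
apply: defect => //; apply: aeS hbracket => c /[apply].
by rewrite invey mule0 lee_fin.
Qed.
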